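(* Let $\mathbf{v}=(k,l)\in\mathbb{Z}^2$, let $$S_{\mathbf v}=\{(i,j)\in\mathbb{Z}^2: ik+jl\ge 0\text{ if } i<0,\ \ ik+jl>0\text{ if } i\ge0\},$$ and assume $(-1,0),(0,-1)\in S_{\mathbf v}$. Let $\{X_{(s,t)}\}_{(s,t)\in\mathbb{Z}^2}$ be a weak-stationary random field with no deterministic part with respect to the past $S_{\mathbf v}$. Let $U_1,U_2$ be the commuting unitary operators on $H=\overline{\mathrm{span}}\{X_{(s,t)}:(s,t)\in\mathbb{Z}^2\}$ with $U_1X_{(s,t)}=X_{(s-1,t)}$, $U_2X_{(s,t)}=X_{(s,t-1)}$, let $H^{(0,0)}=\overline{\mathrm{span}}\{X_{(s,t)}:(s,t)\in S_{\mathbf v}\}$, and let $V_1=U_1|_{H^{(0,0)}}$, $V_2=U_2|_{H^{(0,0)}}$ (isometries on $H^{(0,0)}$). Then there is a decomposition $H^{(0,0)}=H_t^{(0,0)}\oplus H_e^{(0,0)}$ such that: (1) $H_t^{(0,0)},H_e^{(0,0)}$ reduce $V_1,V_2$; (2) $(V_1|_{H_t^{(0,0)}},V_2|_{H_t^{(0,0)}})$ is a totally non-unitary pair (with respect to the semigroup $-S_{\mathbf v}$); (3) $(V_1|_{H_e^{(0,0)}},V_2|_{H_e^{(0,0)}})$ is a pair of generalized powers given by a cyclic unitary. Moreover, if $k,l$ are negative and relatively prime, and $p,q$ are integers with $pk+ql=-1$ and $-l\ge p>0\ge q>k$, then: (4) $(V_1|_{H_e^{(0,0)}},V_2|_{H_e^{(0,0)}})$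 is a pair of generalized powers given by the periodic diagram with period $J_0=\{(i,j)\in -S_{\mathbf v}:0\le i\le -l-1\}\cup\{(0,0)\}$ and integers $(m,n)=(-l,-k)$, the space $\mathcal{H}=\ker\big((V_1^* )^{p}V_2^{-q}\big)\cap H_e^{(0,0)}$, and the unitary $\mathcal{U}=(V_2^* )^{-k}V_1^{-l}|_{\mathcal H}$ (exponents $-k,-l,-q$ are non-negative), and $$H_e^{(0,0)}=\bigoplus_{(i,j)\in J_0}\overline{\mathrm{span}}\{\big((V_2^* )^{-k}V_1^{-l}\big)^{\kappa}V^{(i,j)}w:\kappa\ge0\},$$ where $w$ is a cyclic vector for $\mathcal{U}$; (5) $(V_1|_{H_t^{(0,0)}},V_2|_{H_t^{(0,0)}})$ is a pair given by the diagram $-S_{\mathbf v}\cup\{(0,0)\}$, and $$H_t^{(0,0)}=\bigoplus_{(i,j)\in -S_{\mathbf v}\cup\{(0,0)\}}V^{(i,j)}\ker\big((V_1^* )^{-l}V_2^{-k}\big).$$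
   Context: A random field $\{X_{(s,t)}\}_{(s,t)\in\mathbb{Z}^2}$ (complex random variables on one probability space) is weak-stationary if $\mathbb{E}|X_{(s,t)}|^2<\infty$, $\mathbb{E}X_{(s,t)}$ does not depend on $(s,t)$, and $\mathbb{E}[X_{(s,t)}\overline{X_{(s,t)+(p,q)}}]=\gamma(p,q)$ depends only on $(p,q)$. It is considered in the Hilbert space $L^2$ with inner product $\langle X,Y\rangle=\mathbb{E}[X\overline Y]$. For a past $S\subset\mathbb{Z}^2$ put $H^{(i,j)}=\overline{\mathrm{span}}\{X_{(s,t)}:(s-i,t-j)\in S\}$. The field has no deterministic part if $\bigcap_{(i,j)\in\mathbb{Z}^2}H^{(i,j)}=\{0\}$ (equivalently, no non-zero subspace reduces $(V_1,V_2)$ to a pair of unitary operators). $-S=\{(i,j):(-i,-j)\in S\}$. For commuting isometries $(V_1,V_2)$ put $V^{(m,n)}=V_1^mV_2^n$ if $m,n\ge0$, $V^{(m,n)}=(V_1^* )^{|m|}V_2^n$ if $m<0\le n$, and $V^{(m,n)}=(V_2^* )^{|n|}V_1^m$ if $n<0\le m$. Let $T\subset\mathbb{Z}^2$ be a semigroup with $T\cap(-T)=\emptyset$ containing all pairs of positive integers (here $T=-S$), and let $(V_1,V_2)$ be a commuting pair of isometries on a Hilbert space $G$ such that $V^{(m,n)}$ is an isometry for all $(m,n)\in T$. The pair is quasi-unitary (with respect to $T$) if the closure of $\bigcup V^{(k,l)*}V^{(m,n)}G$, union over $(k,l),(m,n)\in T$ with $(m,n)-(k,l)\in T$, equals $G$.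 It is totally non-unitary if no non-trivial subspace reduces $(V_1,V_2)$ to a quasi-unitary pair. A diagram is a set $J\subset\mathbb{Z}^2$ with $J+(\mathbb{Z}_{\ge0})^2\subset J$. For a Hilbert space $\mathcal{H}$, let $H_J=\{f\in L^2_{\mathcal H}(\mathbb{T}^2):\hat f_{i,j}=0 \text{ for }(i,j)\notin J\}$. A pair of isometries is given by the diagram $J$ (and the space $\mathcal{H}$) if it is unitarily equivalent to $(M_{z_1}|_{H_J},M_{z_2}|_{H_J})$, multiplications by the coordinate functions. A diagram $J$ is periodic if there are integers $m\ge1$, $n\ge0$ such that, with $J_0=(\{0,\dots,m-1\}\times\mathbb{Z})\cap J$ and $J_\kappa=(\kappa m,-\kappa n)+J_0$ for $\kappa\in\mathbb{Z}$, $J$ is the disjoint union of the $J_\kappa$; $J_0$ is called the period. Given a periodic diagram with period $J_0$ and integers $(m,n)$, and a unitary $\mathcal{U}$ on a Hilbert space $\mathcal{H}$, the pair of generalized powers given by these data is the pair $(V_1,V_2)$ (up to unitary equivalence) on the Hilbert space of square-summable families $\mathbf{u}=\{u_{(i,j)}\}_{(i,j)\in J_0}$ in $\mathcal{H}$ defined, with the convention $u_{(i,j)}=0$ for $(i,j)\notin J_0$, by $(V_1\mathbf{u})_{(0,j)}=\mathcal{U}u_{(m-1,j-n)}$, $(V_1\mathbf{u})_{(i,j)}=u_{(i-1,j)}$ for $1\le i\le m-1$, and $(V_2\mathbf{u})_{(i,j)}=u_{(i,j-1)}$, for $(i,j)\in J_0$. It is given by a cyclic unitary if $\mathcal{U}$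 has a cyclic vector, i.e. a vector $w$ with $\overline{\mathrm{span}}\{\mathcal{U}^\kappa w:\kappa\ge0\}=\mathcal{H}$. *)

(* Defs.v *)
From HB Require Import structures.
From mathcomp Require Import all_boot all_order all_algebra.
From mathcomp Require Import generic_quotient ring_quotient sesquilinear.
From mathcomp Require Import all_classical all_reals all_analysis.
From mathcomp Require Import measurable_realfun ring lra.
Set Implicit Arguments.
Unset Strict Implicit.
Unset Printing Implicit Defensive.
Import Order.TTheory GRing.Theory Num.Theory.
Import numFieldNormedType.Exports.
(* Required last, so that Re and Im are the projections of R[i]. *)
From mathcomp Require Import complex.
Local Open Scope classical_set_scope.
Local Open Scope ring_scope.

(* Complex inner product spaces, linear in the first argument. The norm of a
   normed module over R[i] takes its values in R[i]. *)
HB.mixin Record NormedModule_isInner (R : realType) V & NormedModule R[i] V := {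
  inner : {dot V for (@Num.conj R[i])};
  innerxx : forall x : V, inner x x = `|x| ^+ 2
}.

#[short(type="innerType")]
HB.structure Definition Inner (R : realType) :=
  {V of NormedModule R[i] V & NormedModule_isInner R V}.

HB.factory Record Lmodule_isInner (R : realType) V & GRing.Lmodule R[i] V := {
  form : {dot V for (@Num.conj R[i])}
}.

HB.builders Context R V & Lmodule_isInner R V.

Let nrm (x : V) : R[i] := sqrtC (form x x).

Let nrm2 x : nrm x ^+ 2 = form x x.
Proof. by rewrite /nrm sqrtCK. Qed.

Let nrm_ge0 x : 0 <= nrm x.
Proof. exact: sqrt_dnorm_ge0. Qed.

Let CauchySchwarz (x y : V) : `|form x y| <= nrm x * nrm y.
Proof.
rewrite -(@ler_sqr R[i]) ?nnegrE ?mulr_ge0// exprMn !nrm2.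
have [->|y0] := eqVneq y 0; first by rewrite [form x 0]linear0r [form 0 0]linear0r normr0 expr0n mulr0.
have Hy : 0 < form y y by rewrite dnorm_gt0.
have := dnorm_ge0 form (form y y *: x - form x y *: y).
rewrite dnormB !dnormZ linearZl_LR linearZr_LR /=.
rewrite (gtr0_norm Hy).
have -> : form y y * (Num.conj (form x y) * form x y) =
    form y y * `|form x y| ^+ 2 by rewrite normCK [X in form y y * X]mulrC.
rewrite rmorphM rmorphXn /= conj_normC.
have -> : Num.conj (form y y) = form y y by apply/CrealP/gtr0_real.
set N := `|form x y| ^+ 2.
have -> : form y y ^+ 2 * form x x + N * form y y -
    (form y y * N + form y y * N) = form y y * (form x x * form y y - N) by ring.
by rewrite pmulr_rge0// subr_ge0.
Qed.

Let nrmD x y : nrm (x + y) <= nrm x + nrm y.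
Proof.
rewrite -(@ler_sqr R[i]) ?nnegrE ?addr_ge0// sqrrD !nrm2 dnormD.
rewrite [leRHS]addrAC lerD2l.
have -> : form x y + Num.conj (form x y) = 2 * 'Re (form x y).
  by rewrite [in RHS]ReE mulrC divfK// pnatr_eq0.
rewrite -[leRHS]mulr_natl ler_pM2l// (le_trans _ (CauchySchwarz x y))//.
exact: (leif_Re_Creal (form x y)).1.
Qed.

Let nrmZ (l : R[i]) x : nrm (l *: x) = `|l| * nrm x.
Proof. by rewrite /nrm dnormZ rootCMl ?exprn_ge0// sqrCK. Qed.

Let nrm0_eq0 x : nrm x = 0 -> x = 0.
Proof. by move=> /eqP; rewrite sqrt_dnorm_eq0 => /eqP. Qed.

HB.instance Definition _ :=
  Lmodule_isNormed.Build R[i] V nrmD nrmZ nrm0_eq0.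

Let innerxx x : form x x = `|x| ^+ 2.
Proof. by rewrite -nrm2. Qed.

HB.instance Definition _ := NormedModule_isInner.Build R V innerxx.

HB.end.

(* The norm as an element of R; for z : R[i] it is the modulus. *)
Definition rnorm (R : realType) (V : normedZmodType R[i]) (x : V) : R :=
  Re `|x|.

Lemma rnorm2E (R : realType) (z : R[i]) : rnorm z ^+ 2 = Re z ^+ 2 + Im z ^+ 2.
Proof. by rewrite /rnorm normc_def /= sqr_sqrtr// addr_ge0// sqr_ge0. Qed.

Definition cmeasurable (R : realType) d (T : measurableType d) (D : set T)
    (f : T -> R[i]) : Prop :=
  measurable_fun D (fun x => Re (f x)) /\ measurable_fun D (fun x => Im (f x)).

Definition cintegral (R : realType) d (T : measurableType d)
    (mu : {measure set T -> \bar R}) (D : set T) (f : T -> R[i]) : R[i] :=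
  ((\int[mu]_(x in D) Re (f x)) +i* (\int[mu]_(x in D) Im (f x)))%C.

Section L2fun.
Context (R : realType) d (T : measurableType d) (mu : {measure set T -> \bar R}).
Implicit Types f g : T -> R[i].

Definition square_integrable f : Prop := cmeasurable setT f /\
  (\int[mu]_x (rnorm (f x) ^+ 2)%:E < +oo)%E.

Lemma le_integral_lty (f g : T -> R) :
  measurable_fun setT f -> measurable_fun setT g ->
  (forall x, 0 <= f x <= g x) ->
  (\int[mu]_x (g x)%:E < +oo)%E -> (\int[mu]_x (f x)%:E < +oo)%E.
Proof.
move=> mf mg fg; apply: le_lt_trans; apply: ge0_le_integral => //.
- by move=> x _; rewrite lee_fin; case/andP: (fg x).
- exact/measurable_EFinP.
- exact/measurable_EFinP.
- by move=> x _; rewrite lee_fin; case/andP: (fg x).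
Qed.

Lemma Lfun2P (h : T -> R) : h \in Lfun mu 2%:E <->
  measurable_fun setT h /\ (\int[mu]_x (h x ^+ 2)%:E < +oo)%E.
Proof.
split=> [fh|[mh ih]].
  have mh : measurable_fun setT h.
    by move: fh; rewrite inE => /andP[/[!inE]].
  split=> //; have /integrableP[_] := Lfun2_integrable_sqr fh.
  by under eq_integral => x _ do rewrite /= ger0_norm ?sqr_ge0//.
rewrite inE; apply/andP; split; rewrite inE//=.
rewrite /finite_norm unlock /= poweR_lty//.
under eq_integral => x _ do rewrite powR_mulrn// real_normK ?num_real//.
exact: ih.
Qed.

Lemma square_integrableP f : square_integrable f <->
  @Re R \o f \in Lfun mu 2%:E /\ @Im R \o f \in Lfun mu 2%:E.
Proof.
have m2 (h : T -> R) : measurable_fun setT h ->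
  measurable_fun setT (fun x => h x ^+ 2) by exact: measurable_funX.
rewrite /square_integrable /cmeasurable !Lfun2P.
under eq_integral => x _ do rewrite rnorm2E.
split=> [[[mr mi] fi]|[[mr ir] [mi ii]]].
  have mri : measurable_fun setT (fun x => Re (f x) ^+ 2 + Im (f x) ^+ 2).
    by apply: measurable_funD; exact: m2.
  by split; split=> //; apply: le_integral_lty mri _ fi => [|x];
    rewrite ?sqr_ge0 ?lerDl ?lerDr ?sqr_ge0//; exact: m2.
split; first by split.
under eq_integral => x _ do rewrite EFinD.
rewrite ge0_integralD//; first by rewrite lte_add_pinfty.
- by move=> x _; rewrite lee_fin sqr_ge0.
- by apply/measurable_EFinP; exact: m2.
- by move=> x _; rewrite lee_fin sqr_ge0.
- by apply/measurable_EFinP; exact: m2.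
Qed.

Definition sqint : {pred T -> R[i]} := fun f => `[< square_integrable f >].

Lemma Lfun2_linear (a : R) (h k : T -> R) : h \in Lfun mu 2%:E ->
  k \in Lfun mu 2%:E -> (fun x => a * h x + k x) \in Lfun mu 2%:E.
Proof.
have l2 : (1 <= 2%:E :> \bar R)%E by rewrite lee_fin ler1n.
exact: (Lfun_submod_closed mu l2).2.
Qed.

Lemma sqint_submod_closed : submod_closed sqint.
Proof.
have l2 : (1 <= 2%:E :> \bar R)%E by rewrite lee_fin ler1n.
split.
  apply/asboolP/square_integrableP.
  by split; exact: (Lfun_submod_closed mu l2).1.
move=> a f g /asboolP/square_integrableP[fr fi].
move=> /asboolP/square_integrableP[gr gi].
apply/asboolP/square_integrableP; split.
- rewrite (_ : _ \o _ = fun x => Re a * Re (f x) +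
      ((- Im a) * Im (f x) + Re (g x))).
    by do 2 apply: Lfun2_linear => //.
  apply/funext => x; rewrite /= !fctE.
  by case: a (f x) (g x) => [? ?] [? ?] [? ?] /=; ring.
- rewrite (_ : _ \o _ = fun x => Re a * Im (f x) +
      (Im a * Re (f x) + Im (g x))).
    by do 2 apply: Lfun2_linear => //.
  apply/funext => x; rewrite /= !fctE.
  by case: a (f x) (g x) => [? ?] [? ?] [? ?] /=; ring.
Qed.

HB.instance Definition _ := GRing.isSubmodClosed.Build R[i] (T -> R[i]) sqint
  sqint_submod_closed.

(* L^2(mu; C) is the space of square-integrable functions modulo the functions
   that vanish almost everywhere. *)
Record L2fun := MkL2fun { L2fun_val :> T -> R[i] ; _ : L2fun_val \in sqint }.

HB.instance Definition _ := [isSub for L2fun_val].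
HB.instance Definition _ := gen_eqMixin L2fun.
HB.instance Definition _ := [Choice of L2fun by <:].
HB.instance Definition _ := [SubChoice_isSubLmodule of L2fun by <:].

Definition ae_null : {pred L2fun} := fun u => `[< \forall x \ae mu, u x = 0 >].

Lemma ae_null_zmod_closed : zmod_closed ae_null.
Proof.
split; first by apply/asboolP; exact: aeW.
move=> u v /asboolP u0 /asboolP v0; apply/asboolP.
by apply: filterS2 u0 v0 => x /= ux vx; rewrite !fctE ux vx subrr.
Qed.
HB.instance Definition _ := GRing.isZmodClosed.Build L2fun ae_null ae_null_zmod_closed.

Definition L2 := Quotient.quot ae_null.
HB.instance Definition _ := Choice.on L2.
HB.instance Definition _ := GRing.Zmodule.on L2.
HB.instance Definition _ := EqQuotient.on L2.

End L2fun.

Section L2.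
Context (R : realType) d (T : measurableType d) (mu : {measure set T -> \bar R}).
Local Notation L2 := (L2 mu).
Local Open Scope quotient_scope.
Implicit Types (f g : L2fun mu) (u v w : L2).

Lemma pi_eqP f g : reflect (\forall x \ae mu, f x = g x) (\pi_L2 f == \pi_L2 g).
Proof.
rewrite -(Quotient.idealrBE (@ae_null R d T mu)).
apply: (iffP (asboolP _)); apply: filterS => x /=; rewrite !fctE.
  by move/eqP; rewrite subr_eq0 => /eqP.
by move=> ->; rewrite subrr.
Qed.

Lemma repr_pi f : \forall x \ae mu, repr (\pi_L2 f) x = f x.
Proof. by apply/pi_eqP; rewrite reprK. Qed.

Lemma piD f g : \pi_L2 (f + g) = \pi_L2 f + \pi_L2 g.
Proof. exact: (Quotient.pi_add (@ae_null R d T mu)). Qed.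

Lemma pi0 : \pi_L2 0 = 0.
Proof. by apply: (@addrI _ (\pi_L2 0)); rewrite -piD !addr0. Qed.

Definition scaleL2 (a : R[i]) u : L2 := \pi_L2 (a *: repr u).

Lemma scaleL2_pi a f : scaleL2 a (\pi_L2 f) = \pi_L2 (a *: f).
Proof.
apply/eqP/pi_eqP; have := repr_pi f; apply: filterS => x /= fx.
exact: (congr1 (GRing.mul a) fx).
Qed.

Lemma scaleL2A a b u : scaleL2 a (scaleL2 b u) = scaleL2 (a * b) u.
Proof. by rewrite -[u]reprK (scaleL2_pi b) !scaleL2_pi scalerA. Qed.

Lemma scale1L2 : left_id 1 scaleL2.
Proof. by move=> u; rewrite -[u]reprK scaleL2_pi scale1r. Qed.

Lemma scaleL2Dr : right_distributive scaleL2 +%R.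
Proof.
move=> a u v; rewrite -[u]reprK -[v]reprK -piD !scaleL2_pi scalerDr.
exact: piD.
Qed.

Lemma scaleL2Dl u : {morph scaleL2^~ u : a b / a + b}.
Proof. by move=> a b; rewrite -[u]reprK !scaleL2_pi scalerDl piD. Qed.

HB.instance Definition _ := GRing.Zmodule_isLmodule.Build R[i] L2
  scaleL2A scale1L2 scaleL2Dr scaleL2Dl.

Lemma repr_linear a u v :
  \forall x \ae mu, repr (a *: u + v) x = a * repr u x + repr v x.
Proof.
have -> : a *: u + v = \pi_L2 (a *: repr u + repr v).
  by rewrite piD reprK.
by have := repr_pi (a *: repr u + repr v); apply: filterS => x ->.
Qed.

Definition dotL2 u v : R[i] :=
  cintegral mu setT (fun x => repr u x * Num.conj (repr v x)).

Lemma L2fun_Lfun f : (@Re R \o f) \in Lfun mu 2%:E /\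
  (@Im R \o f) \in Lfun mu 2%:E.
Proof. by apply/square_integrableP; have /asboolP := valP f. Qed.

Lemma L2fun_int f g :
  mu.-integrable setT (fun x => (Re (f x * Num.conj (g x)))%:E) /\
  mu.-integrable setT (fun x => (Im (f x * Num.conj (g x)))%:E).
Proof.
have [fr fi] := L2fun_Lfun f; have [gr gi] := L2fun_Lfun g.
have rr := Lfun2_mul_Lfun1 fr gr; have ii := Lfun2_mul_Lfun1 fi gi.
have ri := Lfun2_mul_Lfun1 fr gi; have ir := Lfun2_mul_Lfun1 fi gr.
have {}rr := (Lfun1_integrable _ _).1 rr.
have {}ii := (Lfun1_integrable _ _).1 ii.
have {}ri := (Lfun1_integrable _ _).1 ri.
have {}ir := (Lfun1_integrable _ _).1 ir.
split.
  apply: eq_integrable (integrableD measurableT rr ii) => // x _.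
  by rewrite /= -EFinD; case: (f x) (g x) => [? ?] [? ?] /=; congr EFin; ring.
apply: eq_integrable (integrableB measurableT ir ri) => // x _.
by rewrite /= -EFinB; case: (f x) (g x) => [? ?] [? ?] /=; congr EFin; ring.
Qed.

Lemma cintegral_linear (a : R[i]) (F G : T -> R[i]) :
  mu.-integrable setT (fun x => (Re (F x))%:E) ->
  mu.-integrable setT (fun x => (Im (F x))%:E) ->
  mu.-integrable setT (fun x => (Re (G x))%:E) ->
  mu.-integrable setT (fun x => (Im (G x))%:E) ->
  cintegral mu setT (fun x => a * F x + G x) =
  a * cintegral mu setT F + cintegral mu setT G.
Proof.
move=> Fr Fi Gr Gi; rewrite /cintegral; case: a => a b.
have Z (r : R) (h : T -> R) : mu.-integrable setT (fun x => (h x)%:E) ->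
    mu.-integrable setT (EFin \o (fun x => r * h x)).
  by move=> ih; apply: eq_integrable (integrableZl measurableT r ih).
have D (h k : T -> R) : mu.-integrable setT (EFin \o h) ->
    mu.-integrable setT (EFin \o k) -> mu.-integrable setT (EFin \o (h \+ k)).
  by move=> ih ik; apply: eq_integrable (integrableD measurableT ih ik).
apply/eqP; rewrite eq_complex /=; apply/andP; split; apply/eqP.
  under eq_Rintegral => x _.
    rewrite (_ : Re _ = (a * Re (F x) + (- b) * Im (F x)) + Re (G x)); last first.
      by case: (F x) (G x) => [? ?] [? ?] /=; ring.
    over.
  rewrite RintegralD//; last by apply: D; exact: Z.
  rewrite RintegralD//; [|exact: Z..].
  by rewrite !RintegralZl// mulNr.
under eq_Rintegral => x _.
  rewrite (_ : Im _ = (a * Im (F x) + b * Re (F x)) + Im (G x)); last first.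
    by case: (F x) (G x) => [? ?] [? ?] /=; ring.
  over.
rewrite RintegralD//; last by apply: D; exact: Z.
rewrite RintegralD//; [|exact: Z..].
by rewrite !RintegralZl.
Qed.

Lemma ae_eq_cintegral (F G : T -> R[i]) :
  mu.-integrable setT (fun x => (Re (F x))%:E) ->
  mu.-integrable setT (fun x => (Im (F x))%:E) ->
  mu.-integrable setT (fun x => (Re (G x))%:E) ->
  mu.-integrable setT (fun x => (Im (G x))%:E) ->
  (\forall x \ae mu, F x = G x) -> cintegral mu setT F = cintegral mu setT G.
Proof.
move=> /integrableP[Fr _] /integrableP[Fi _] /integrableP[Gr _].
move=> /integrableP[Gi _] FG.
by rewrite /cintegral /Rintegral; congr (fine _ +i* fine _)%C;
  apply: ae_eq_integral => //; apply: filterS FG => x ->.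
Qed.

Lemma dotL2_conj u v : dotL2 u v = Num.conj (dotL2 v u).
Proof.
have [vur vui] := L2fun_int (repr v) (repr u).
rewrite /dotL2 /cintegral /=; apply/eqP; rewrite eq_complex /=.
apply/andP; split; apply/eqP.
  by apply: eq_Rintegral => x _; case: (repr u x) (repr v x) => [? ?] [? ?] /=; ring.
rewrite -mulN1r -RintegralZl//.
by apply: eq_Rintegral => x _; case: (repr u x) (repr v x) => [? ?] [? ?] /=; ring.
Qed.

Lemma dotL2_linear w : linear_for *%R (dotL2^~ w).
Proof.
move=> a u v; rewrite /dotL2.
have [uwr uwi] := L2fun_int (repr u) (repr w).
have [vwr vwi] := L2fun_int (repr v) (repr w).
rewrite -cintegral_linear//.
have [lr li] := L2fun_int (repr (a *: u + v)) (repr w).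
have [lr' li'] := L2fun_int (a *: repr u + repr v) (repr w).
have E x : (a *: repr u + repr v) x * Num.conj (repr w x) =
  a * (repr u x * Num.conj (repr w x)) + repr v x * Num.conj (repr w x).
  by rewrite mulrA -mulrDl.
apply: ae_eq_cintegral => //.
- by under eq_fun do rewrite -E.
- by under eq_fun do rewrite -E.
- by have := repr_linear a u v; apply: filterS => x ->; rewrite -E.
Qed.

Lemma dotL2_linearr w : linear_for (Num.conj \; *%R) (dotL2 w).
Proof.
move=> a u v; rewrite dotL2_conj dotL2_linear rmorphD rmorphM /=.
by rewrite -!dotL2_conj.
Qed.

Lemma dotL2_gt0 u : u != 0 -> 0 < dotL2 u u.
Proof.
have [ur ui] := L2fun_int (repr u) (repr u).
have E x : Re (repr u x * Num.conj (repr u x)) = rnorm (repr u x) ^+ 2.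
  by rewrite rnorm2E; case: (repr u x) => [? ?] /=; ring.
have Im0 : Im (dotL2 u u) = 0.
  have /(congr1 (@Im R)) := dotL2_conj u u.
  by case: (dotL2 u u) => p q /= ?; lra.
have ReE : (Re (dotL2 u u))%:E = (\int[mu]_x (rnorm (repr u x) ^+ 2)%:E)%E.
  rewrite /dotL2 /cintegral /= /Rintegral fineK ?integrable_fin_num//.
  by apply: eq_integral => x _; rewrite E.
move=> u0; rewrite ltcE Im0 eqxx andTb lt0r; apply/andP; split; last first.
  by rewrite -lee_fin ReE integral_ge0// => x _; rewrite lee_fin sqr_ge0.
apply: contra u0 => /eqP Re0; rewrite Re0 in ReE.
have mE : measurable_fun setT (fun x => (rnorm (repr u x) ^+ 2)%:E).
  by have /integrableP[+ _] := ur; under eq_fun do rewrite E.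
have : (\int[mu]_x `|(rnorm (repr u x) ^+ 2)%:E| = 0)%E.
  rewrite [RHS]ReE; apply: eq_integral => x _.
  by rewrite gee0_abs// lee_fin sqr_ge0.
move/(ae_eq_integral_abs mu measurableT mE) => u0.
rewrite -[u]reprK -pi0; apply/pi_eqP.
apply: filterS u0 => x /= /(_ I) [].
rewrite rnorm2E; case: (repr u x) => p q /= /eqP.
by rewrite paddr_eq0 ?sqr_ge0// !sqrf_eq0 => /andP[/eqP-> /eqP->].
Qed.

HB.instance Definition _ := bilinear_isBilinear.Build R[i] L2 L2 R[i]
  *%R (Num.conj \; *%R) dotL2 (dotL2_linear, dotL2_linearr).

Lemma dotL2_herm u v : dotL2 u v = (-1) ^+ false * Num.conj (dotL2 v u).
Proof. by rewrite mul1r dotL2_conj. Qed.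

HB.instance Definition _ := isHermitianSesquilinear.Build R[i] L2 false Num.conj
  dotL2 dotL2_herm.

HB.instance Definition _ := isDotProduct.Build R[i] L2 dotL2 dotL2_gt0.

HB.instance Definition _ := Lmodule_isInner.Build R L2 dotL2.

(* The class of f; it is 0 when f is not square-integrable. *)
Definition L2_class (f : T -> R[i]) : L2 := \pi_L2 (insubd (0 : L2fun mu) f).

End L2.

Section hilbert_space.
Context (R : realType) (E : innerType R).
Implicit Types (A G HH M N : set E) (V U : E -> E) (x y w : E).

Definition linear_span A : set E :=
  [set x | exists n (a : 'I_n -> R[i]) (v : 'I_n -> E),
    (forall i, A (v i)) /\ x = \sum_(i < n) a i *: v i].

Definition clspan A : set E := closure (linear_span A).

Definition linear_subspace G : Prop :=
  G 0 /\ forall (a : R[i]) x y, G x -> G y -> G (a *: x + y).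

Definition closed_subspace G : Prop := linear_subspace G /\ closed G.

(* Hilbert spaces are represented by complete subspaces of an inner product
   space, and operators on G by functions E -> E of which only the values on G
   matter. In particular the restriction of an operator is the same function
   considered on a smaller domain. *)
Definition hilbert_subspace G : Prop := linear_subspace G /\
  forall F : set_system E, ProperFilter F -> cauchy F -> F G ->
    exists2 x, G x & F --> x.

Definition isometry_on G V : Prop :=
  [/\ forall x, G x -> G (V x),
      forall (a : R[i]) x y, G x -> G y -> V (a *: x + y) = a *: V x + V y
    & forall x, G x -> `|V x| = `|x|].

Definition unitary_on G V : Prop := isometry_on G V /\ V @` G = G.

Definition commute_on G V1 V2 : Prop := forall x, G x -> V1 (V2 x) = V2 (V1 x).

(* The adjoint of V as an operator on G; on a Hilbert space G the vector
   selected here exists and is unique for every y in G. *)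
Definition adjoint G V y : E :=
  xget 0 [set z | G z /\ forall x, G x -> inner (V x) y = inner x z].

(* V^(m,n). The value for m, n < 0 is arbitrary: no such pair lies in a
   semigroup T satisfying isometry_semigroup. *)
Definition vpow G V1 V2 (mn : int * int) x : E :=
  match mn with
  | (Posz m, Posz n) => iter m V1 (iter n V2 x)
  | (Negz m, Posz n) => iter m.+1 (adjoint G V1) (iter n V2 x)
  | (Posz m, Negz n) => iter n.+1 (adjoint G V2) (iter m V1 x)
  | (Negz m, Negz n) => iter m.+1 (adjoint G V1) (iter n.+1 (adjoint G V2) x)
  end.

(* The semigroups T with respect to which quasi-unitary and totally non-unitary
   pairs are considered. *)
Definition isometry_semigroup (T : set (int * int)) : Prop :=
  [/\ forall u v, T u -> T v -> T (u + v),
      forall u, T u -> ~ T (- u)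
    & forall m n : int, 0 < m -> 0 < n -> T (m, n)].

Definition isometric_pair (T : set (int * int)) G V1 V2 : Prop :=
  [/\ isometry_semigroup T, isometry_on G V1, isometry_on G V2,
      commute_on G V1 V2
    & forall mn, T mn -> isometry_on G (vpow G V1 V2 mn)].

Definition quasi_unitary (T : set (int * int)) G V1 V2 : Prop :=
  isometric_pair T G V1 V2 /\
  closure [set y | exists kl mn x, [/\ T kl, T mn, T (mn - kl), G x &
    y = adjoint G (vpow G V1 V2 kl) (vpow G V1 V2 mn x)]] = G.

Definition reduces G V1 V2 M : Prop :=
  [/\ closed_subspace M, M `<=` G,
      forall x, M x -> M (V1 x) /\ M (V2 x)
    & forall x, M x -> M (adjoint G V1 x) /\ M (adjoint G V2 x)].

Definition totally_non_unitary (T : set (int * int)) G V1 V2 : Prop :=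
  isometric_pair T G V1 V2 /\
  forall M, reduces G V1 V2 M -> quasi_unitary T M V1 V2 -> M = [set 0].

Definition orthogonal_sum G M N : Prop :=
  [/\ closed_subspace M, closed_subspace N,
      forall x y, M x -> N y -> inner x y = 0
    & G = [set x + y | x in M & y in N]].

(* G is the Hilbert space direct sum of the M i, i in D. *)
Definition orthogonal_bigsum (I : Type) (D : set I) (M : I -> set E) G : Prop :=
  [/\ forall i, D i -> closed_subspace (M i),
      forall i j, D i -> D j -> i <> j ->
        forall x y, M i x -> M j y -> inner x y = 0
    & clspan (\bigcup_(i in D) M i) = G].

Definition cyclic_vector HH U w : Prop :=
  HH w /\ clspan [set iter kappa U w | kappa in [set: nat]] = HH.

End hilbert_space.

(* Unitary equivalence of the pair (V1, V2) on G with the pair (A1, A2) on the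
   Hilbert space presented by a set D of representatives with squared norm sq:
   representatives whose difference has norm 0 are identified. *)
Definition unitarily_equivalent (R : realType) (E : innerType R)
    (G : set E) (V1 V2 : E -> E) (F : lmodType R[i]) (D : set F)
    (sq : F -> \bar R) (A1 A2 : F -> F) : Prop :=
  exists W : E -> F,
    [/\ forall x, G x -> D (W x) /\ sq (W x) = (rnorm x ^+ 2)%:E,
        forall (a : R[i]) x y, G x -> G y ->
          sq (W (a *: x + y) - (a *: W x + W y)) = 0%E,
        forall f, D f -> exists2 x, G x & sq (W x - f) = 0%E
      & forall x, G x ->
          sq (W (V1 x) - A1 (W x)) = 0%E /\ sq (W (V2 x) - A2 (W x)) = 0%E].

Definition diagram (J : set (int * int)) : Prop :=
  forall i j m n : int, J (i, j) -> 0 <= m -> 0 <= n -> J (i + m, j + n).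

(* J is a periodic diagram with period J0 and integers (m, n). *)
Definition periodic_diagram (J : set (int * int)) (m n : int)
    (J0 : set (int * int)) : Prop :=
  let J_ (kappa : int) :=
    [set (kappa * m, - (kappa * n)) + ij | ij in J0] in
  [/\ diagram J, 1 <= m, 0 <= n,
      J0 = [set ij | 0 <= ij.1 < m /\ J ij]
    & trivIset setT J_ /\ J = \bigcup_kappa J_ kappa].

Section generalized_powers.
Context (R : realType) (E : innerType R) (m n : int) (J0 : set (int * int)).
Implicit Types (u : int * int -> E) (HH : set E) (U : E -> E).

Definition family_sqnorm u : \bar R :=
  (\esum_(ij in setT) (rnorm (u ij) ^+ 2)%:E)%E.

Definition family_space HH : set (int * int -> E) :=
  [set u | [/\ forall ij, J0 ij -> HH (u ij),
               forall ij, ~ J0 ij -> u ij = 0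
             & (family_sqnorm u < +oo)%E]].

Definition power1 U u : int * int -> E := fun ij =>
  if ij \in J0 then
    if ij.1 == 0 then U (u (m - 1, ij.2 - n)) else u (ij.1 - 1, ij.2)
  else 0.

Definition power2 u : int * int -> E := fun ij =>
  if ij \in J0 then u (ij.1, ij.2 - 1) else 0.

End generalized_powers.

Definition generalized_powers (R : realType) (E : innerType R)
    (G : set E) (V1 V2 : E -> E) (m n : int) (J0 : set (int * int))
    (E' : innerType R) (HH : set E') (U : E' -> E') : Prop :=
  [/\ exists J, periodic_diagram J m n J0,
      hilbert_subspace HH,
      unitary_on HH U
    & unitarily_equivalent G V1 V2 (family_space J0 HH)
        (@family_sqnorm R E') (power1 m n J0 U) (power2 J0)].

Definition cyclic_generalized_powers (R : realType) (E : innerType R)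
    (G : set E) (V1 V2 : E -> E) : Prop :=
  exists (m n : int) (J0 : set (int * int))
         (E' : innerType R) (HH : set E') (U : E' -> E'),
    generalized_powers G V1 V2 m n J0 HH U /\ exists w, cyclic_vector HH U w.

(* Functions on the torus T^2 are functions of z in C^2, considered through the
   parametrization by [0, 1]^2, which maps Lebesgue measure to the normalized
   Haar measure. *)
Section torus.
Context (R : realType) (E : innerType R).
Local Notation square := (measurableTypeR R * measurableTypeR R)%type.
Implicit Types (f : R[i] * R[i] -> E) (HH : set E).

Definition expi (t : R) : R[i] := (cos t +i* sin t)%C.

Definition torus_point (x : square) : R[i] * R[i] :=
  (expi (2 * pi * x.1), expi (2 * pi * x.2)).

Definition unit_square : set square := `[0%R, 1%R] `*` `[0%R, 1%R].

Definition area : {measure set square -> \bar R} :=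
  (@lebesgue_measure R \x @lebesgue_measure R)%E.

(* Strong measurability, in Pettis' form: weak measurability together with a
   separable range. *)
Definition torus_measurable HH f : Prop :=
  (forall h, HH h ->
     cmeasurable unit_square (fun x => inner (f (torus_point x)) h)) /\
  exists2 A : set E, countable A & forall x, closure A (f (torus_point x)).

Definition torus_sqnorm f : \bar R :=
  (\int[area]_(x in unit_square) (rnorm (f (torus_point x)) ^+ 2)%:E)%E.

(* c is the (weakly defined) vector-valued integral of f(z) z1^-i z2^-j. *)
Definition fourier_coefficient HH f (ij : int * int) (c : E) : Prop :=
  HH c /\ forall h, HH h -> inner c h =
    cintegral area unit_square (fun x => let z := torus_point x in
      inner (f z) h * (z.1 ^ ij.1 * z.2 ^ ij.2)^*).

Definition torus_space (J : set (int * int)) HH : set (R[i] * R[i] -> E) :=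
  [set f | [/\ forall x, HH (f (torus_point x)), torus_measurable HH f,
               (torus_sqnorm f < +oo)%E
             & forall ij, ~ J ij -> fourier_coefficient HH f ij 0]].

Definition mul_z1 f : R[i] * R[i] -> E := fun z => z.1 *: f z.
Definition mul_z2 f : R[i] * R[i] -> E := fun z => z.2 *: f z.

End torus.

Definition given_by_diagram (R : realType) (E : innerType R)
    (G : set E) (V1 V2 : E -> E) (J : set (int * int)) : Prop :=
  diagram J /\ exists (E' : innerType R) (HH : set E'),
    hilbert_subspace HH /\
    unitarily_equivalent G V1 V2 (torus_space J HH)
      (@torus_sqnorm R E') (@mul_z1 R E') (@mul_z2 R E').

Section random_field.
Context (R : realType) d (Omega : measurableType d) (P : probability Omega R).
Variable X : int * int -> Omega -> R[i].

Definition weak_stationary : Prop :=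
  [/\ forall v, square_integrable P (X v),
      forall u v, cintegral P setT (X u) = cintegral P setT (X v)
    & exists gamma : int * int -> R[i], forall v h,
        cintegral P setT (fun omega => X v omega * (X (v + h) omega)^*) =
        gamma h].

Definition field_space : set (L2 P) := clspan [set L2_class P (X v) | v in setT].

Definition past_space (S : set (int * int)) (ij : int * int) : set (L2 P) :=
  clspan [set L2_class P (X v) | v in [set v | S (v - ij)]].

End random_field.
Arguments field_space {R d Omega} P X.
Arguments past_space {R d Omega} P X S ij.

Definition no_deterministic_part (R : realType) d (Omega : measurableType d)
    (P : probability Omega R) (X : int * int -> Omega -> R[i])
    (S : set (int * int)) : Prop :=
  \bigcap_ij past_space P X S ij = [set 0].


Definition halfplane_past (k l : int) : set (int * int) :=
  [set ij | if ij.1 < 0 then 0 <= ij.1 * k + ij.2 * l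
            else 0 < ij.1 * k + ij.2 * l].

Definition opp_set (S : set (int * int)) : set (int * int) :=
  [set ij | S (- ij)].

(* Main.v *)
(* Let a = -k/gcd(k,l) and b = -l/gcd(k,l). Then -S_v with 0 is the positive
   cone of a total order on Z^2, which compares the heights a i + b j first and
   then i; its least positive element is e = (b, -a), of height 0. H_t is the
   closed span of the V^u K, u in this cone, where K is the kernel of the
   adjoint of V^e, and V^e is unitary on the complement H_e. A quasi-unitary
   reducing subspace M of H_t is contained in the closure of V^e M, hence
   orthogonal to K, hence to all V^u K.
   Let f have height 1, and let E_0 be the kernel of the adjoint of V^f in H_e.
   Since there is no deterministic part, H_e is the sum of the translates of
   E_0 over all heights n >= 0, and the period contains exactly one point of
   each height. The projection of V^e X_(0,0) spans K, and its projection to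
   E_0 is cyclic for V^e. If w is a unit vector in K, then V^u w |-> z^u w
   identifies H_t with the space given by the diagram -S_v with 0; it is onto
   because the trigonometric system is complete. *)
Require Import Defs.
From mathcomp Require Import all_boot all_order all_algebra.
From mathcomp Require Import all_classical all_reals all_analysis.
From mathcomp Require Import ring lra zify measurable_realfun.
Set Implicit Arguments.
Unset Strict Implicit.
Unset Printing Implicit Defensive.
Import Order.TTheory GRing.Theory Num.Theory.
Import numFieldNormedType.Exports.
From mathcomp Require Import complex.
Local Open Scope classical_set_scope.
Local Open Scope ring_scope.

(** * Geometry of inner product spaces *)

(** All operators are read off one ambient unitary action [up] of Z^2. On every reducing subspace,
    V^u and the adjoints are compressions of [up u] by the same projection onto [half_space]; hence
    adjoints taken inside [Ht], [He] or a smaller subspace agree, and the sign cases of [vpow]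
    become one formula. The decisive property of the cone is that [e] is its least element: V^u G
    lies in V^e G for every u in it. Orthogonality to V^e G thus controls all V^u G, and every
    generator of G other than V^e X_(0,0) already lies in V^e G, which leaves at most one dimension
    for K. The vector f has no such property, as u - f may leave the cone although u has positive
    height. On H_e, where V^e is invertible, the height alone decides; this is why H_t is split off
    before the levels of H_e are formed. A vector of H_e orthogonal to all levels lies in every
    translate of G, and here the absence of a deterministic part is used. The factor gcd(k,l)
    disappears because only signs of heights matter. *)

Section inner_product.
Context (R : realType) (E : innerType R).
Implicit Types (A G M N : set E) (x y z w : E) (a : R[i]) (e : R).

Lemma normrE x : `|x| = (rnorm x)%:C%C.
Proof. by rewrite /rnorm RRe_real// realE normr_ge0. Qed.

Lemma rnorm_ge0 x : 0 <= rnorm x.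
Proof. by rewrite -lecR -normrE normr_ge0. Qed.

Lemma rnorm0 : rnorm (0 : E) = 0.
Proof. by rewrite /rnorm normr0. Qed.

Lemma rnorm_eq0 x : (rnorm x == 0) = (x == 0).
Proof. by rewrite -[RHS]normr_eq0 normrE -(inj_eq (@complexI _)). Qed.

Lemma rnormN x : rnorm (- x) = rnorm x.
Proof. by rewrite /rnorm normrN. Qed.

Lemma rnormBC x y : rnorm (x - y) = rnorm (y - x).
Proof. by rewrite -rnormN opprB. Qed.

Lemma ler_rnormD x y : rnorm (x + y) <= rnorm x + rnorm y.
Proof. by rewrite -lecR rmorphD /= -!normrE ler_normD. Qed.

Lemma ler_rnormB x y z : rnorm (x - z) <= rnorm (x - y) + rnorm (y - z).
Proof. by rewrite -[x - z](subrKA y) ler_rnormD. Qed.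

Lemma crnormE a : `|a| = (rnorm a)%:C%C.
Proof. by rewrite /rnorm RRe_real// realE normr_ge0. Qed.

Lemma crnorm_ge0 a : 0 <= rnorm a.
Proof. by rewrite -lecR -crnormE normr_ge0. Qed.

Lemma rnormZ a x : rnorm (a *: x) = rnorm a * rnorm x.
Proof. by apply: (@complexI R); rewrite rmorphM /= -crnormE -!normrE normrZ. Qed.

Lemma innerC x y : inner x y = (inner y x)^*.
Proof. by have := hermC (@inner R E) x y; rewrite mul1r. Qed.

Lemma innerDl x y z : inner (x + y) z = inner x z + inner y z.
Proof. exact: linearDl. Qed.
Lemma innerZl a x z : inner (a *: x) z = a * inner x z.
Proof. exact: linearZl_LR. Qed.
Lemma inner0l z : inner 0 z = 0.
Proof. exact: linear0l. Qed.
Lemma innerBl x y z : inner (x - y) z = inner x z - inner y z.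
Proof. exact: linearBl. Qed.
Lemma innerDr x y z : inner z (x + y) = inner z x + inner z y.
Proof. exact: linearDr. Qed.
Lemma innerZr a x z : inner z (a *: x) = a^* * inner z x.
Proof. exact: linearZr_LR. Qed.
Lemma inner0r z : inner z 0 = 0.
Proof. exact: linear0r. Qed.
Lemma innerNr x z : inner z (- x) = - inner z x.
Proof. exact: linearNr. Qed.
Lemma innerBr x y z : inner z (x - y) = inner z x - inner z y.
Proof. exact: linearBr. Qed.
Lemma inner_suml I (r : seq I) (P : pred I) (F : I -> E) z :
  inner (\sum_(i <- r | P i) F i) z = \sum_(i <- r | P i) inner (F i) z.
Proof.
by rewrite (big_morph (fun x => inner x z) (fun x y => innerDl x y z) (inner0l z)).
Qed.
Lemma inner_sumr I (r : seq I) (P : pred I) (F : I -> E) z :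
  inner z (\sum_(i <- r | P i) F i) = \sum_(i <- r | P i) inner z (F i).
Proof.
by rewrite (big_morph (fun x => inner z x) (fun x y => innerDr x y z) (inner0r z)).
Qed.

Lemma inner_eq0C x y : inner x y = 0 -> inner y x = 0.
Proof. by rewrite [inner y x]innerC => ->; rewrite rmorph0. Qed.

Lemma rnorm2C x : (rnorm x ^+ 2)%:C%C = inner x x.
Proof. by rewrite innerxx normrE rmorphXn. Qed.

Lemma rnorm2Re x : rnorm x ^+ 2 = Re (inner x x).
Proof. by rewrite -rnorm2C. Qed.

Lemma inner_self_eq0 x : inner x x = 0 -> x = 0.
Proof. by rewrite innerxx => /eqP; rewrite expf_eq0/= normr_eq0 => /eqP. Qed.

Lemma rnorm2D x y :
  rnorm (x + y) ^+ 2 = rnorm x ^+ 2 + rnorm y ^+ 2 + 2 * Re (inner x y).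
Proof.
rewrite !rnorm2Re !innerDl !innerDr [inner y x]innerC.
case: (inner x x) (inner x y) (inner y y) => [? ?] [? ?] [? ?] /=.
by ring.
Qed.

Lemma rnorm2B x y :
  rnorm (x - y) ^+ 2 = rnorm x ^+ 2 + rnorm y ^+ 2 - 2 * Re (inner x y).
Proof. by rewrite rnorm2D rnormN innerNr raddfN /= mulrN. Qed.

Lemma pythagoras x y : inner x y = 0 ->
  rnorm (x + y) ^+ 2 = rnorm x ^+ 2 + rnorm y ^+ 2.
Proof. by rewrite rnorm2D => -> /=; rewrite mulr0 addr0. Qed.

Lemma parallelogram x y :
  rnorm (x + y) ^+ 2 + rnorm (x - y) ^+ 2 = 2 * (rnorm x ^+ 2 + rnorm y ^+ 2).
Proof. by rewrite rnorm2D rnorm2B; ring. Qed.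

Lemma CauchySchwarz x y : rnorm (inner x y) <= rnorm x * rnorm y.
Proof.
have [->|y0] := eqVneq y 0.
  by rewrite inner0r rnorm0 mulr0 /rnorm normr0.
rewrite -lecR rmorphM /= -crnormE -!normrE.
rewrite -(@ler_sqr R[i]) ?nnegrE ?mulr_ge0// exprMn -!innerxx.
have Hy : 0 < inner y y by rewrite dnorm_gt0.
have := dnorm_ge0 (@inner R E) (inner y y *: x - inner x y *: y).
rewrite dnormB !dnormZ innerZl innerZr /=.
rewrite (gtr0_norm Hy).
have -> : inner y y * ((inner x y)^* * inner x y) =
    inner y y * `|inner x y| ^+ 2 by rewrite normCK [X in inner y y * X]mulrC.
rewrite rmorphM rmorphXn /= conj_normC.
have -> : (inner y y)^* = inner y y by apply/CrealP/gtr0_real.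
set n := `|inner x y| ^+ 2.
have -> : inner y y ^+ 2 * inner x x + n * inner y y -
    (inner y y * n + inner y y * n) = inner y y * (inner x x * inner y y - n).
  by ring.
by rewrite pmulr_rge0// subr_ge0.
Qed.

Definition tends (u : nat -> E) x : Prop :=
  forall e, 0 < e -> exists n0, forall n, (n0 <= n)%N -> rnorm (x - u n) < e.

Definition cauchy_sequence (u : nat -> E) : Prop :=
  forall e, 0 < e -> exists n0, forall m n,
    (n0 <= m)%N -> (n0 <= n)%N -> rnorm (u m - u n) < e.

(** The radii of balls of [E] are elements of [R[i]], where positivity implies being real.
    Neighbourhoods can therefore be handled with radii in [R] throughout. *)
Lemma real_pos (r : R[i]) : 0 < r -> exists2 e, 0 < e & r = e%:C%C.
Proof.
move=> r0; exists (Re r); first by move: r0; rewrite ltcE => /andP[].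
by rewrite RRe_real// gtr0_real.
Qed.

Lemma closureP A x :
  closure A x <-> forall e, 0 < e -> exists2 y, A y & rnorm (x - y) < e.
Proof.
split=> [clA e e0|H].
  have /clA[y [Ay]] : nbhs x (ball x e%:C%C) by apply: nbhsx_ballx; rewrite ltcR.
  by rewrite -ball_normE /= normrE ltcR => xy; exists y.
move=> B /nbhs_ballP[_ /real_pos[e e0 ->]] xB.
have [y Ay xy] := H _ e0; exists y; split=> //.
by apply: xB; rewrite -ball_normE /= normrE ltcR.
Qed.

Lemma closedP A : closed A <->
  forall x, (forall e, 0 < e -> exists2 y, A y & rnorm (x - y) < e) -> A x.
Proof. by split=> [clA x /closureP/clA//|H x /closureP/H]. Qed.

Lemma closed_tends A (u : nat -> E) x :
  closed A -> (forall n, A (u n)) -> tends u x -> A x.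
Proof.
move=> /closedP clA Au ux; apply: clA => e /ux[n0 /(_ _ (leqnn _))].
by exists (u n0).
Qed.

Lemma exp2_small e : 0 < e -> exists n, (2 ^- n : R) < e.
Proof.
move=> e0; have [n ne] : exists n, (e^-1 < n%:R :> R).
  exists (Num.bound e^-1); rewrite archi_boundP// invr_ge0 ltW//.
exists n; rewrite invf_plt ?posrE// ?exprn_gt0//.
apply: (lt_le_trans ne); rewrite -natrX ler_nat.
exact/ltnW/ltn_expl.
Qed.

Lemma hilbert_subspaceP G :
  (forall u, cauchy_sequence u -> exists x, tends u x) ->
  closed_subspace G -> hilbert_subspace G.
Proof.
move=> cE [lG cG]; split=> // F PF /cauchy_ballP cF FG.
have A_ n : exists A : set E, F A /\ forall x y, A x -> A y -> rnorm (x - y) < 2 ^- n.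
  have e0 : 0 < (2 ^- n : R)%:C%C by rewrite ltcR invr_gt0 exprn_gt0.
  have [[A B] /= [FA FB] AB] := cF _ e0.
  exists (A `&` B); split; first exact: filterI.
  move=> x y [Ax _] [_ By]; have /= := AB (x, y) (conj Ax By).
  by rewrite -ball_normE /= normrE ltcR.
have [A HA] := choice A_.
(* The sets [A n] need not be nested. With their finite intersections, all [u k] with [k >= n] lie
   in [A n], so that [u] is Cauchy. *)
pose B n := [set x | G x /\ forall k, (k <= n)%N -> A k x].
have FB n : F (B n).
  apply: filterI => //; elim: n => [|n IH].
    apply: filterS (HA 0%N).1 => x Ax k; by rewrite leqn0 => /eqP->.
  apply: filterS2 IH (HA n.+1).1 => x H An k.
  by rewrite leq_eqVlt => /orP[/eqP->//|]; exact: H.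
have B0 n : exists x, B n x by exact: (filter_ex (FB n)).
have [u Hu] := choice B0.
have cu : cauchy_sequence u.
  move=> e /exp2_small[n ne]; exists n => i j ni nj.
  apply: lt_trans ne; apply: (HA n).2; first exact: (Hu i).2.
  exact: (Hu j).2.
have [x ux] := cE _ cu; exists x.
  by apply: closed_tends ux => // n; case: (Hu n).
apply/fcvgrPdist_lt => _ /real_pos[e e0 ->].
have /exp2_small[n ne] : 0 < e / 2 by rewrite divr_gt0.
have /ux[m Hm] : 0 < e / 2 by rewrite divr_gt0.
apply: filterS (FB n) => y By; rewrite normrE ltcR.
apply: (le_lt_trans (ler_rnormB _ (u (maxn n m)) _)).
rewrite [e]splitr ltrD//; first by apply: Hm; rewrite leq_maxr.
apply: lt_trans ne; apply: (HA n).2; last exact: By.2.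
by apply: (Hu _).2; rewrite leq_maxl.
Qed.

End inner_product.

(** * Closed subspaces, projections and adjoints *)

Section subspaces.
Context (R : realType) (E : innerType R).
Implicit Types (A B G M N : set E) (x y z w : E) (a : R[i]) (e : R) (V : E -> E).

Lemma subspace0 G : linear_subspace G -> G 0.
Proof. by case. Qed.

Lemma subspaceZ G a x : linear_subspace G -> G x -> G (a *: x).
Proof. by move=> [G0 GD] Gx; rewrite -[_ *: _]addr0; apply: GD. Qed.

Lemma subspaceD G x y : linear_subspace G -> G x -> G y -> G (x + y).
Proof. by move=> [G0 GD] Gx Gy; rewrite -[x]scale1r; apply: GD. Qed.

Lemma subspaceN G x : linear_subspace G -> G x -> G (- x).
Proof. by move=> lG Gx; rewrite -scaleN1r; apply: subspaceZ. Qed.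

Lemma subspaceB G x y : linear_subspace G -> G x -> G y -> G (x - y).
Proof. by move=> lG Gx Gy; apply: subspaceD => //; apply: subspaceN. Qed.

Lemma subspace_sum G (I : Type) (r : seq I) (P : pred I) (F : I -> E) :
  linear_subspace G -> (forall i, P i -> G (F i)) -> G (\sum_(i <- r | P i) F i).
Proof.
move=> lG GF; elim/big_ind : _ => //; first exact: subspace0.
by move=> x y; exact: subspaceD.
Qed.

Lemma sub_linear_span A : A `<=` linear_span A.
Proof.
move=> x Ax; exists 1%N, (fun=> 1), (fun=> x); split=> //.
by rewrite big_ord1 scale1r.
Qed.

Lemma linear_span_subspace A : linear_subspace (linear_span A).
Proof.
split; first by exists 0%N, (fun=> 0), (fun=> 0); rewrite big_ord0; split=> // -[].
move=> a _ _ [m [b [v [Av ->]]]] [n [c [w [Aw ->]]]].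
exists (m + n)%N, (fun i => match fintype.split i with inl j => a * b j | inr j => c j end).
exists (fun i => match fintype.split i with inl j => v j | inr j => w j end); split.
  by move=> i; case: (fintype.split i).
rewrite big_split_ord /= scaler_sumr; congr (_ + _); apply: eq_bigr => i _.
  by rewrite -[lshift _ _]/(unsplit (inl i)) unsplitK scalerA.
by rewrite -[rshift _ _]/(unsplit (inr i)) unsplitK.
Qed.

Lemma linear_span_min A G :
  linear_subspace G -> A `<=` G -> linear_span A `<=` G.
Proof.
move=> lG AG _ [n [a [v [Av ->]]]]; apply: subspace_sum => // i _.
by apply: subspaceZ => //; exact: AG.
Qed.

Lemma closure_subspace A : linear_subspace A -> closed_subspace (closure A).
Proof.
move=> lA; split; last exact: closed_closure.
split; first by apply: subset_closure; exact: subspace0.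
move=> a x y /closureP Ax /closureP Ay; apply/closureP => e e0.
have d0 : 0 < rnorm a + 1 by rewrite ltr_wpDl// crnorm_ge0.
have /Ax[x' Ax' xx'] : 0 < e / 2 / (rnorm a + 1) by rewrite !divr_gt0.
have /Ay[y' Ay' yy'] : 0 < e / 2 by rewrite divr_gt0.
exists (a *: x' + y'); first by apply: (lA.2).
rewrite opprD addrACA -scalerBr (le_lt_trans (ler_rnormD _ _))// [e]splitr.
rewrite ltr_leD//; last exact: ltW.
rewrite rnormZ; apply: (@le_lt_trans _ _ ((rnorm a + 1) * rnorm (x - x'))).
  by rewrite ler_wpM2r ?rnorm_ge0// lerDl.
by rewrite mulrC -ltr_pdivlMr.
Qed.

Lemma clspan_subspace A : closed_subspace (clspan A).
Proof. exact/closure_subspace/linear_span_subspace. Qed.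

Lemma sub_clspan A : A `<=` clspan A.
Proof. exact: subset_trans (@sub_linear_span A) (@subset_closure _ _). Qed.

Lemma clspan_min A G : closed_subspace G -> A `<=` G -> clspan A `<=` G.
Proof.
move=> [lG cG] AG; rewrite (closure_id G).1//.
by apply: closure_subset; exact: linear_span_min.
Qed.

Lemma set0_subspace : closed_subspace ([set 0] : set E).
Proof.
split; first by split=> // a _ _ -> ->; rewrite scaler0 addr0.
apply/closedP => x H; apply/eqP/contraT; rewrite -rnorm_eq0 => x0.
have [] := H (rnorm x); first by rewrite lt0r x0 rnorm_ge0.
by move=> _ ->; rewrite subr0 ltxx.
Qed.

Lemma setI_subspace M N :
  closed_subspace M -> closed_subspace N -> closed_subspace (M `&` N).
Proof.
move=> [lM cM] [lN cN]; split; last exact: closedI.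
split; first by split; exact: subspace0.
by move=> a x y [Mx Nx] [My Ny]; split; [apply: lM.2|apply: lN.2].
Qed.

Definition orth A : set E := [set x | forall y, A y -> inner x y = 0].

Lemma orthC A x : orth A x <-> forall y, A y -> inner y x = 0.
Proof. by split=> H y Ay; apply: inner_eq0C; exact: H. Qed.

Lemma orth_subspace A : closed_subspace (orth A).
Proof.
split.
  split=> [y _|a x y Ax Ay z Az]; first exact: inner0l.
  by rewrite innerDl innerZl Ax// Ay// mulr0 addr0.
apply/closedP => x H y Ay; apply/eqP; rewrite -normr_eq0 crnormE.
apply/eqP; congr (_%:C)%C; apply/eqP; rewrite eq_le crnorm_ge0 andbT.
apply/ler_addgt0Pr => e e0; rewrite add0r.
have d0 : 0 < rnorm y + 1 by rewrite ltr_wpDl// rnorm_ge0.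
have [|x' Ax' xx'] := H (e / (rnorm y + 1)); first by rewrite divr_gt0.
rewrite -(subrK x' x) innerDl Ax'// addr0 (le_trans (CauchySchwarz _ _))//.
apply: (@le_trans _ _ (rnorm (x - x') * (rnorm y + 1))).
  by rewrite ler_wpM2l ?rnorm_ge0// lerDl.
by rewrite -ler_pdivlMr// ltW.
Qed.

(** The vectors orthogonal to a single [x] form a closed subspace, which contains the closed span as
    soon as it contains [A]. *)
Lemma orth_clspan A : orth A `<=` orth (clspan A).
Proof.
move=> x Ax; apply/orthC => y Ay; suff : orth [set x] y by move=> /(_ _ erefl).
by apply: clspan_min Ay; [exact: orth_subspace|move=> z Az _ ->; apply/inner_eq0C/Ax].
Qed.

Lemma clspan_orth A x : clspan A x -> orth A x -> x = 0.
Proof. by move=> Ax /orth_clspan/(_ _ Ax)/inner_self_eq0. Qed.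

(** Polarization: the norm of [x + y] determines the real part of the inner product, and the real
    part for [i x] is minus the imaginary part for [x]. *)
Lemma isometry_inner G V x y : isometry_on G V -> linear_subspace G ->
  G x -> G y -> inner (V x) (V y) = inner x y.
Proof.
move=> [GV lV nV] lG Gx Gy.
have nV' u : G u -> rnorm (V u) = rnorm u by move=> Gu; rewrite /rnorm nV.
have ReV u v : G u -> G v -> Re (inner (V u) (V v)) = Re (inner u v).
  move=> Gu Gv; have := rnorm2D (V u) (V v).
  rewrite -[V u in LHS]scale1r -lV// nV'; last by apply: (lG.2).
  rewrite scale1r rnorm2D !nV'// => /addrI/(congr1 (fun t => t / 2)).
  by rewrite ![2 * _]mulrC !mulfK// pnatr_eq0.
have VZ u b : G u -> V (b *: u) = b *: V u.
  move=> Gu; have := lV b u 0 Gu (subspace0 lG).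
  rewrite !addr0 => ->; suff -> : V 0 = 0 by rewrite addr0.
  by apply/eqP; rewrite -rnorm_eq0 nV' ?rnorm0//; exact: subspace0.
have := ReV _ _ (subspaceZ (0 +i* 1)%C lG Gx) Gy.
rewrite VZ// !innerZl; have := ReV _ _ Gx Gy.
case: (inner (V x) (V y)) (inner x y) => [p q] [r s] /= -> H.
by congr (_ +i* _)%C; lra.
Qed.

Lemma isometry_rnorm G V x : isometry_on G V -> G x -> rnorm (V x) = rnorm x.
Proof. by move=> [_ _ nV] Gx; rewrite /rnorm nV. Qed.

Lemma isometry0 G V : isometry_on G V -> linear_subspace G -> V 0 = 0.
Proof.
move=> iV lG; apply/eqP; rewrite -rnorm_eq0 (isometry_rnorm iV) ?rnorm0//.
exact: subspace0.
Qed.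

End subspaces.

Section complete.
Context (R : realType) (E : innerType R).
Hypothesis cE : forall u : nat -> E, cauchy_sequence u -> exists x, tends u x.
Implicit Types (A B G M N : set E) (x y z w : E) (a : R[i]) (e : R) (V : E -> E).

(** The distance to [M] is attained: by the parallelogram law a minimizing sequence is Cauchy,
    because the midpoints of its terms lie in [M] and are no closer to [x] than the infimum. *)
Lemma projection M x : closed_subspace M ->
  exists y, M y /\ forall z, M z -> inner (x - y) z = 0.
Proof.
move=> [lM cM].
pose D := [set rnorm (x - y) ^+ 2 | y in M].
have D0 : has_inf D.
  split; first by exists (rnorm (x - 0) ^+ 2), 0 => //; exact: subspace0.
  by exists 0 => _ [y _ <-]; rewrite sqr_ge0.
have infD y : M y -> inf D <= rnorm (x - y) ^+ 2.
  by move=> My; apply: ge_inf; [case: D0|exists y].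
have H n : exists y, M y /\ rnorm (x - y) ^+ 2 < inf D + 2 ^- n.
  have : 0 < 2 ^- n :> R by rewrite invr_gt0 exprn_gt0.
  by move=> /(inf_adherent)/(_ D0)[_ [y My <-] yn]; exists y.
have [u Hu] := choice H.
have cu : cauchy_sequence u.
  move=> e e0; have [n nlt] : exists n, (2 ^- n : R) < (e / 2) ^+ 2.
    by apply: exp2_small; rewrite exprn_gt0// divr_gt0.
  have Hu' m : (n <= m)%N -> rnorm (x - u m) ^+ 2 < inf D + (e / 2) ^+ 2.
    move=> nm; apply: (lt_le_trans (Hu m).2); rewrite lerD2l.
    apply: le_trans (ltW nlt).
    by rewrite lef_pV2 ?posrE ?exprn_gt0// ler_weXn2l// ler1n.
  exists n => i j ni nj.
  rewrite -(@ltr_pXn2r _ 2)// ?nnegrE ?rnorm_ge0 ?(ltW e0)//.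
  have := parallelogram (x - u i) (x - u j).
  have -> : x - u i - (x - u j) = u j - u i by rewrite opprB addrC addrA subrK.
  have -> : x - u i + (x - u j) = 2 *: (x - 2^-1 *: (u i + u j)).
    rewrite scalerBr scalerA divff ?pnatr_eq0// scale1r addrACA -opprD.
    by rewrite -[2]/(1 + 1) scalerDl !scale1r.
  rewrite rnormZ exprMn (_ : rnorm 2 = 2 :> R); last first.
    by rewrite /rnorm normr_nat.
  have := infD (2^-1 *: (u i + u j)).
  move=> /(_ (subspaceZ _ lM (subspaceD lM (Hu i).1 (Hu j).1))).
  have := Hu' _ ni; have := Hu' _ nj.
  rewrite (rnormBC (u i)) (_ : (e / 2) ^+ 2 = e ^+ 2 / 4) ?[in RHS]expr2; first lra.
  by field.
have [y uy] := cE cu; have My : M y by apply: closed_tends uy => // n; exact: (Hu n).1.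
have ymin z : M z -> rnorm (x - y) <= rnorm (x - z).
  move=> Mz; rewrite -(@ler_pXn2r _ 2)// ?nnegrE ?rnorm_ge0//.
  apply: le_trans (infD _ Mz); rewrite leNgt; apply/negP => lt.
  have sD : 0 <= inf D by apply: lb_le_inf; [case: D0|move=> _ [? _ <-]; rewrite sqr_ge0].
  have lt' : Num.sqrt (inf D) < rnorm (x - y).
    by rewrite -(@ltr_pXn2r _ 2)// ?nnegrE ?rnorm_ge0 ?sqrtr_ge0// sqr_sqrtr.
  set e := (rnorm (x - y) - Num.sqrt (inf D)) / 2.
  have e0 : 0 < e by rewrite divr_gt0// subr_gt0.
  have [n1 Hn1] := uy _ e0.
  have [n2 Hn2] : exists n, (2 ^- n : R) < e ^+ 2 by apply: exp2_small; rewrite exprn_gt0.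
  pose n := maxn n1 n2.
  have A1 : rnorm (y - u n) < e by rewrite Hn1// leq_maxl.
  have A2 : rnorm (x - u n) < Num.sqrt (inf D) + e.
    rewrite -(@ltr_pXn2r _ 2)// ?nnegrE ?rnorm_ge0 ?addr_ge0 ?sqrtr_ge0 ?(ltW e0)//.
    apply: (lt_le_trans (Hu n).2); rewrite sqrrD sqr_sqrtr//.
    rewrite -addrA lerD2l; apply: (@le_trans _ _ (e ^+ 2)).
      apply: le_trans (ltW Hn2).
      by rewrite lef_pV2 ?posrE ?exprn_gt0// ler_weXn2l ?leq_maxr// ler1n.
    by rewrite lerDr mulrn_wge0// mulr_ge0 ?sqrtr_ge0// ltW.
  have := ler_rnormB x (u n) y; rewrite (rnormBC (u n)).
  by move: A1 A2; rewrite /e; lra.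
exists y; split=> // z Mz.
have [->|z0] := eqVneq z 0; first exact: inner0r.
have zz0 : inner z z != 0 by apply: contra z0 => /eqP/inner_self_eq0->.
(* Moving from [y] to [y + c *: z] removes the component of [x - y] along [z]. By minimality of [y]
   this cannot shorten the distance, so that component is 0. *)
set c := inner (x - y) z / inner z z.
have wz : inner (x - y - c *: z) z = 0.
  by rewrite innerBl innerZl /c divfK// subrr.
have := pythagoras (y := c *: z) (x := x - y - c *: z).
rewrite innerZr wz mulr0 subrK => /(_ erefl) H1.
have : rnorm (x - y) <= rnorm (x - y - c *: z).
  rewrite -addrA -opprD; apply: ymin; apply: subspaceD => //.
  exact: subspaceZ.
rewrite -(@ler_pXn2r _ 2) ?nnegrE ?rnorm_ge0// H1 gerDl => H2.
have : rnorm (c *: z) ^+ 2 == 0 by rewrite eq_le H2 sqr_ge0.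
rewrite expf_eq0 /= rnorm_eq0 => /eqP cz.
by move: wz; rewrite cz subr0.
Qed.

Definition proj M x : E :=
  xget 0 [set y | M y /\ forall z, M z -> inner (x - y) z = 0].

Lemma projP M x : closed_subspace M ->
  M (proj M x) /\ forall z, M z -> inner (x - proj M x) z = 0.
Proof. by move=> /(projection x)[y Hy]; rewrite /proj; case: xgetP => [//|/(_ y)]. Qed.

Lemma proj_uniq M x y : closed_subspace M ->
  M y -> (forall z, M z -> inner (x - y) z = 0) -> proj M x = y.
Proof.
move=> cM My H; have [Mp Hp] := projP x cM.
have Mpy : M (proj M x - y) by apply: subspaceB => //; exact: cM.1.
apply/eqP; rewrite -subr_eq0; apply/eqP/inner_self_eq0.
have {1}-> : proj M x - y = (x - y) - (x - proj M x) by rewrite opprB [RHS]addrC addrA subrK.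
by rewrite innerBl Hp// H// subrr.
Qed.

Lemma proj_id M x : closed_subspace M -> M x -> proj M x = x.
Proof. by move=> cM Mx; apply: proj_uniq => // z _; rewrite subrr inner0l. Qed.

Lemma proj_orth M x : closed_subspace M -> orth M x -> proj M x = 0.
Proof.
move=> cM Mx; apply: proj_uniq => //; first exact: subspace0 cM.1.
by move=> z Mz; rewrite subr0 Mx.
Qed.

Lemma proj_linear M a x y : closed_subspace M ->
  proj M (a *: x + y) = a *: proj M x + proj M y.
Proof.
move=> cM; have [Mx Hx] := projP x cM; have [My Hy] := projP y cM.
apply: proj_uniq => //; first by apply: (cM.1.2).
move=> z Mz; rewrite opprD addrACA -scalerBr innerDl innerZl Hx// Hy//.
by rewrite mulr0 addr0.
Qed.

Lemma projB M x y : closed_subspace M -> proj M (x - y) = proj M x - proj M y.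
Proof. by move=> cM; rewrite addrC -scaleN1r proj_linear// scaleN1r addrC. Qed.

Lemma rnorm_proj M x : closed_subspace M -> rnorm (proj M x) <= rnorm x.
Proof.
move=> cM; have [Mx Hx] := projP x cM.
rewrite -(@ler_pXn2r _ 2) ?nnegrE ?rnorm_ge0//.
rewrite -[x in leRHS](subrK (proj M x)) pythagoras; last exact: Hx.
by rewrite lerDr sqr_ge0.
Qed.

Lemma orthK_sub G M x : closed_subspace G -> closed_subspace M -> M `<=` G ->
  G x -> exists y z, [/\ M y, G z, orth M z & x = y + z].
Proof.
move=> cG cM MG Gx; have [My Hy] := projP x cM.
exists (proj M x), (x - proj M x); split=> //; last by rewrite addrC subrK.
by apply: subspaceB; [exact: cG.1|exact: Gx|exact: MG].
Qed.

Lemma closed_subspace_eq G M : closed_subspace G -> closed_subspace M -> M `<=` G ->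
  (forall x, G x -> orth M x -> x = 0) -> M = G.
Proof.
move=> cG cM MG H; rewrite eqEsubset; split=> // x Gx.
have [y [z [My Gz Mz ->]]] := orthK_sub cG cM MG Gx.
by rewrite (H z)// addr0.
Qed.

Lemma adjoint_uniq G V y z : linear_subspace G -> G z ->
  (forall x, G x -> inner (V x) y = inner x z) -> adjoint G V y = z.
Proof.
move=> lG Gz H; rewrite /adjoint; case: xgetP => [z' _ [Gz' Hz']|/(_ z)]; last by case.
have Gd : G (z' - z) by apply: subspaceB.
apply/eqP; rewrite -subr_eq0; apply/eqP/inner_self_eq0.
by rewrite innerBr -Hz'// -H// subrr.
Qed.

End complete.

(** * Completeness of L2 *)

Section riesz_fischer.
Context (R : realType).

Lemma geometric_cvg (a : nat -> R) (C : R) :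
  (forall k, `|a k.+1 - a k| <= C * 2 ^- k) ->
  a @ \oo --> limn a /\ forall k, `|limn a - a k| <= 2 * C * 2 ^- k.
Proof.
move=> aC.
have C0 : 0 <= C by have := le_trans (normr_ge0 _) (aC 0%N); rewrite expr0 divr1.
have g2 k : (2 ^- k : R) = 2 * 2 ^- k.+1 by rewrite exprS invfM mulrA divff ?mul1r// pnatr_eq0.
(* The factor [1 - 2 ^- n] is what lets the induction on [n] close; the uniform bound follows from
   it. *)
have D k n : `|a (k + n)%N - a k| <= 2 * C * 2 ^- k * (1 - 2 ^- n).
  elim: n => [|n IH]; first by rewrite addn0 subrr normr0 expr0 invr1 subrr mulr0.
  rewrite addnS -[a _ - _](subrKA (a (k + n)%N)) (le_trans (ler_normD _ _))//.
  have := lerD (aC (k + n)%N) IH; move=> /le_trans; apply.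
  rewrite exprD invfM (g2 n); nra.
have D' k n : `|a (k + n)%N - a k| <= 2 * C * 2 ^- k.
  apply: le_trans (D k n) _; rewrite -[leRHS]mulr1 ler_wpM2l//.
  by rewrite mulr_ge0 ?mulr_ge0// invr_ge0 exprn_ge0.
have ca : cvgn a.
  (* The correction drops by exactly [C * 2 ^- k] at each step, which absorbs the increment of [a];
     a monotone bounded sequence remains. *)
  have b_ : nondecreasing_seq (fun k => a k - 2 * C * 2 ^- k).
    apply/nondecreasing_seqP => k; have := aC k; rewrite ler_norml => /andP[+ _].
    rewrite (g2 k); lra.
  have /(nondecreasing_is_cvgn b_) : has_ubound (range (fun k => a k - 2 * C * 2 ^- k)).
    exists (a 0%N + 2 * C) => _ [k _ <-].
    have := D' 0%N k; rewrite ler_norml add0n expr0 invr1 mulr1 => /andP[_].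
    have : 0 <= 2 * C * 2 ^- k by rewrite mulr_ge0 ?mulr_ge0// invr_ge0 exprn_ge0.
    lra.
  have : geometric (2 * C) (2^-1) @ \oo --> (0 : R).
    by apply: cvg_geometric; rewrite ger0_norm ?invr_ge0// invf_lt1// ltr1n.
  move=> /cvgP/[swap]/is_cvgD/[apply]; rewrite (_ : _ + _ = a)//.
  by apply/funext => k; rewrite !fctE /geometric /= exprVn subrK.
split=> // k; have : (fun n => `|a n - a k|) @ \oo --> `|limn a - a k|.
  by apply: cvg_norm; apply: cvgB ca (cvg_cst _).
move=> H; rewrite -(cvg_lim _ H)//; apply: limr_le; first exact: cvgP H.
by exists k => // n /= kn; rewrite -(subnKC kn).
Qed.

Lemma Re_rnorm (z : R[i]) : `|Re z| <= rnorm z.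
Proof.
rewrite -(@ler_pXn2r _ 2)// ?nnegrE ?crnorm_ge0//.
by rewrite rnorm2E real_normK ?num_real// lerDl sqr_ge0.
Qed.

Lemma Im_rnorm (z : R[i]) : `|Im z| <= rnorm z.
Proof.
rewrite -(@ler_pXn2r _ 2)// ?nnegrE ?crnorm_ge0//.
by rewrite rnorm2E real_normK ?num_real// lerDr sqr_ge0.
Qed.

Lemma sqr_ler_norm (t c : R) : `|t| <= c -> t ^+ 2 <= c ^+ 2.
Proof.
move=> tc; rewrite -(real_normK (num_real t)) ler_pXn2r// nnegrE//.
exact: le_trans tc.
Qed.

Lemma geometric_ccvg (z : nat -> R[i]) (C : R) :
  (forall k, rnorm (z k.+1 - z k) <= C * 2 ^- k) ->
  let l := (limn (fun n => Re (z n)) +i* limn (fun n => Im (z n)))%C in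
  [/\ (fun n => Re (z n)) @ \oo --> Re l, (fun n => Im (z n)) @ \oo --> Im l
    & forall k, rnorm (l - z k) ^+ 2 <= 8 * C ^+ 2 * 4 ^- k].
Proof.
move=> zC /=.
have [cr Hr] : _ := @geometric_cvg (fun n => Re (z n)) C (fun k =>
  le_trans (le_trans (eq_ind _ (fun t =>
    `|t| <= _) (Re_rnorm _) _ (raddfB (@Re R) _ _)) (lexx _)) (zC k)).
have [ci Hi] : _ := @geometric_cvg (fun n => Im (z n)) C (fun k =>
  le_trans (le_trans (eq_ind _ (fun t =>
    `|t| <= _) (Im_rnorm _) _ (raddfB (@Im R) _ _)) (lexx _)) (zC k)).
split=> // k; rewrite rnorm2E.
have -> : (4 ^- k : R) = (2 ^- k) ^+ 2.
  by rewrite exprVn -exprM mulnC exprM; congr (_ ^+ k)^-1; rewrite -natrX.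
have := sqr_ler_norm (Hr k); have := sqr_ler_norm (Hi k).
move: (limn _) (limn _) => li lr; case: (z k) => p q /=.
by move: (2 ^- k) => u; lra.
Qed.

Section L2.
Context d (T : measurableType d) (mu : {measure set T -> \bar R}).
Local Open Scope quotient_scope.
Implicit Types (f g : L2fun mu) (u v : L2 mu).

Lemma inner_pi f g : inner (\pi_(L2 mu) f : L2 mu) (\pi_(L2 mu) g : L2 mu) =
  cintegral mu setT (fun x => f x * (g x)^*).
Proof.
have [ir ii] := L2fun_int f g.
have [ir' ii'] := L2fun_int (repr (\pi_(L2 mu) f)) (repr (\pi_(L2 mu) g)).
rewrite -[LHS]/(dotL2 _ _) /dotL2; apply: ae_eq_cintegral => //.
by apply: filterS2 (repr_pi f) (repr_pi g) => x /= -> ->.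
Qed.

Lemma rnorm_pi f : (rnorm (\pi_(L2 mu) f : L2 mu) ^+ 2)%:E =
  (\int[mu]_x (rnorm (f x) ^+ 2)%:E)%E.
Proof.
have [ir ii] := L2fun_int f f.
rewrite rnorm2Re inner_pi /cintegral /= /Rintegral fineK ?integrable_fin_num//.
apply: eq_integral => x _; congr (_%:E).
by rewrite rnorm2E; case: (f x) => p q /=; ring.
Qed.

Lemma measurable_rnorm2 (h : T -> R[i]) : cmeasurable setT h ->
  measurable_fun setT (fun x => rnorm (h x) ^+ 2).
Proof.
move=> [hr hi]; under eq_fun do rewrite rnorm2E.
by apply: measurable_funD; apply: measurable_funX.
Qed.

Lemma L2fun_cmeasurable f : cmeasurable setT f.
Proof. by have /asboolP[] := valP f. Qed.

(** Riesz-Fischer: a subsequence with increments below [4 ^- k] converges pointwise almost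
    everywhere, and its pointwise limit is also the limit in norm. *)
Lemma L2_complete (u : nat -> L2 mu) : cauchy_sequence u -> exists x, tends u x.
Proof.
move=> cu.
have /choice[N HN] k : exists n0, forall m n, (n0 <= m)%N -> (n0 <= n)%N ->
    rnorm (u m - u n) < 4 ^- k by apply: cu; rewrite invr_gt0 exprn_gt0.
pose phi k := (\sum_(j < k.+1) N j)%N.
have phiN k : (N k <= phi k)%N by rewrite /phi big_ord_recr leq_addl.
have phiS k : (N k <= phi k.+1)%N.
  by rewrite /phi big_ord_recr (leq_trans (phiN k))// leq_addr.
pose f k := repr (u (phi k)).
(* The weight [4 ^+ k] is small enough for the sum [S] to be integrable, and large enough that [S x]
   finite bounds the increments at [x] by [2 ^- k] times the root of [S x]. *)
pose D k x := 4 ^+ k * rnorm (f k.+1 x - f k x) ^+ 2.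
have mD k : measurable_fun setT (D k).
  apply: measurable_funM => //; apply: measurable_rnorm2.
  exact: (L2fun_cmeasurable (f k.+1 - f k)).
have D0 k x : 0 <= D k x by rewrite mulr_ge0 ?sqr_ge0// exprn_ge0.
have ID k : (\int[mu]_x (D k x)%:E <= (geometric 1 (4^-1) k)%:E)%E.
  have m2 : measurable_fun setT (fun x => (rnorm (f k.+1 x - f k x) ^+ 2)%:E).
    apply/measurable_EFinP; apply: measurable_rnorm2.
    exact: (L2fun_cmeasurable (f k.+1 - f k)).
  under eq_integral do rewrite EFinM.
  rewrite (ge0_integralZl mu measurableT m2) ?lee_fin ?exprn_ge0//; last first.
    by move=> x _; rewrite lee_fin sqr_ge0.
  rewrite -(rnorm_pi (f k.+1 - f k)) -EFinM lee_fin.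
  have -> : \pi_(L2 mu) (f k.+1 - f k) = u (phi k.+1) - u (phi k).
    by rewrite [LHS](Quotient.pi_add (@ae_null R d T mu)) (Quotient.pi_opp (@ae_null R d T mu)) !reprK.
  have [p0 p1] : 0 < (4 ^+ k : R) /\ 4 ^- k * 4 ^+ k = 1 :> R.
    by rewrite exprn_gt0// mulVf// expf_neq0// pnatr_eq0.
  have := HN k _ _ (phiS k) (phiN k); have := rnorm_ge0 (u (phi k.+1) - u (phi k)).
  rewrite /geometric /= exprVn mul1r.
  move: p0 p1; move: (4 ^- k) (rnorm _) => q r; move: (4 ^+ k) => p p0 p1 r0 rq.
  apply: (@le_trans _ _ (p * q ^+ 2)); last by rewrite expr2 mulrA (mulrC p) p1 mul1r.
  by rewrite ler_pM2l// ler_pXn2r ?nnegrE// ltW// (le_lt_trans r0).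
pose S x := (\big[+%E/0%E]_(0 <= k <oo) (D k x)%:E)%E.
have S0 x : (0 <= S x)%E by apply: nneseries_ge0 => k _ _; rewrite lee_fin.
have mS : measurable_fun setT S.
  by apply: ge0_emeasurable_sum => [k x _ _|k _]; [rewrite lee_fin|exact/measurable_EFinP].
have IS : (\int[mu]_x S x < +oo)%E.
  rewrite integral_nneseries//; last by move=> *; rewrite lee_fin.
    apply: (@le_lt_trans _ _ (\big[+%E/0%E]_(0 <= k <oo) (geometric 1 (4^-1 : R) k)%:E)%E).
      apply: lee_nneseries => [k _ _|k _]; last exact: ID.
      by apply: integral_ge0 => x _; rewrite lee_fin.
    rewrite (_ : limn _ = limn (EFin \o series (geometric 1 (4^-1 : R)))).
      rewrite EFin_lim ?ltry//; apply: is_cvg_geometric_series.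
      by rewrite ger0_norm ?invr_ge0// invf_lt1// ltr1n.
    by congr (limn _); apply/funext => n; rewrite sumEFin.
  by move=> k; exact/measurable_EFinP.
have iS : mu.-integrable setT S.
  apply/integrableP; split=> //.
  by under eq_integral do rewrite gee0_abs//.
have aeS : \forall x \ae mu, S x \is a fin_num.
  by have := integrable_ae measurableT iS; apply: filterS => x; exact.
pose A := S @^-1` [set y | y \is a fin_num].
have mA : measurable A.
  by rewrite -[A]setTI; apply: emeasurable_fin_num.
(* Replacing the functions by 0 where [S] is infinite makes the limit exist everywhere, so that its
   measurability needs no completion of the measure. *)
pose g k x : R[i] := if x \in A then f k x else 0.
pose l x : R[i] := (limn (fun n => Re (g n x)) +i* limn (fun n => Im (g n x)))%C.
have gl x : [/\ (fun n => Re (g n x)) @ \oo --> Re (l x),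
    (fun n => Im (g n x)) @ \oo --> Im (l x)
    & forall k, rnorm (l x - g k x) ^+ 2 <= 8 * fine (S x) * 4 ^- k].
  have S0' : 0 <= fine (S x) by rewrite fine_ge0.
  have [|? ? H] := @geometric_ccvg (g ^~ x) (Num.sqrt (fine (S x))).
    move=> k; rewrite /g; case: ifPn => [/set_mem /= xA|_]; last first.
      by rewrite subr0 /rnorm normr0 mulr_ge0 ?sqrtr_ge0// invr_ge0 exprn_ge0.
    have : ((D k x)%:E <= S x)%E.
      have D0' n : (0 <= n)%N -> xpredT n -> (0 <= (D n x)%:E)%E by rewrite lee_fin.
      apply: le_trans (nneseries_lim_ge k.+1 D0').
      by rewrite big_nat_recr//= leeDr// sume_ge0// => n _; rewrite lee_fin.
    rewrite -(fineK xA) lee_fin /D => H.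
    rewrite -(@ler_pXn2r _ 2)// ?nnegrE ?crnorm_ge0 ?mulr_ge0 ?sqrtr_ge0 ?invr_ge0 ?exprn_ge0//.
    rewrite exprMn sqr_sqrtr// exprVn -exprM mulnC exprM -natrX.
    by rewrite ler_pdivlMr ?exprn_gt0// mulrC.
  by split=> // k; rewrite -[fine _]sqr_sqrtr.
have mAb : measurable_fun setT (fun x => x \in A).
  apply: (measurable_fun_bool true); rewrite setTI [X in measurable X](_ : _ = A)//.
  by apply/seteqP; split=> x /=; [move/set_mem|move/mem_set].
have mg k : cmeasurable setT (g k).
  have [mr mi] := L2fun_cmeasurable (f k).
  have gE (h : R[i] -> R) : h 0 = 0 -> (fun x => h (g k x)) = fun x =>
    if x \in A then h (f k x) else 0.
    by move=> h0; apply/funext => x; rewrite /g; case: ifP.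
  by split; rewrite gE//; apply: measurable_fun_ifT.
have ml : cmeasurable setT l.
  split; [apply: (measurable_fun_cvg (h := fun n x => Re (g n x)))|
    apply: (measurable_fun_cvg (h := fun n x => Im (g n x)))] => //.
  - by move=> n; case: (mg n).
  - by move=> x _; case: (gl x).
  - by move=> n; case: (mg n).
  - by move=> x _; case: (gl x).
pose IS1 := fine (\int[mu]_x S x)%E.
have IlD k : (\int[mu]_x (rnorm (l x - f k x) ^+ 2)%:E <= (8 * 4 ^- k * IS1)%:E)%E.
  rewrite EFinM /IS1 fineK ?integrable_fin_num// -ge0_integralZl ?lee_fin ?mulr_ge0 ?invr_ge0 ?exprn_ge0//.
  apply: ae_ge0_le_integral => //.
  - by move=> x _; rewrite lee_fin sqr_ge0.
  - apply/measurable_EFinP; apply: measurable_rnorm2; split.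
      under eq_fun do rewrite raddfB /=.
      by apply: measurable_funB; [case: ml|case: (L2fun_cmeasurable (f k))].
    under eq_fun do rewrite raddfB /=.
    by apply: measurable_funB; [case: ml|case: (L2fun_cmeasurable (f k))].
  - by move=> x _; rewrite mule_ge0// lee_fin mulr_ge0// invr_ge0 exprn_ge0.
  - exact: measurable_funeM.
  apply: filterS aeS => x xA _; have [_ _ /(_ k)] := gl x.
  rewrite /g mem_set// => H; rewrite -(fineK xA) -EFinM lee_fin (le_trans H)//.
  by rewrite mulrAC.
have l_sqint : l \in sqint mu.
  apply/asboolP; split=> //.
  have := IlD 0%N; rewrite expr0 divr1 => IlD0.
  have I0 : (\int[mu]_x (rnorm (f 0%N x) ^+ 2)%:E < +oo)%E.
    by rewrite -rnorm_pi ltry.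
  have mlf : measurable_fun setT (fun x => (2 * rnorm (l x - f 0%N x) ^+ 2)).
    apply: measurable_funM => //; apply: measurable_rnorm2; split.
      under eq_fun do rewrite raddfB /=.
      by apply: measurable_funB; [case: ml|case: (L2fun_cmeasurable (f 0%N))].
    under eq_fun do rewrite raddfB /=.
    by apply: measurable_funB; [case: ml|case: (L2fun_cmeasurable (f 0%N))].
  have mf0 : measurable_fun setT (fun x => 2 * rnorm (f 0%N x) ^+ 2).
    by apply: measurable_funM => //; apply: measurable_rnorm2; exact: L2fun_cmeasurable.
  apply: (le_integral_lty (g := fun x =>
    2 * rnorm (l x - f 0%N x) ^+ 2 + 2 * rnorm (f 0%N x) ^+ 2)).
  - exact: measurable_rnorm2.
  - exact: measurable_funD.
  - move=> x; rewrite sqr_ge0 /= !rnorm2E raddfB (raddfB (@Im R)) /=.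
    move: (limn _) (limn _) => q p; case: (f 0%N x) => r s /=.
    have := sqr_ge0 (p - r - r); have := sqr_ge0 (q - s - s); nra.
  under eq_integral do rewrite EFinD.
  rewrite ge0_integralD//; last first.
  - exact/measurable_EFinP.
  - by move=> x _; rewrite lee_fin mulr_ge0// sqr_ge0.
  - exact/measurable_EFinP.
  - by move=> x _; rewrite lee_fin mulr_ge0// sqr_ge0.
  have I2 (h : T -> R) : measurable_fun setT (fun x => 2 * h x) -> (forall x, 0 <= h x) ->
      (\int[mu]_x (h x)%:E < +oo)%E -> (\int[mu]_x (2 * h x)%:E < +oo)%E.
    move=> mh h0 Ih; under eq_integral do rewrite EFinM.
    rewrite ge0_integralZl//; last by move=> *; rewrite lee_fin.
      by rewrite lte_mul_pinfty.
    apply/measurable_EFinP; rewrite (_ : h = fun x => 2^-1 * (2 * h x)).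
      exact: measurable_funM.
    by apply/funext => x; rewrite mulKf// pnatr_eq0.
  rewrite lte_add_pinfty// I2// => [x||x]; rewrite ?sqr_ge0//.
  exact: le_lt_trans IlD0 (ltry _).
pose L := MkL2fun l_sqint.
exists (\pi_(L2 mu) L) => e e0.
have IS0 : 0 <= IS1 by rewrite fine_ge0// integral_ge0.
have [k kP] : exists k, 8 * 4 ^- k * IS1 < (e / 2) ^+ 2 /\ 4 ^- k < e / 2.
  have c0 : 0 < Num.min ((e / 2) ^+ 2 / (8 * IS1 + 1)) (e / 2).
    by rewrite lt_min !divr_gt0 ?exprn_gt0 ?divr_gt0// ltr_wpDl// mulr_ge0.
  have [k] := exp2_small c0; rewrite lt_min => /andP[k1 k2]; exists k.
  have k4 : 4 ^- k <= 2 ^- k :> R.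
    by rewrite lef_pV2 ?posrE ?exprn_gt0// lerXn2r ?nnegrE// ler_nat.
  split; last exact: le_lt_trans k2.
  move: k1; rewrite ltr_pdivlMr ?ltr_wpDl ?mulr_ge0//.
  have : 0 < 2 ^- k :> R by rewrite invr_gt0 exprn_gt0.
  by move: k4; move: (4 ^- k) (2 ^- k) (_ ^+ 2) => p q r; nra.
exists (N k) => n kn.
apply: (le_lt_trans (ler_rnormB _ (u (phi k)) _)); rewrite [e]splitr ltrD//.
  have e2 : 0 <= e / 2 by rewrite divr_ge0// ltW.
  rewrite -(@ltr_pXn2r _ 2) ?nnegrE ?rnorm_ge0//.
  apply: le_lt_trans kP.1; rewrite -lee_fin; apply: le_trans (IlD k).
  rewrite -(rnorm_pi (L - f k)).
  by rewrite [in leRHS](Quotient.pi_add (@ae_null R d T mu)) (Quotient.pi_opp (@ae_null R d T mu)) !reprK.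
by apply: lt_trans kP.2; exact: HN.
Qed.

End L2.

End riesz_fischer.

(** * Sums over orthogonal families *)

Section esum_seq.
Context (R : realType) (I : choiceType) (D : set I) (a : I -> R).

(** Duplicate-free sequences replace the finite sets in the definition of [esum], so that partial
    sums are sums over lists. *)
Definition uniq_in (s : seq I) : Prop := uniq s /\ forall i, i \in s -> D i.

Lemma esum_seq_le s : uniq_in s ->
  ((\sum_(i <- s) a i)%:E <= \esum_(i in D) (a i)%:E)%E.
Proof.
move=> [us sD]; rewrite -sumEFin; apply: esum_ge.
exists [set` s]; last by rewrite (fsbig_seq _ _ us).
by split; [exact: finite_seq|move=> i /= /sD].
Qed.

Lemma esum_seq_gt (t : R) : (t%:E < \esum_(i in D) (a i)%:E)%E ->
  exists s, uniq_in s /\ t < \sum_(i <- s) a i.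
Proof.
move=> /ereal_sup_gt[_ [A [fA AD] <-]]; rewrite fsbig_finite// sumEFin lte_fin => tA.
exists (finmap.enum_fset (fset_set A)); split=> //; split; first exact: finmap.fset_uniq.
by move=> i iA; apply: AD; move: iA; rewrite in_fset_set// => /set_mem.
Qed.

Lemma esum_seq_lub (r : R) : (forall s, uniq_in s -> \sum_(i <- s) a i <= r) ->
  (\esum_(i in D) (a i)%:E <= r%:E)%E.
Proof.
move=> H; rewrite leNgt; apply/negP => /esum_seq_gt[s [us]].
by apply/negP; rewrite -leNgt H.
Qed.

End esum_seq.

Section orthogonal_family.
Context (R : realType) (E : innerType R).
Hypothesis cE : forall u : nat -> E, cauchy_sequence u -> exists x, tends u x.
Context (I : choiceType) (D : set I) (M : I -> set E).
Hypothesis cM : forall i, D i -> closed_subspace (M i).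
Hypothesis oM : forall i j, D i -> D j -> i <> j ->
  forall x y, M i x -> M j y -> inner x y = 0.
Implicit Types (s : seq I) (c : I -> E) (x y : E).

Lemma family_sum_inner c s j y : uniq_in D s -> (forall i, D i -> M i (c i)) -> D j -> M j y ->
  inner (\sum_(i <- s) c i) y = if j \in s then inner (c j) y else 0.
Proof.
move=> [us sD] Mc Dj My; rewrite inner_suml; case: ifP => [js|/negbT js].
  rewrite (bigD1_seq j)//= big_seq_cond big1 ?addr0// => i /andP[/sD Di /eqP ij].
  exact: (oM Di Dj ij (Mc _ Di) My).
rewrite big_seq_cond big1// => i /andP[/[dup] si /sD Di _].
by apply: (oM Di Dj _ (Mc _ Di) My) => ij; rewrite -ij si in js.
Qed.

Lemma family_sum_rnorm c s : uniq_in D s -> (forall i, D i -> M i (c i)) ->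
  rnorm (\sum_(i <- s) c i) ^+ 2 = \sum_(i <- s) rnorm (c i) ^+ 2.
Proof.
move=> us Mc; rewrite rnorm2Re inner_sumr (big_morph (@Re R) (raddfD (@Re R)) (raddf0 (@Re R))).
apply: eq_big_seq => i si; have Di := us.2 _ si.
by rewrite (family_sum_inner us Mc Di (Mc _ Di)) si rnorm2Re.
Qed.

Lemma family_sum_proj c s j : uniq_in D s -> (forall i, D i -> M i (c i)) -> D j ->
  proj (M j) (\sum_(i <- s) c i) = if j \in s then c j else 0.
Proof.
move=> us Mc Dj; apply: proj_uniq => //; first exact: cM.
  by case: ifP => _; [exact: Mc|exact: subspace0 (cM Dj).1].
move=> z Mz; rewrite innerBl (family_sum_inner us Mc Dj Mz).
by case: ifP => _; rewrite ?inner0l subrr.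
Qed.

Let P s x := \sum_(i <- s) proj (M i) x.

Let projM x i : D i -> M i (proj (M i) x).
Proof. by move=> Di; have [] := projP cE x (cM Di). Qed.

Lemma bessel s x : uniq_in D s ->
  rnorm x ^+ 2 = rnorm (x - P s x) ^+ 2 + \sum_(i <- s) rnorm (proj (M i) x) ^+ 2.
Proof.
move=> us; have {1}-> : x = (x - P s x) + P s x by rewrite subrK.
rewrite pythagoras.
  by rewrite (family_sum_rnorm us (@projM x)).
rewrite inner_sumr big_seq big1// => i si; have Di := us.2 _ si.
rewrite innerBl (family_sum_inner us (@projM x) Di (projM x Di)) si.
by rewrite -innerBl; have [_ ->//] := projP cE x (cM Di); exact: projM.
Qed.

(** For the lower bound, a combination within the root of [e] of [x] involves only finitely many
    indices [s], and the projection [P s x] is at least as close to [x]. *)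
Lemma parseval x : clspan (\bigcup_(i in D) M i) x ->
  (\esum_(i in D) (rnorm (proj (M i) x) ^+ 2)%:E)%E = (rnorm x ^+ 2)%:E.
Proof.
move=> Gx; apply/eqP; rewrite eq_le; apply/andP; split.
  by apply: esum_seq_lub => s us; rewrite (bessel x us) lerDr sqr_ge0.
apply/lee_addgt0Pr => e e0.
have /closureP/(_ (Num.sqrt e))[|y [n [b [v [Mv ->]]]] xy] := Gx.
  by rewrite sqrtr_gt0.
have /choice[k Hk] : forall j : 'I_n, exists i, D i /\ M i (v j).
  by move=> j; have [i Di Mi] := Mv j; exists i.
pose s := undup [seq k j | j <- enum 'I_n].
have us : uniq_in D s.
  split; first exact: undup_uniq.
  by move=> i; rewrite mem_undup => /mapP[j _ ->]; case: (Hk j).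
have ks j : k j \in s by rewrite mem_undup map_f// mem_enum.
apply: (@le_trans _ _ ((\sum_(i <- s) rnorm (proj (M i) x) ^+ 2)%:E + e%:E)%E).
  rewrite -EFinD lee_fin (bessel x us) addrC lerD2l.
  set z := \sum_(j < n) _ in xy *.
  have : rnorm (x - z) ^+ 2 = rnorm (x - P s x) ^+ 2 + rnorm (P s x - z) ^+ 2.
    have -> : x - z = (x - P s x) + (P s x - z) by rewrite subrKA.
    apply: pythagoras; rewrite innerBr inner_sumr big_seq big1 ?sub0r.
      rewrite /z inner_sumr big1 ?oppr0// => j _; rewrite innerZr innerBl.
      have [Dk Mk] := Hk j; rewrite (family_sum_inner us (@projM x) Dk Mk) ks.
      by rewrite -innerBl (projP cE x (cM Dk)).2// mulr0.
    move=> i si; have Di := us.2 _ si; rewrite innerBl.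
    rewrite (family_sum_inner us (@projM x) Di (projM x Di)) si -innerBl.
    by rewrite (projP cE x (cM Di)).2//; exact: projM.
  move: xy; rewrite -(@ltr_pXn2r _ 2) ?nnegrE ?rnorm_ge0 ?sqrtr_ge0//.
  rewrite sqr_sqrtr; last exact: ltW.
  move=> lt_xz xzE; apply: (le_trans _ (ltW lt_xz)).
  by rewrite xzE lerDl sqr_ge0.
by rewrite leeD2r// esum_seq_le.
Qed.

(** The index set carries no enumeration. The partial sums run over finite sets [s n] that miss less
    than [4 ^- n] of the total, so any finite set disjoint from [s n] contributes a vector of norm
    below [2 ^- n]. *)
Lemma synthesis c : (forall i, D i -> M i (c i)) ->
  (\esum_(i in D) (rnorm (c i) ^+ 2)%:E < +oo)%E ->
  exists x, clspan (\bigcup_(i in D) M i) x /\ forall i, D i -> proj (M i) x = c i.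
Proof.
move=> Mc; set S := \esum_(i in D) _ => Sfin.
have S0 : (0 <= S)%E by apply: esum_ge0 => i _; rewrite lee_fin sqr_ge0.
have SE : S = (fine S)%:E by rewrite fineK// ge0_fin_numE.
have /choice[s Hs] n : exists s, uniq_in D s /\
    fine S - 4 ^- n < \sum_(i <- s) rnorm (c i) ^+ 2.
  by apply: esum_seq_gt; rewrite -/S SE lte_fin ltrBlDr ltrDl invr_gt0 exprn_gt0.
have tail n t : uniq_in D t -> (forall i, i \in t -> i \notin s n) ->
    rnorm (\sum_(i <- t) c i) < 2 ^- n.
  move=> [ut tD] ts.
  have ust : uniq_in D (s n ++ t).
    split; first rewrite cat_uniq (Hs n).1.1 ut andbT andTb.
      by apply/hasPn => i /ts.
    by move=> i; rewrite mem_cat => /orP[/(Hs n).1.2//|/tD].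
  rewrite -(@ltr_pXn2r _ 2) ?nnegrE ?rnorm_ge0 ?invr_ge0 ?exprn_ge0//.
  rewrite (family_sum_rnorm (conj ut tD) Mc) exprVn -exprM mulnC exprM -natrX.
  have := esum_seq_le (fun i => rnorm (c i) ^+ 2) ust.
  by rewrite -/S SE lee_fin big_cat /=; have := (Hs n).2; lra.
pose u n := \sum_(i <- s n) c i.
(* The sets [s n] need not increase. After cancelling the common indices, each of the two remaining
   sums avoids one of the sets and is therefore a tail. *)
have uB m n : rnorm (u m - u n) < 2 ^- m + 2 ^- n.
  have -> : u m - u n = \sum_(i <- [seq i <- s m | i \notin s n]) c i -
                        \sum_(i <- [seq i <- s n | i \notin s m]) c i.
    rewrite !big_filter /u (bigID (mem (s n)))/= [X in _ - X](bigID (mem (s m)))/=.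
    rewrite opprD addrACA -[in LHS]big_filter -[X in _ - X + _]big_filter.
    rewrite [X in X - _ + _](perm_big [seq i <- s n | i \in s m]) ?subrr ?add0r//.
    apply: uniq_perm; rewrite ?filter_uniq ?(Hs _).1.1// => i.
    by rewrite !mem_filter andbC.
  rewrite (le_lt_trans (ler_rnormD _ _))// rnormN addrC.
  have uf (k l : nat) : uniq_in D [seq i <- s k | i \notin s l].
    split; first by rewrite filter_uniq// (Hs k).1.1.
    by move=> i; rewrite mem_filter => /andP[_ /(Hs k).1.2].
  rewrite ltrD// tail//; first by move=> i; rewrite mem_filter => /andP[].
  by move=> i; rewrite mem_filter => /andP[].
have cu : cauchy_sequence u.
  move=> e e0; have /exp2_small[k ke] : 0 < e / 2 by rewrite divr_gt0.
  have H n : (k <= n)%N -> 2 ^- n < e / 2 :> R.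
    move=> kn; apply: le_lt_trans ke.
    by rewrite lef_pV2 ?posrE ?exprn_gt0// ler_weXn2l// ler1n.
  exists k => m n km kn; apply: (lt_trans (uB m n)).
  by rewrite [e]splitr ltrD// H.
have [x ux] := cE cu; exists x; split.
  apply: closed_tends ux; first exact: (clspan_subspace _).2.
  move=> n; rewrite /u big_seq; apply: subspace_sum => [|i si].
    exact: (clspan_subspace _).1.
  by have Di := (Hs n).1.2 _ si; apply: sub_clspan; exists i => //; exact: Mc.
move=> j Dj; apply/eqP; rewrite -subr_eq0 -rnorm_eq0 eq_le rnorm_ge0 andbT.
apply/ler_addgt0Pr => e e0; rewrite add0r.
have e2 : 0 < e / 2 by rewrite divr_gt0.
have [n0 Hn0] := ux _ e2; have [k ke] := exp2_small e2.
pose n := maxn n0 k.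
apply: (le_trans (ler_rnormB _ (proj (M j) (u n)) _)); rewrite [e]splitr lerD//.
  rewrite -(projB cE)//; last exact: cM.
  rewrite (le_trans (rnorm_proj cE _ (cM Dj)))// ltW// Hn0// leq_maxl//.
rewrite (family_sum_proj (Hs n).1 Mc Dj); case: ifP => [_|/negbT js].
  by rewrite subrr rnorm0 ltW.
(* If [j] is not in [s n], the single index [j] is itself a tail, so [c j] is small. *)
rewrite sub0r rnormN; have := @tail n [:: j].
rewrite big_seq1 => H; apply/ltW/(lt_trans (H _ _)).
- by split=> // i; rewrite inE => /eqP->.
- by move=> i; rewrite inE => /eqP->.
- apply: le_lt_trans ke.
  by rewrite lef_pV2 ?posrE ?exprn_gt0// ler_weXn2l ?ler1n// leq_maxr.
Qed.

End orthogonal_family.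

(** * Fourier uniqueness on the torus *)

Section fourier_uniqueness.
Context (R : realType).
Local Notation square := (measurableTypeR R * measurableTypeR R)%type.
Local Notation area := (@area R).

Definition open_square : set square := `]0%R, 1%R[ `*` `]0%R, 1%R[.
Local Notation D0 := open_square.

Lemma measurable_open_square : measurable D0.
Proof. by apply: measurableX; exact: measurable_itv. Qed.
Let mD0 := measurable_open_square.

(** With [theta] equal to 0 or [- (pi / 2)] these are the real and imaginary parts of the
    characters; general [theta] makes the family closed under multiplication up to linear
    combinations and gives all half circles. *)
Definition phase (i j : int) (theta : R) (x : square) : R :=
  cos (2 * pi * (i%:~R * x.1 + j%:~R * x.2) + theta).

Lemma measurable_phase i j theta : measurable_fun setT (phase i j theta).
Proof.
apply: (measurableT_comp (f := @cos R)).
  by apply: continuous_measurable_fun; exact: continuous_cos.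
apply: measurable_funD => //; apply: measurable_funM => //.
by apply: measurable_funD; apply: measurable_funM.
Qed.

Lemma phaseM i j k l theta phi x : phase i j theta x * phase k l phi x =
  2^-1 * phase (i + k) (j + l) (theta + phi) x +
  2^-1 * phase (i - k) (j - l) (theta - phi) x.
Proof.
rewrite /phase !rmorphD !rmorphN /=; set A := 2 * pi * _ + theta; set B := 2 * pi * _ + phi.
rewrite (_ : _ + (theta + phi) = A + B); last by rewrite /A /B; ring.
rewrite (_ : _ + (theta - phi) = A - B); last by rewrite /A /B; ring.
by move: A B => A B; rewrite cosD cosB; field.
Qed.

(* Indicators of half circles as bounded limits of polynomials in a cosine, which
   takes the place of the Stone-Weierstrass theorem. *)
Lemma threshold_cvg (u : R) : 0 <= u <= 1 ->
  (fun n => (1 - u ^+ n) ^+ (n * 2 ^ n)) @ \oo --> ((u < 2^-1)%R%:R : R).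
Proof.
move=> /andP[u0 u1].
(* The exponent [n * 2 ^ n] puts the threshold at 1/2: multiplied by [u ^+ n] it gives
   [n * (2 * u) ^+ n]. For [u < 1/2] this tends to 0 and Bernoulli bounds the power below by 1 minus
   it; for [u >= 1/2] it is at least [n], and the power is at most the inverse of
   [(1 + u ^+ n) ^+ N >= n + 1]. *)
have bernoulli (y : R) n : 0 <= y -> 1 + n%:R * y <= (1 + y) ^+ n.
  move=> y0; elim: n => [|n IH]; first by rewrite mul0r addr0 expr0.
  rewrite exprSr -natr1; apply: le_trans (ler_wpM2r _ IH); last by rewrite addr_ge0.
  by have := mulr_ge0 (mulr_ge0 (ler0n R n) y0) y0; lra.
have bernoulliN (y : R) n : 0 <= y <= 1 -> 1 - n%:R * y <= (1 - y) ^+ n.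
  move=> /andP[y0 y1]; elim: n => [|n IH]; first by rewrite mul0r subr0 expr0.
  rewrite exprSr -natr1; apply: le_trans (ler_wpM2r _ IH); last by rewrite subr_ge0.
  by have := mulr_ge0 (mulr_ge0 (ler0n R n) y0) y0; lra.
have un n : 0 <= u ^+ n <= 1 by rewrite exprn_ge0//= exprn_ile1.
have [u2|u2] := ltP u 2^-1.
  have nr0 : (fun n => n%:R * (2 * u) ^+ n) @ \oo --> (0 : R).
    set r := 2 * u; have [r0 r1] : 0 <= r /\ r < 1 by rewrite /r; split; lra.
    have [->|rn0] := eqVneq r 0.
      apply: cvg_near_cst; exists 1%N => // -[//|n] _.
      by rewrite expr0n mulr0.
    have rp : 0 < r by rewrite lt0r rn0.
    (* With [r = s ^+ 2], one factor [s ^+ n] compensates [n], by Bernoulli for [s^-1 = 1 + dl]; the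
       other one tends to 0. *)
    pose s := Num.sqrt r; have sp : 0 < s by rewrite sqrtr_gt0.
    have ss : s ^+ 2 = r by rewrite sqr_sqrtr.
    have s1 : s < 1 by nra.
    pose dl := s^-1 - 1; have dl0 : 0 < dl by rewrite subr_gt0 invf_gt1.
    have H n : n%:R * r ^+ n <= geometric (dl^-1) s n.
      rewrite -ss exprAC expr2 mulrA /geometric /= ler_wpM2r ?exprn_ge0 ?(ltW sp)//.
      rewrite -[leRHS]mul1r ler_pdivlMr// mulrAC -ler_pdivlMr ?exprn_gt0// div1r.
      have := bernoulli dl n (ltW dl0); rewrite [1 + dl]addrC subrK exprVn.
      by apply: le_trans; rewrite lerDr.
    apply: (squeeze_cvgr (f := fun=> 0) (h := geometric dl^-1 s)).
    - by near=> n; rewrite H mulr_ge0// exprn_ge0.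
    - exact: cvg_cst.
    - by apply: cvg_geometric; rewrite ger0_norm ?ltW.
  apply: (squeeze_cvgr (f := fun n => 1 - n%:R * (2 * u) ^+ n) (h := fun=> 1)).
  - near=> n; apply/andP; split.
      have := @bernoulliN (u ^+ n) (n * 2 ^ n)%N (un n).
      by rewrite natrM natrX exprMn mulrA.
    have /andP[un0 un1] := un n.
    by rewrite exprn_ile1// ?subr_ge0// gerBl.
  - by rewrite -[X in _ --> X]subr0; apply: cvgB nr0; exact: cvg_cst.
  - exact: cvg_cst.
apply: (squeeze_cvgr (f := fun=> 0) (h := fun n => n.+1%:R^-1)).
- near=> n; have /andP[un0 un1] := un n.
  rewrite exprn_ge0 ?subr_ge0//=.
  set N := (n * 2 ^ n)%N; have y0 : 0 <= (1 - u ^+ n) ^+ N by rewrite exprn_ge0 ?subr_ge0.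
  have H1 : (1 - u ^+ n) ^+ N * (1 + u ^+ n) ^+ N <= 1.
    rewrite -exprMn -subr_sqr expr1n exprn_ile1 ?subr_ge0 ?exprn_ile1//.
    by rewrite gerBl sqr_ge0.
  have H2 : n.+1%:R <= (1 + u ^+ n) ^+ N.
    apply: le_trans (bernoulli _ N un0); rewrite -natr1 addrC lerD2l.
    rewrite natrM natrX -mulrA -exprMn -[leLHS]mulr1 ler_wpM2l// exprn_ege1//.
    by move: u2; lra.
  rewrite -[leRHS]mul1r ler_pdivlMr ?ltr0n//; apply: le_trans H1.
  by rewrite ler_wpM2l.
- exact: cvg_cst.
- exact: cvg_harmonic.
Unshelve. all: by end_near.
Qed.

(** * Functions annihilated by h, and the sets that preserve them *)

Section annihilator.
Variable h : square -> R.
Hypothesis ih : area.-integrable D0 (EFin \o h).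

Let mh : measurable_fun D0 h.
Proof. by have /integrableP[/measurable_EFinP] := ih. Qed.

Definition bounded_measurable (t : square -> R) : Prop :=
  measurable_fun setT t /\ exists C : R, forall x, `|t x| <= C.

Lemma bounded_measurableM t s : bounded_measurable t -> bounded_measurable s ->
  bounded_measurable (fun x => t x * s x).
Proof.
move=> [mt [C tC]] [ms [B sB]]; split; first exact: measurable_funM.
by exists (C * B) => x; rewrite normrM ler_pM.
Qed.

Lemma bounded_phase i j theta : bounded_measurable (phase i j theta).
Proof. by split; [exact: measurable_phase|exists 1 => x; exact: cos_max]. Qed.

Lemma bounded_integrable t : bounded_measurable t ->
  area.-integrable D0 (EFin \o (fun x => h x * t x)).
Proof.
move=> [mt [C tC]].
have /(le_integrable mD0) : area.-integrable D0 (fun x => C%:E * (EFin \o h) x)%E.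
  exact: integrableZl.
apply.
  apply/measurable_EFinP; apply: measurable_funM => //.
  exact: measurable_funS mt.
move=> x Dx; rewrite /= lee_fin !normrM mulrC ler_wpM2r//.
by rewrite (le_trans (tC x))// ler_norm.
Qed.

(* Only these products of [h] with test functions matter, so that the class is
   stable under multiplication by phases. *)
Definition annihilated (t : square -> R) : Prop := bounded_measurable t /\
  forall i j theta, \int[area]_(x in D0) (h x * (t x * phase i j theta x)) = 0.

Lemma annihilatedD c t s : annihilated t -> annihilated s ->
  annihilated (fun x => c * t x + s x).
Proof.
move=> [bt At] [bs As]; split.
  have [[mt [C tC]] [ms [B sB]]] := (bt, bs); split.
    by apply: measurable_funD => //; apply: measurable_funM.
  exists (`|c| * C + B) => x; rewrite (le_trans (ler_normD _ _))// lerD//.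
  by rewrite normrM ler_wpM2l.
move=> i j theta.
have it := bounded_integrable (bounded_measurableM bt (bounded_phase i j theta)).
have is_ := bounded_integrable (bounded_measurableM bs (bounded_phase i j theta)).
under eq_Rintegral => x _ do rewrite mulrDl mulrDr -mulrA (mulrCA (h x)).
rewrite RintegralD//; last exact: integrableZl it.
by rewrite RintegralZl// At As mulr0 addr0.
Qed.

Lemma annihilated_phase k l phi t : annihilated t -> annihilated (fun x =>
  t x * phase k l phi x).
Proof.
move=> [bt At]; split; first exact: bounded_measurableM (bounded_phase k l phi).
move=> i j theta.
have ip i' j' th := bounded_integrable (bounded_measurableM bt (bounded_phase i' j' th)).
transitivity (\int[area]_(x in D0) (
    2^-1 * (h x * (t x * phase (k + i) (l + j) (phi + theta) x)) +
    2^-1 * (h x * (t x * phase (k - i) (l - j) (phi - theta) x)))).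
  by apply: eq_Rintegral => x _; rewrite -[t x * _ * _]mulrA phaseM; ring.
rewrite RintegralD//; [|exact: integrableZl (ip _ _ _)..].
by rewrite !RintegralZl// !At mulr0 addr0.
Qed.

Lemma annihilated_lim (t_ : nat -> square -> R) t (C : R) :
  (forall n, annihilated (t_ n)) -> (forall n x, `|t_ n x| <= C) ->
  (forall x, (fun n => t_ n x) @ \oo --> t x) -> annihilated t.
Proof.
move=> At tC tt.
have mt : measurable_fun setT t.
  apply: (measurable_fun_cvg (h := t_)) => [n|x _]; last exact: tt.
  by have [[]] := At n.
have bt : bounded_measurable t.
  split=> //; exists C => x; have H : (fun n =>
    `|t_ n x|) @ \oo --> `|t x| by apply: cvg_norm; exact: tt.
  rewrite -(cvg_lim _ H)//; apply: limr_le; first exact: cvgP H.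
  by exists 0%N => // n _; exact: tC.
split=> // i j theta.
have itp := bounded_integrable (bounded_measurableM bt (bounded_phase i j theta)).
have C0 : 0 <= C by rewrite (le_trans (normr_ge0 _) (tC 0%N (0, 0))).
have btn n : bounded_measurable (fun x => t_ n x * phase i j theta x).
  by apply: bounded_measurableM (bounded_phase i j theta); case: (At n).
have mhb s : bounded_measurable s -> measurable_fun D0 (fun x => (h x * s x)%:E).
  move=> [ms _]; apply/measurable_EFinP; apply: measurable_funM => //.
  exact: measurable_funS ms.
have cv x : D0 x -> (fun n => (h x * (t_ n x * phase i j theta x))%:E) @ \oo -->
    (h x * (t x * phase i j theta x))%:E.
  move=> _; apply: cvg_EFin; first by near=> n.
  by apply: cvgMr; apply: cvgMl; exact: tt.
have iC : area.-integrable D0 (fun x => (C * `|h x|)%:E).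
  apply: (integrableZl mD0 C (f := fun x => (`|h x|)%:E)).
  by have := integrable_abse ih.
have dom x n : D0 x -> (`|(h x * (t_ n x * phase i j theta x))%:E| <= (C * `|h x|)%:E)%E.
  move=> _; rewrite /= lee_fin normrM mulrC ler_wpM2r// normrM -[leRHS]mulr1.
  by rewrite ler_pM// cos_max.
have [_ _] := dominated_convergence mD0 (fun n => mhb _ (btn n))
  (mhb _ (bounded_measurableM bt (bounded_phase i j theta)))
  (aeW _ cv) iC (aeW _ (fun x n => dom x n)).
have E n : (\int[area]_(x in D0) (h x * (t_ n x * phase i j theta x))%:E = 0)%E.
  have ibn := bounded_integrable (btn n).
  by rewrite -[LHS]fineK ?integrable_fin_num// [fine _](At n).2.
under eq_fun do rewrite E.
by move=> H; rewrite /Rintegral -(cvg_lim _ H)// lim_cst.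
Unshelve. all: by end_near.
Qed.

(** The half circle is where [u = (1 + phase) / 2] is below 1/2. Multiplication by [u] preserves
    annihilated functions, hence so does every polynomial in [u], and [threshold_cvg] yields the
    indicator as a bounded pointwise limit. *)
Lemma annihilated_threshold k l phi t : annihilated t ->
  annihilated (fun x => t x * (phase k l phi x < 0)%R%:R).
Proof.
move=> At; pose u x := (1 + phase k l phi x) / 2.
have u01 x : 0 <= u x <= 1.
  have := cos_max (2 * pi * (k%:~R * x.1 + l%:~R * x.2) + phi); rewrite ler_norml.
  by rewrite /u /phase; lra.
have Au s : annihilated s -> annihilated (fun x => s x * u x).
  move=> As; have := annihilatedD 2^-1 As (annihilatedD (2^-1) (annihilated_phase k l phi As) (annihilatedD (-1) As As)).
  by congr annihilated; apply/funext => x; rewrite /u; field.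
have Aun s n : annihilated s -> annihilated (fun x => s x * u x ^+ n).
  move=> As; elim: n => [|n IH]; first by under eq_fun do rewrite expr0 mulr1.
  by under eq_fun do rewrite exprSr mulrA; exact: Au.
have Aun1 s n : annihilated s -> annihilated (fun x => s x * (1 - u x ^+ n)).
  move=> As; have := annihilatedD (-1) (Aun s n As) As.
  by congr annihilated; apply/funext => x; ring.
have AunN n N : annihilated (fun x => t x * (1 - u x ^+ n) ^+ N).
  elim: N => [|N IH]; first by under eq_fun do rewrite expr0 mulr1.
  by under eq_fun do rewrite exprSr mulrA; exact: Aun1.
have [[_ [C tC]] _] := At.
apply: (annihilated_lim (C := C) (fun n => AunN n (n * 2 ^ n)%N)) => [n x|x].
  have /andP[u0 u1] := u01 x.
  have un1 : u x ^+ n <= 1 by rewrite exprn_ile1.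
  have un0 : 0 <= u x ^+ n by rewrite exprn_ge0.
  rewrite normrM -[leRHS]mulr1 ler_pM// ger0_norm; last by rewrite exprn_ge0 ?subr_ge0.
  by rewrite exprn_ile1 ?subr_ge0// lerBlDr lerDl.
apply: cvgMr; have := threshold_cvg (u01 x).
by rewrite (_ : (u x < 2^-1) = (phase k l phi x < 0))// /u; apply/idP/idP; lra.
Qed.

(** Requiring that the indicator preserve annihilated functions, rather than that it be annihilated,
    gives closure under intersections at once: the multipliers form a sigma-algebra, not just a
    Dynkin system. *)
Definition multiplier (A : set square) : Prop := measurable A /\
  forall t, annihilated t -> annihilated (fun x => t x * \1_A x).

Lemma multiplier_eq A B : measurable A -> multiplier B -> A `&` D0 = B `&` D0 -> multiplier A.
Proof.
move=> mA [mB HB] AB; split=> // t At; have [[mt [C tC]] _] := At; split.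
  split; first by apply: measurable_funM => //; exact: measurable_indic.
  exists C => x; rewrite normrM -[leRHS]mulr1 ler_pM// indicE.
  by case: (x \in A); rewrite ?normr1 ?normr0.
move=> i j theta; rewrite -((HB t At).2 i j theta); apply: eq_Rintegral => x xD.
suff -> : \1_A x = \1_B x :> R by [].
move/seteqP: AB => [AB BA]; rewrite !indicE; congr (_%:R); congr nat_of_bool.
apply/idP/idP => /set_mem H; apply: mem_set.
  by have [] : (B `&` D0) x by apply: AB; split=> //; exact: set_mem.
by have [] : (A `&` D0) x by apply: BA; split=> //; exact: set_mem.
Qed.

Lemma multiplierT : multiplier setT.
Proof.
split=> // t; congr annihilated; apply/funext => x.
by rewrite indicT mulr1.
Qed.

Lemma multiplierC A : multiplier A -> multiplier (~` A).
Proof.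
move=> [mA HA]; split=> [|t At]; first exact: measurableC.
have := annihilatedD (-1) (HA t At) At; congr annihilated; apply/funext => x.
by rewrite !indicE in_setC; case: (x \in A) => /=; ring.
Qed.

Lemma multiplierI A B : multiplier A -> multiplier B -> multiplier (A `&` B).
Proof.
move=> [mA HA] [mB HB]; split=> [|t At]; first exact: measurableI.
have := HB _ (HA t At); congr annihilated; apply/funext => x.
by rewrite indicI /= mulrA.
Qed.

Lemma multiplierU A B : multiplier A -> multiplier B -> multiplier (A `|` B).
Proof.
move=> PA PB; rewrite -[A `|` B]setCK setCU; apply: multiplierC.
by apply: multiplierI; exact: multiplierC.
Qed.

Lemma multiplier_bigcup (F : nat -> set square) :
  (forall n, multiplier (F n)) -> multiplier (\bigcup_n F n).
Proof.
move=> PF; split; first by apply: bigcup_measurable => n _; case: (PF n).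
move=> t At; have [[_ [C tC]] _] := At.
have PU n : multiplier (\big[setU/set0]_(i < n) F i).
  elim: n => [|n IH]; last by rewrite big_ord_recr; apply: multiplierU.
  by rewrite big_ord0 -setCT; apply: multiplierC; exact: multiplierT.
apply: (annihilated_lim (C := C) (fun n => (PU n).2 t At)) => [n x|x].
  rewrite normrM -[leRHS]mulr1 ler_pM// indicE.
  by case: (x \in _); rewrite ?normr1 ?normr0.
apply: cvgMr; have [[m _ Fm]|nF] := pselect ((\bigcup_n F n) x).
  apply: cvg_near_cst; exists m.+1 => // n /= mn.
  rewrite !indicE !mem_set//; first by exists m.
  by rewrite -bigcup_mkord; exists m.
apply: cvg_near_cst; exists 0%N => // n _; rewrite !indicE !memNset//.
by rewrite -bigcup_mkord => -[m _ Fm]; apply: nF; exists m.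
Qed.

Lemma multiplier_phase k l phi : multiplier [set x | phase k l phi x < 0].
Proof.
split.
  rewrite -[X in measurable X]setTI;
    apply: (measurable_fun_ltr (f := phase k l phi) (g := cst 0)) => //.
  exact: measurable_phase.
move=> t /(annihilated_threshold k l phi); congr annihilated; apply/funext => x.
by rewrite indicE; congr (_ * _%:R); congr nat_of_bool; apply/idP/idP => [/mem_set|/set_mem].
Qed.

Lemma sin_2pi_gt0 (y : R) : - 2^-1 < y < 2^-1 -> (0 < sin (2 * pi * y)) = (0 < y).
Proof.
have pi0 := pi_gt0 R; move=> /andP[y1 y2]; have [y0|y0] := ltP 0 y.
  by rewrite sin_gt0_pi//; apply/andP; split; nra.
apply/negbTE; rewrite -leNgt -oppr_ge0 -sinN sin_ge0_pi//.
by apply/andP; split; nra.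
Qed.

(* Inside ]0, 1[, a ray is a Boolean combination of half circles. *)
Lemma multiplier_ray (co : square -> R) c : measurable_fun setT co ->
  (forall x, D0 x -> 0 < co x < 1) ->
  (forall phi, multiplier [set x | cos (2 * pi * co x + phi) < 0]) ->
  multiplier [set x | c < co x].
Proof.
move=> mco coD Pco.
have mc : measurable [set x | c < co x].
  by rewrite -[X in measurable X]setTI; apply: (measurable_fun_ltr (f := cst c) (g := co)).
(* On the circle of circumference 1, this is the open half circle starting at [d]. *)
have arc d : multiplier [set x | 0 < sin (2 * pi * (co x - d))].
  have := Pco (- (2 * pi * d) + pi / 2); congr multiplier; apply/seteqP; split=> x /=;
  by rewrite addrA cosDpihalf oppr_lt0 mulrBr.
have [c0|c0] := ltP c 0.
  apply: (multiplier_eq mc multiplierT); apply/seteqP; split=> x [_ Dx]; split=> //=.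
  by have /andP[? _] := coD x Dx; exact: lt_trans c0 _.
have [c1|c1] := leP 1 c.
  apply: (multiplier_eq mc (multiplierC multiplierT)); apply/seteqP.
  split=> x [/= H Dx]; last by case: H.
  by have /andP[_ x1] := coD x Dx; have := lt_le_trans x1 c1; rewrite ltNge (ltW H).
have [c2|c2] := ltP c 2^-1.
  (* For [0 <= c < 1/2], removing the arc from [c] to [c + 1/2] from the arc []0, 1/2[] leaves []0,
     c]], whose complement in []0, 1[] is the ray. *)
  apply: (multiplier_eq mc (multiplierC (multiplierI (arc 0) (multiplierC (arc c))))).
  apply/seteqP; split=> x [/= H Dx]; have /andP[x0 x1] := coD x Dx; split=> //.
    move=> [H1 H2]; apply: H2; have [x2|x2] := ltP (co x) 2^-1.
      by rewrite sin_2pi_gt0 ?subr_gt0//; lra.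
    move: H1; rewrite subr0 (_ : 2 * pi * co x = 2 * pi * (co x - 1) + pi *+ 2);
      last by rewrite mulr2n; ring.
    rewrite sinD2pi; case: (eqVneq (co x) 2^-1) => [->|xn]; last first.
      have x3 : 2^-1 < co x by rewrite lt_neqAle eq_sym xn.
      by rewrite sin_2pi_gt0; lra.
    rewrite (_ : 2 * pi * _ = - pi); last by field.
    by rewrite sinN sinpi oppr0 ltxx.
  rewrite ltNge; apply/negP => xc; apply: H; split.
    by rewrite subr0 sin_2pi_gt0//; lra.
  by apply/negP; rewrite sin_2pi_gt0; lra.
(* For [1/2 <= c < 1], the arc starting at [c] passes through 0; the arc []1/2, 1[] cuts off the
   part beyond. *)
apply: (multiplier_eq mc (multiplierI (arc 2^-1) (arc c))).
apply/seteqP; split=> x [/= H Dx]; have /andP[x0 x1] := coD x Dx; split=> //.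
  by split; rewrite sin_2pi_gt0; lra.
case: H => H1 H2; have [x2|x2] := ltP 2^-1 (co x).
  by move: H2; rewrite sin_2pi_gt0; lra.
by move: H1; rewrite sin_2pi_gt0; lra.
Qed.

Lemma multiplier_preimage (co : square ->
  R) (B : set (measurableTypeR R)) : measurable_fun setT co ->
  (forall x, D0 x -> 0 < co x < 1) ->
  (forall phi, multiplier [set x | cos (2 * pi * co x + phi) < 0]) ->
  measurable B -> multiplier (co @^-1` B).
Proof.
move=> mco coD Pco.
suff : measurable `<=` [set B : set (measurableTypeR R) | multiplier (co @^-1` B)] by apply.
have -> : @measurable _ (measurableTypeR R) = <<s @RGenOInfty.G R >>.
  exact: RGenOInfty.measurableE.
apply: smallest_sub; last first.
  move=> _ [c ->] /=; have := multiplier_ray c mco coD Pco; congr multiplier.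
  by apply/seteqP; split=> x /=; rewrite in_itv/= andbT.
split.
- by rewrite /= preimage_set0 -setCT; exact/multiplierC/multiplierT.
- by move=> A /= PA; rewrite setTD preimage_setC; exact: multiplierC.
- by move=> F /= PF; rewrite preimage_bigcup; exact: multiplier_bigcup.
Qed.

Lemma multiplier_measurable A : measurable A -> multiplier A.
Proof.
suff : measurable `<=` [set A : set square | multiplier A] by apply.
rewrite measurable_prod_measurableType; apply: smallest_sub; first split.
- by rewrite /= -setCT; exact/multiplierC/multiplierT.
- by move=> B /= PB; rewrite setTD; exact: multiplierC.
- by move=> F /= PF; exact: multiplier_bigcup.
move=> _ [B mB [C mC <-]] /=.
have -> : B `*` C = fst @^-1` B `&` snd @^-1` C by [].
apply: multiplierI; apply: multiplier_preimage => //.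
- by move=> x [/=]; rewrite in_itv.
- move=> phi; have := multiplier_phase 1 0 phi; congr multiplier.
  by apply/seteqP; split=> x /=; rewrite /phase mul1r mul0r addr0.
- by move=> x [_ /=]; rewrite in_itv.
- move=> phi; have := multiplier_phase 0 1 phi; congr multiplier.
  by apply/seteqP; split=> x /=; rewrite /phase mul1r mul0r add0r.
Qed.

Lemma fourier_unique :
  (forall i j theta, \int[area]_(x in D0) (h x * phase i j theta x) = 0) ->
  ae_eq area D0 h (fun=> 0).
Proof.
move=> H0.
have A1 : annihilated (fun=> 1).
  split; first by split=> //; exists 1 => x; rewrite normr1.
  by move=> i j theta; under eq_Rintegral => x _ do rewrite mul1r; exact: H0.
have Hae : ae_eq area D0 (EFin \o h) (fun=> 0%E).
  apply: (integral_ae_eq mD0 ih) => // A AD mA; rewrite integral0.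
  (* The phase with all parameters 0 is the constant 1, so [h] has integral 0 over every measurable
     subset of the square. *)
  have [_ /(_ _ A1)[_ /(_ 0 0 0)]] := multiplier_measurable mA.
  rewrite /Rintegral; set I := integral _ _ _ => I0.
  have iA : area.-integrable A (EFin \o h) by exact: integrableS ih.
  suff IE : (\int[area]_(x in A) (h x)%:E)%E = I.
    by rewrite -[LHS]fineK ?integrable_fin_num// [X in fine X]IE I0.
  rewrite /I -[A in LHS](setIidr AD) integral_mkcondr.
  apply: eq_integral => x _; rewrite /phase !(mul0r, mulr0, addr0) cos0 mul1r mulr1.
  by rewrite patchE indicE; case: ifP; rewrite ?mulr1 ?mulr0.
by apply: filterS Hae => x /= H Dx; have [] := H Dx.
Qed.

End annihilator.

End fourier_uniqueness.

(** * Characters of the torus and their orthogonality *)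

Section characters.
Context (R : realType).
Local Notation square := (measurableTypeR R * measurableTypeR R)%type.
Local Notation area := (@area R).
Local Notation D0 := (@open_square R).
Let mD0 := @measurable_open_square R.

Lemma integral_cos (k c : R) : sin (k + c) = sin c -> k != 0 ->
  (\int[lebesgue_measure]_(x in `]0%R, 1%R[) (cos (k * x + c))%:E = 0)%E.
Proof.
move=> kc k0.
pose F (x : R) : R := k^-1 *: sin (k *: x + c).
have dF (x : R) : is_derive x 1 F (cos (k * x + c)).
  apply: is_derive_eq.
  by rewrite /GRing.scale /= mulr1 addr0 mulrCA mulVf// mulr1.
have cF : continuous F.
  move=> x; apply: differentiable_continuous; apply/derivable1_diffP.
  by case: (dF x).
have cc : continuous (fun x : R => cos (k * x + c)).
  move=> x; apply: (@continuous_comp _ _ _ (fun x : R => k * x + c) (@cos R));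
    last exact: continuous_cos.
  by apply: continuousD; [apply: continuousM; [exact: cvg_cst|exact: cvg_id]|exact: cvg_cst].
rewrite -(integral_itv_bndoo true false); last first.
  apply/measurable_EFinP; apply: measurable_funS (continuous_measurable_fun cc) => //.
rewrite (continuous_FTC2 (F := F))//.
- by rewrite /F scaler0 add0r /GRing.scale /= mulr1 kc -EFinB subrr.
- exact: continuous_subspaceT.
- split.
  + by move=> x _; case: (dF x).
  + by apply: cvg_at_right_filter; exact: cF.
  + by apply: cvg_at_left_filter; exact: cF.
- by move=> x _; rewrite derive1E; case: (dF x).
Qed.

Lemma sin_2pi_int (n : int) (c : R) : sin (2 * pi * n%:~R + c) = sin c.
Proof.
have N m (c' : R) : sin (2 * pi * m%:R + c') = sin c'.
  elim: m => [|m IH]; first by rewrite mulr0 add0r.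
  rewrite -IH -natr1 -(sinD2pi (2 * pi * m%:R + c')); congr sin.
  by rewrite mulr2n; ring.
case: n => m; first exact: N.
rewrite -(N m.+1 (2 * pi * (Negz m)%:~R + c)) NegzE rmorphN /=; congr sin.
by rewrite mulrN addNKr.
Qed.

Lemma measure_open_square : area D0 = 1%E.
Proof.
have -> : area D0 = (@lebesgue_measure R `]0%R, 1%R[%classic * @lebesgue_measure R `]0%R,
  1%R[%classic)%E.
  by apply: product_measure1E; exact: measurable_itv.
by rewrite !lebesgue_measure_itv /= lte01 sube0 mule1.
Qed.

(** Fubini, with the inner integral taken in a variable of non-zero frequency: it runs over full
    periods and vanishes. *)
Lemma integral_phase i j theta :
  \int[area]_(x in D0) phase i j theta x = if (i == 0) && (j == 0) then cos theta else 0.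
Proof.
have [/andP[/eqP-> /eqP->]|ij] := boolP ((i == 0) && (j == 0)).
  under eq_Rintegral => x _ do rewrite /phase !(mul0r, mulr0, addr0, add0r).
  by rewrite Rintegral_cst//= measure_open_square mulr1.
have iF : area.-integrable setT ((EFin \o phase i j theta) \_ D0).
  rewrite -integrable_mkcond//; apply: (measurable_bounded_integrable mD0) => //.
  - by rewrite measure_open_square ltry.
  - exact: measurable_funS (measurable_phase i j theta).
  - exists 1; split=> // M M1 x _; apply: le_trans (ltW M1); exact: cos_max.
have mI := measurable_itv `]0%R, 1%R[.
have pi0 : pi != 0 :> R by rewrite gt_eqF// pi_gt0.
rewrite /Rintegral integral_mkcond.
have [i0|i0] := eqVneq i 0.
  have j0 : j != 0 by move: ij; rewrite i0 eqxx.
  rewrite -(fubini1 iF) [X in fine X](_ : _ = 0%E)//.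
  apply: integral0_eq => x _; rewrite /fubini_F.
  have [xI|xI] := boolP (x \in `]0, 1[); last first.
    by apply: integral0_eq => y _; rewrite patchE memNset// => -[/= H]; rewrite H in xI.
  transitivity (\int[lebesgue_measure]_(y in `]0%R,
    1%R[) (cos (2 * pi * j%:~R * y + theta))%:E)%E.
    rewrite [RHS]integral_mkcond; apply: eq_integral => y _; rewrite !patchE.
    have -> : ((x, y) \in D0) = (y \in `]0%R, 1%R[%classic).
      by apply/idP/idP => /set_mem; [case=> _ /mem_set|move=> H; apply: mem_set; split].
    by case: ifP => // _; rewrite /= /phase i0 mul0r add0r mulrA.
  by rewrite integral_cos ?sin_2pi_int// !mulf_neq0// ?pnatr_eq0// intr_eq0.
rewrite -(fubini2 iF) [X in fine X](_ : _ = 0%E)//.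
apply: integral0_eq => y _; rewrite /fubini_G.
have [yI|yI] := boolP (y \in `]0, 1[); last first.
  by apply: integral0_eq => x _; rewrite patchE memNset// => -[_ /= H]; rewrite H in yI.
transitivity (\int[lebesgue_measure]_(x in `]0%R, 1%R[)
    (cos (2 * pi * i%:~R * x + (2 * pi * (j%:~R * y) + theta)))%:E)%E.
  rewrite [RHS]integral_mkcond; apply: eq_integral => x _; rewrite !patchE.
  have -> : ((x, y) \in D0) = (x \in `]0%R, 1%R[%classic).
    by apply/idP/idP => /set_mem; [case=> /mem_set|move=> H; apply: mem_set; split].
  by case: ifP => // _; rewrite /= /phase mulrDr addrA mulrA.
by rewrite integral_cos ?sin_2pi_int// !mulf_neq0// ?pnatr_eq0// intr_eq0.
Qed.

Lemma expiD (s t : R) : expi (s + t) = expi s * expi t.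
Proof. by rewrite /expi cosD sinD; congr (_ +i* _)%C; ring. Qed.

Lemma expi0 : expi 0 = 1 :> R[i].
Proof. by rewrite /expi cos0 sin0. Qed.

Lemma expi_neq0 (t : R) : expi t != 0.
Proof.
apply/eqP => t0; have := expiD t (- t); rewrite subrr expi0 t0 mul0r => /eqP.
by rewrite oner_eq0.
Qed.

Lemma expiX (t : R) (n : int) : expi t ^ n = expi (n%:~R * t).
Proof.
have N m : expi t ^+ m = expi (m%:R * t).
  elim: m => [|m IH]; first by rewrite mul0r expi0.
  by rewrite exprSr IH -natr1 mulrDl mul1r expiD.
case: n => m; first exact: N.
change (expi t ^ Negz m) with ((expi t ^+ m.+1)^-1).
rewrite N NegzE rmorphN /= mulNr.
apply: (mulfI (expi_neq0 (m.+1%:R * t))).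
by rewrite divff ?expi_neq0// -expiD subrr expi0.
Qed.

Lemma expi_conj (t : R) : (expi t)^* = expi (- t).
Proof. by rewrite /expi cosN sinN. Qed.

Lemma rnorm_expi (t : R) : rnorm (expi t) = 1.
Proof.
apply/eqP; rewrite -(@eqrXn2 _ 2)// ?crnorm_ge0// rnorm2E /= cos2Dsin2 expr1n//.
Qed.

Definition char (u : int * int) (x : square) : R[i] :=
  (torus_point x).1 ^ u.1 * (torus_point x).2 ^ u.2.

Lemma charE u x : char u x = expi (2 * pi * (u.1%:~R * x.1 + u.2%:~R * x.2)).
Proof. by rewrite /char /= !expiX -expiD; congr expi; ring. Qed.

Lemma charD u v x : char (u + v) x = char u x * char v x.
Proof. by rewrite !charE -expiD; congr expi; rewrite /= !rmorphD /=; ring. Qed.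

Lemma char_conj u x : (char u x)^* = char (- u) x.
Proof. by rewrite !charE expi_conj; congr expi; rewrite /= !rmorphN /=; ring. Qed.

Lemma char0 x : char 0 x = 1.
Proof. by rewrite charE /= !mul0r addr0 mulr0 expi0. Qed.

Lemma rnorm_char u x : rnorm (char u x) = 1.
Proof. by rewrite charE rnorm_expi. Qed.

Lemma char_Re u x : Re (char u x) = phase u.1 u.2 0 x.
Proof. by rewrite charE /= /phase addr0. Qed.

Lemma char_Im u x : Im (char u x) = phase u.1 u.2 (- (pi / 2)) x.
Proof. by rewrite charE /= /phase cosBpihalf. Qed.

Lemma cmeasurable_char u : cmeasurable setT (char u).
Proof.
split; [under eq_fun do rewrite char_Re|under eq_fun do rewrite char_Im];
exact: measurable_phase.
Qed.

Lemma integral_char u : cintegral area D0 (char u) = (u == 0)%:R.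
Proof.
rewrite /cintegral; under eq_Rintegral => x _ do rewrite char_Re.
rewrite integral_phase; under eq_Rintegral => x _ do rewrite char_Im.
rewrite integral_phase cos0 cosN cos_pihalf if_same.
by case: u => i j; rewrite -[0 in RHS]/(0, 0) xpair_eqE /=; case: ifP.
Qed.

End characters.

(** * Exponentials in L2 of the torus *)

Section orthonormal_family.
Context (R : realType) (E : innerType R).
Hypothesis cE : forall u : nat -> E, cauchy_sequence u -> exists x, tends u x.
Implicit Types (x y w : E).

Definition line w : set E := [set c *: w | c in [set: R[i]]].

Lemma inner_unit w : rnorm w = 1 -> inner w w = 1.
Proof. by move=> w1; rewrite -rnorm2C w1 expr1n. Qed.

Lemma line_subspace w : rnorm w = 1 -> closed_subspace (line w).
Proof.
move=> w1; have ww := inner_unit w1; split.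
  split; first by exists 0; rewrite ?scale0r.
  by move=> c _ _ [d _ <-] [d' _ <-]; exists (c * d + d') => //; rewrite scalerDl scalerA.
apply/closedP => x Hx; exists (inner x w) => //.
set y := x - inner x w *: w.
have yw : inner y w = 0 by rewrite innerBl innerZl ww mulr1 subrr.
suff : rnorm y == 0 by rewrite rnorm_eq0 subr_eq0 => /eqP.
rewrite eq_le rnorm_ge0 andbT; apply/ler_addgt0Pr => e e0; rewrite add0r.
have [_ [c _ <-] xc] := Hx _ e0; apply: le_trans (ltW xc).
rewrite -(@ler_pXn2r _ 2) ?nnegrE ?rnorm_ge0//.
have -> : x - c *: w = y + (inner x w - c) *: w by rewrite /y scalerBl addrA subrK.
by rewrite [leRHS]pythagoras ?innerZr ?yw ?mulr0// lerDl sqr_ge0.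
Qed.

Lemma proj_line w x : rnorm w = 1 -> proj (line w) x = inner x w *: w.
Proof.
move=> w1; apply: (proj_uniq cE (line_subspace w1)); first by exists (inner x w).
move=> _ [c _ <-]; rewrite innerZr innerBl innerZl (inner_unit w1) mulr1 subrr.
by rewrite mulr0.
Qed.

Context (I : choiceType) (D : set I) (b : I -> E).
Hypothesis b1 : forall i, D i -> rnorm (b i) = 1.
Hypothesis bo : forall i j, D i -> D j -> i <> j -> inner (b i) (b j) = 0.

Let cM i : D i -> closed_subspace (line (b i)).
Proof. by move=> Di; apply: line_subspace; exact: b1. Qed.

Let oM i j : D i -> D j -> i <> j -> forall x y, line (b i) x -> line (b j) y -> inner x y = 0.
Proof.
move=> Di Dj ij _ _ [c _ <-] [d _ <-].
by rewrite innerZl innerZr bo// !mulr0.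
Qed.

Lemma clspan_lines : clspan (\bigcup_(i in D) line (b i)) = clspan (b @` D).
Proof.
apply/seteqP; split; apply: clspan_min; try exact: clspan_subspace.
  move=> _ [i Di [c _ <-]]; apply: (subspaceZ _ (clspan_subspace _).1).
  by apply: sub_clspan; exists i.
by move=> _ [i Di <-]; apply: sub_clspan; exists i => //; exists 1 => //; rewrite scale1r.
Qed.

Lemma rnorm_proj_line i x : D i -> rnorm (proj (line (b i)) x) = rnorm (inner x (b i)).
Proof. by move=> Di; rewrite proj_line ?rnormZ ?b1 ?mulr1. Qed.

Lemma onb_parseval x : clspan (b @` D) x ->
  (\esum_(i in D) (rnorm (inner x (b i)) ^+ 2)%:E)%E = (rnorm x ^+ 2)%:E.
Proof.
rewrite -clspan_lines => Gx; rewrite -(parseval cE cM oM Gx).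
by apply: eq_esum => i Di; rewrite rnorm_proj_line.
Qed.

Lemma onb_bessel x :
  (\esum_(i in D) (rnorm (inner x (b i)) ^+ 2)%:E <= (rnorm x ^+ 2)%:E)%E.
Proof.
apply: esum_seq_lub => s us; rewrite (bessel cE cM oM x us).
rewrite [leLHS](_ : _ = \sum_(i <- s) rnorm (proj (line (b i)) x) ^+ 2) ?lerDr ?sqr_ge0//.
by apply: eq_big_seq => i /us.2 Di; rewrite rnorm_proj_line.
Qed.

Lemma onb_synthesis (c : I -> R[i]) : (\esum_(i in D) (rnorm (c i) ^+ 2)%:E < +oo)%E ->
  exists x, clspan (b @` D) x /\ forall i, D i -> inner x (b i) = c i.
Proof.
move=> cfin.
have cb : (\esum_(i in D) (rnorm (c i *: b i) ^+ 2)%:E < +oo)%E.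
  rewrite (_ : esum _ _ = (\esum_(i in D) (rnorm (c i) ^+ 2)%:E)%E)//.
  by apply: eq_esum => i Di; rewrite rnormZ b1// mulr1.
have Mcb i : D i -> line (b i) (c i *: b i) by exists (c i).
have [x [Gx Hx]] := synthesis cE cM oM Mcb cb.
exists x; rewrite -clspan_lines; split=> // i Di.
have := Hx _ Di; rewrite proj_line ?b1// => /(congr1 (fun y => inner y (b i))).
by rewrite !innerZl (inner_unit (b1 Di)) !mulr1.
Qed.

End orthonormal_family.

(** * The unit square and completeness of the characters *)

Section square_space.
Context (R : realType).
Local Notation square := (measurableTypeR R * measurableTypeR R)%type.
Local Notation area := (@area R).
Local Notation D0 := (@open_square R).
Local Notation US := (@unit_square R).
Local Open Scope quotient_scope.
Let mD0 := @measurable_open_square R.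
Implicit Types (f g : square -> R[i]) (u v : int * int) (F : L2fun area) (w : L2 area).

Lemma measurable_unit_square : measurable US.
Proof. by apply: measurableX; exact: measurable_itv. Qed.

Lemma open_square_sub : D0 `<=` US.
Proof.
by move=> x [/=]; rewrite !in_itv/= => /andP[a b] /andP[c d]; split; rewrite /= in_itv/= !ltW.
Qed.

(** The torus is parametrized by the closed square, on whose boundary points are identified. Passing
    to the open square loses four null segments and makes [torus_point] injective. *)
Lemma ae_open_square : \forall x \ae area, US x -> D0 x.
Proof.
have neq (co : square -> R) r : (forall B : set (measurableTypeR R), measurable B ->
    lebesgue_measure B = 0%E -> area (co @^-1` B) = 0%E /\ measurable (co @^-1` B)) ->
    \forall x \ae area, co x != r.
  move=> H; have [|a0 mr] := H [set r] (measurable_set1 r); first exact: lebesgue_measure_set1.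
  by exists (co @^-1` [set r]); split=> // x /=/negP; rewrite negbK => /eqP.
have n1 r : \forall x \ae area, x.1 != r.
  apply: neq => B mB B0; have -> : fst @^-1` B = B `*` setT :> set square.
    by apply/seteqP; split=> x //= [].
  split; last exact: measurableX.
  by transitivity (@lebesgue_measure R B * @lebesgue_measure R setT)%E;
    [exact: product_measure1E|rewrite B0 mul0e].
have n2 r : \forall x \ae area, x.2 != r.
  apply: neq => B mB B0; have -> : snd @^-1` B = setT `*` B :> set square.
    by apply/seteqP; split=> x //= [].
  split; last exact: measurableX.
  by transitivity (@lebesgue_measure R setT * @lebesgue_measure R B)%E;
    [exact: product_measure1E|rewrite B0 mule0].
apply: filterS2 (filterI (n1 0) (n1 1)) (filterI (n2 0) (n2 1)) => x [/= a0 a1] [b0 b1].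
rewrite /unit_square /open_square => -[/=]; rewrite !in_itv/= => /andP[p0 p1] /andP[q0 q1].
by split; rewrite /= !lt_neqAle (eq_sym 0) ?a0 ?a1 ?b0 ?b1 ?p0 ?p1 ?q0 ?q1.
Qed.

Lemma integral_unit_square (f : square -> \bar R) : measurable_fun US f ->
  (\int[area]_(x in US) f x = \int[area]_(x in D0) f x)%E.
Proof.
move=> mf; rewrite integral_mkcond [RHS]integral_mkcond.
apply: ae_eq_integral => //.
- by apply/(measurable_restrictT _ measurable_unit_square).
- by apply/(measurable_restrictT _ mD0); apply: measurable_funS mf => //;
  [exact: measurable_unit_square|exact: open_square_sub].
apply: filterS ae_open_square => x H _; rewrite !patchE.
case: ifPn => [/set_mem/H Dx|xU]; first by rewrite mem_set.
by rewrite memNset// => /open_square_sub Ux; move/negP: xU; apply; exact: mem_set.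
Qed.

Lemma cintegral_unit_square f : cmeasurable US f -> cintegral area US f = cintegral area D0 f.
Proof.
move=> [mr mi]; rewrite /cintegral /Rintegral !integral_unit_square//;
exact/measurable_EFinP.
Qed.

(** [L2 area] consists of functions on the whole plane; those cut off outside the open square stand
    for the functions on the torus. *)
Definition restr f (x : square) : R[i] := if x \in D0 then f x else 0.

Lemma restr_comp (T : Type) (h : R[i] -> T) f : h \o restr f =
  fun x => if x \in D0 then h (f x) else h 0.
Proof. by apply/funext => x; rewrite /restr /=; case: ifP. Qed.

Lemma cmeasurable_restr f : cmeasurable D0 f -> cmeasurable setT (restr f).
Proof.
have E (h : R[i] -> R) : h 0 = 0 -> (fun x => h (restr f x)) = (h \o f) \_ D0.
  by move=> h0; rewrite -[LHS]/(h \o restr f) restr_comp h0.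
by move=> [mr mi]; split; rewrite E//; apply/(measurable_restrictT _ mD0).
Qed.

Lemma integral_rnorm_restr f :
  (\int[area]_x (rnorm (restr f x) ^+ 2)%:E = \int[area]_(x in D0) (rnorm (f x) ^+ 2)%:E)%E.
Proof.
rewrite [RHS]integral_mkcond; apply: eq_integral => x _; rewrite patchE /restr.
by case: ifP => // _; rewrite /rnorm normr0 expr0n.
Qed.

Lemma restr_sqint f : cmeasurable D0 f ->
  (\int[area]_(x in D0) (rnorm (f x) ^+ 2)%:E < +oo)%E -> square_integrable area (restr f).
Proof. by move=> mf fi; split; [exact: cmeasurable_restr|rewrite integral_rnorm_restr]. Qed.

Lemma L2_classP d (T : measurableType d) (mu : {measure set T -> \bar R}) (f : T -> R[i]) :
  square_integrable mu f -> exists2 F : L2fun mu, (F : T -> R[i]) = f & L2_class mu f =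
    \pi_(L2 mu) F.
Proof.
move=> sf; have sf' : f \in sqint mu by apply/asboolP.
exists (MkL2fun sf') => //; rewrite /L2_class; congr (\pi_(L2 mu) _); apply/val_inj.
by rewrite insubdK.
Qed.

Lemma L2fun_restr_sqint F : square_integrable area (restr F).
Proof.
have /asboolP[mF iF] := valP F.
apply: restr_sqint; first by case: mF => mr mi; split;
  [exact: measurable_funS mr|exact: measurable_funS mi].
apply: le_lt_trans iF; apply: ge0_subset_integral => //.
  by apply/measurable_EFinP; exact: measurable_rnorm2.
by move=> x _; rewrite lee_fin sqr_ge0.
Qed.

Lemma char_sqint u : square_integrable area (restr (char u)).
Proof.
apply: restr_sqint.
  by have [mr mi] := @cmeasurable_char R u; split;
    [exact: measurable_funS mr|exact: measurable_funS mi].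
under eq_integral => x _ do rewrite rnorm_char expr1n.
by rewrite integral_cst//= mul1e measure_open_square ltry.
Qed.

Definition echar u : L2 area := L2_class area (restr (char u)).

Lemma inner_echar F u : inner (\pi_(L2 area) F : L2 area) (echar u) =
  cintegral area D0 (fun x => F x * char (- u) x).
Proof.
rewrite /echar; have [G GE ->] := L2_classP (char_sqint u).
rewrite inner_pi GE /cintegral !(Rintegral_mkcond area D0).
congr (_ +i* _)%C; apply: eq_Rintegral => x _; rewrite patchE /restr;
by case: ifP => _; rewrite ?char_conj// rmorph0 mulr0.
Qed.

Lemma eq_cintegral d (T : measurableType d) (mu : {measure set T -> \bar R}) (D : set T)
  (f g : T -> R[i]) : (forall x, D x -> f x = g x) -> cintegral mu D f = cintegral mu D g.
Proof.
by move=> fg; congr (_ +i* _)%C; apply: eq_Rintegral => x /set_mem/fg ->.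
Qed.

Lemma inner_echarE u v : inner (echar u) (echar v) = (u == v)%:R.
Proof.
rewrite {1}/echar; have [F FE ->] := L2_classP (char_sqint u).
rewrite inner_echar FE -subr_eq0 -integral_char; apply: eq_cintegral => x Dx.
by rewrite /restr mem_set// -charD.
Qed.

Lemma rnorm_echar u : rnorm (echar u) = 1.
Proof.
apply/eqP; rewrite -(@eqrXn2 _ 2)// ?rnorm_ge0// rnorm2Re inner_echarE eqxx expr1n.
by [].
Qed.

Lemma echar_orthogonal u v : u <> v -> inner (echar u) (echar v) = 0.
Proof. by move=> /eqP/negbTE uv; rewrite inner_echarE uv. Qed.

(** [fourier_unique] concerns real functions, so the vanishing of the complex coefficients has to be
    turned into the vanishing of the cosine and sine coefficients of [Fr] and [Fi] separately. *)
Lemma echar_complete F :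
  (forall u, inner (\pi_(L2 area) F : L2 area) (echar u) = 0) ->
  \forall x \ae area, D0 x -> F x = 0.
Proof.
move=> H; pose Fr x := Re (F x); pose Fi x := Im (F x).
(* [G] is 1 on the square; as a product of two square-integrable functions, [F] is integrable
   there. *)
have [G GE _] := L2_classP (char_sqint 0).
have [ir ii] := L2fun_int F G.
have GD x : D0 x -> G x = 1 by move=> Dx; rewrite GE /restr mem_set// char0.
have iFr : area.-integrable D0 (EFin \o Fr).
  apply: eq_integrable (integrableS measurableT mD0 _ ir) => // x /set_mem Dx.
  by rewrite GD// rmorph1 mulr1.
have iFi : area.-integrable D0 (EFin \o Fi).
  apply: eq_integrable (integrableS measurableT mD0 _ ii) => // x /set_mem Dx.
  by rewrite GD// rmorph1 mulr1.
pose I (h : square -> R) i j theta := \int[area]_(x in D0) (h x * phase i j theta x).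
have ip h i j theta : area.-integrable D0 (EFin \o h) ->
    area.-integrable D0 (EFin \o (fun x => h x * phase i j theta x)).
  by move=> ih; apply: (bounded_integrable ih); exact: bounded_phase.
have [E1 E2] : (forall u, I Fr u.1 u.2 0 - I Fi u.1 u.2 (- (pi / 2)) = 0) /\
    (forall u, I Fr u.1 u.2 (- (pi / 2)) + I Fi u.1 u.2 0 = 0).
  have HE u : cintegral area D0 (fun x => F x * char u x) = 0.
    by rewrite -[u]opprK -inner_echar.
  split=> u; have := HE u; rewrite /cintegral => -[].
    move=> H1 _; rewrite -[RHS]H1 /I -RintegralB//; try exact: ip.
    by apply: eq_Rintegral => x _; rewrite /= -char_Re -char_Im /Fr /Fi;
      case: (F x) (char u x) => [? ?] [? ?].
  move=> _ H1; rewrite -[RHS]H1 /I -RintegralD//; try exact: ip.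
  by apply: eq_Rintegral => x _; rewrite /= -char_Re -char_Im /Fr /Fi;
    case: (F x) (char u x) => [? ?] [? ?].
(* Cosine coefficients are even in the frequency and sine coefficients odd. Comparing [u] with [- u]
   therefore separates [Fr] from [Fi]. *)
have IN h (i j : int) : I h (- i) (- j) 0 = I h i j 0.
  apply: eq_Rintegral => x _; congr (_ * _);
    rewrite /phase !rmorphN /= !mulNr -opprD mulrN !addr0.
  by rewrite cosN.
have INs h (i j : int) : area.-integrable D0 (EFin \o h) -> I h (- i) (- j) (- (pi / 2)) =
  - I h i j (- (pi / 2)).
  move=> ih; rewrite -[RHS]mulN1r /I -RintegralZl//; last exact: ip.
  apply: eq_Rintegral => x _; rewrite mulrCA; congr (_ * _);
    rewrite /phase !rmorphN /= !mulNr -opprD mulrN.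
  by rewrite !cosBpihalf sinN mul1r.
have Z i j : [/\ I Fr i j 0 = 0, I Fi i j (- (pi / 2)) = 0, I Fr i j (- (pi / 2)) = 0 &
  I Fi i j 0 = 0].
  have := E1 (i, j); have := E1 (- i, - j); have := E2 (i, j); have := E2 (- i, - j).
  rewrite /= !IN !INs//.
  move: (I Fr i j 0) (I Fi i j (- (pi / 2))) (I Fr i j (- (pi / 2))) (I Fi i j 0) =>
    A B C D e1 e2 e3 e4.
  by split; lra.
have IZ h i j theta : area.-integrable D0 (EFin \o h) ->
    I h i j 0 = 0 -> I h i j (- (pi / 2)) = 0 -> I h i j theta = 0.
  move=> ih h1 h2; transitivity (cos theta * I h i j 0 + (- sin theta) * I h i j (- (pi / 2))).
    have ic := ip h i j 0 ih; have is_ := ip h i j (- (pi / 2)) ih.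
    rewrite /I -!RintegralZl// -RintegralD//;
      [|exact: (integrableZl mD0 _ ic)|exact: (integrableZl mD0 _ is_)].
    apply: eq_Rintegral => x _; rewrite /phase cosBpihalf addr0 cosD; ring.
  by rewrite h1 h2 !mulr0 addr0.
have Fr0 := fourier_unique iFr (fun i j theta =>
  IZ Fr i j theta iFr (let: And4 a _ _ _ := Z i j in a) (let: And4 _ _ c _ := Z i j in c)).
have Fi0 := fourier_unique iFi (fun i j theta =>
  IZ Fi i j theta iFi (let: And4 _ _ _ d := Z i j in d) (let: And4 _ b _ _ := Z i j in b)).
apply: filterS2 Fr0 Fi0 => x Hr Hi Dx; have := Hr Dx; have := Hi Dx.
by rewrite /Fr /Fi; case: (F x) => a b /= -> ->.
Qed.

(** The difference of [w] and its cut-off is orthogonal to the cut-off, by disjoint supports, and to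
    [w], which is a limit of combinations of functions supported in the square. *)
Lemma echar_span_restr (J : set (int * int)) w : clspan (echar @` J) w ->
  L2_class area (restr (repr w)) = w.
Proof.
move=> Jw; have [G GE GL] := L2_classP (L2fun_restr_sqint (repr w)).
rewrite GL; set w' := \pi_(L2 area) G.
have e u : inner (w - w') (echar u) = 0.
  rewrite innerBl -{1}[w]reprK !inner_echar; apply/eqP; rewrite subr_eq0; apply/eqP.
  by apply: eq_cintegral => x Dx; rewrite GE /restr mem_set.
have ww : inner (w - w') w = 0.
  have : orth (echar @` J) (w - w') by move=> _ [u _ <-].
  by move=> /orth_clspan; apply.
have ww' : inner (w - w') w' = 0.
  rewrite innerBl -{1}[w]reprK !inner_pi; apply/eqP; rewrite subr_eq0; apply/eqP.
  by apply: eq_cintegral => x _; rewrite GE /restr; case: ifP; rewrite // rmorph0 !mulr0.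
apply/eqP; rewrite eq_sym -subr_eq0; apply/eqP/inner_self_eq0.
by rewrite innerBr ww ww' subrr.
Qed.

(** As [s] is interior, [s - t] lies strictly between -1 and 1, where the sine of [pi * (s - t)]
    vanishes only at 0. *)
Lemma expi_inj (s t : R) : 0 < s < 1 -> 0 <= t <= 1 -> expi (2 * pi * s) =
  expi (2 * pi * t) -> s = t.
Proof.
move=> /andP[s0 s1] /andP[t0 t1] st; have pi0 := pi_gt0 R.
have H : expi (2 * pi * (s - t)) = 1.
  by rewrite mulrBr expiD st -expiD subrr expi0.
have sin0' : sin (pi * (s - t)) = 0.
  move/(congr1 (@Re R)): H => /=; rewrite -mulrA mulr_natl cos_mulr2n => H.
  have := cos2Dsin2 (pi * (s - t)); apply: contra_eq => s_neq0.
  have : 0 < sin (pi * (s - t)) ^+ 2 by rewrite exprn_even_gt0.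
  move=> sp; apply/eqP => cs; move: H sp cs; rewrite mulr2n.
  by move: (cos _ ^+ 2) (sin _ ^+ 2) => p q; lra.
apply/eqP; rewrite -subr_eq0; apply/negPn/negP => d0.
have [d|d] := ltP 0 (s - t).
  have := @sin_gt0_pi R (pi * (s - t)); rewrite sin0' ltxx => H'.
  by have : false by apply: H'; apply/andP; split; nra.
have d' : 0 < t - s by rewrite subr_gt0 lt_neqAle -subr_eq0 d0 -subr_le0.
have := @sin_gt0_pi R (pi * (t - s)); rewrite -opprB mulrN sinN sin0' oppr0 ltxx => H'.
by have : false by apply: H'; apply/andP; split; nra.
Qed.

Lemma torus_point_inj (x y : square) : D0 x -> US y -> torus_point x = torus_point y -> x = y.
Proof.
case: x y => [x1 x2] [y1 y2] [/=]; rewrite !in_itv => /= X1 X2 [/=];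
  rewrite !in_itv => /= Y1 Y2.
move=> H; have := congr1 fst H; have := congr1 snd H.
by rewrite /torus_point => /(expi_inj X2 Y2) -> /(expi_inj X1 Y1) ->.
Qed.

Definition torus_arg (z : R[i] * R[i]) : square :=
  xget (0, 0) [set x | D0 x /\ torus_point x = z].

Lemma torus_argK f (y : square) : US y -> restr f (torus_arg (torus_point y)) = restr f y.
Proof.
move=> Uy; rewrite /torus_arg; case: xgetP => [x _ [Dx /(torus_point_inj Dx Uy) ->]//|H].
(* Here [y] is on the boundary. The default [(0, 0)] of [torus_arg] is outside the open square too,
   so both sides are 0. *)
rewrite /restr memNset; last by move=> -[/=]; rewrite in_itv/= ltxx.
by case: ifP => // /set_mem Dy; case: (H y).
Qed.

End square_space.

(** * The model given by a diagram *)

Section diagram_model.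
Context (R : realType) (E : innerType R).
Hypothesis cE : forall u : nat -> E, cauchy_sequence u -> exists x, tends u x.
Local Notation square := (measurableTypeR R * measurableTypeR R)%type.
Local Notation area := (@area R).
Local Notation D0 := (@open_square R).
Local Notation US := (@unit_square R).
Local Notation echar := (@echar R).
Local Open Scope quotient_scope.
Variables (J : set (int * int)) (b : int * int -> E) (w : E) (V1 V2 : E -> E).
Hypothesis dJ : diagram J.
Hypothesis b1 : forall u, J u -> rnorm (b u) = 1.
Hypothesis bo : forall u v, J u -> J v -> u <> v -> inner (b u) (b v) = 0.
Hypothesis w1 : rnorm w = 1.
Local Notation G := (clspan (b @` J)).
Local Notation L := (clspan (echar @` J)).
Hypothesis V1G : forall x, G x -> G (V1 x).
Hypothesis V2G : forall x, G x -> G (V2 x).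

Definition coefficient x u : R[i] := if u \in J then inner x (b u) else 0.

Hypothesis V1c : forall x u, G x -> J u -> inner (V1 x) (b u) = coefficient x (u - (1, 0)).
Hypothesis V2c : forall x u, G x -> J u -> inner (V2 x) (b u) = coefficient x (u - (0, 1)).

Let mD0 := @measurable_open_square R.
Let cL2 := @L2_complete R _ _ area.
Let e1 u (_ : J u) := rnorm_echar R u.
Let eo u v (_ : J u) (_ : J v) (uv : u <> v) := echar_orthogonal R uv.

Definition fourier_series x : L2 area :=
  xget 0 [set g | L g /\ forall u, inner g (echar u) = coefficient x u].
Local Notation fs := fourier_series.

Lemma fourier_synthesis (c : int * int -> R[i]) :
  (\esum_(u in J) (rnorm (c u) ^+ 2)%:E < +oo)%E ->
  exists g : L2 area, L g /\ forall u, inner g (echar u) = if u \in J then c u else 0.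
Proof.
move=> cfin; have [g [Lg Hg]] := onb_synthesis cL2 e1 eo cfin.
exists g; split=> // u; case: ifPn => [/set_mem/Hg//|uJ].
have : orth (echar @` J) (echar u).
  move=> _ [v Jv <-]; apply: echar_orthogonal => uv.
  by move/negP: uJ; apply; rewrite uv; exact: mem_set.
by move=> /orth_clspan/(_ _ Lg)/inner_eq0C.
Qed.

Lemma fourier_seriesP x : G x ->
  L (fs x) /\ forall u, inner (fs x) (echar u) = coefficient x u.
Proof.
move=> Gx; rewrite /fs; case: xgetP => [g _ //|H]; exfalso.
have [|g [Lg Hg]] := @fourier_synthesis (fun u => inner x (b u)).
  by rewrite (onb_parseval cE b1 bo Gx) ltry.
exact: (H g).
Qed.

Lemma fourier_series_rnorm x : G x -> rnorm (fs x) = rnorm x.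
Proof.
move=> Gx; have [Lf Hf] := fourier_seriesP Gx.
apply/eqP; rewrite -(@eqrXn2 _ 2)// ?rnorm_ge0//; apply/eqP.
suff : (rnorm (fs x) ^+ 2)%:E = (rnorm x ^+ 2)%:E :> \bar R by move=> [].
rewrite -(onb_parseval cL2 e1 eo Lf) -(onb_parseval cE b1 bo Gx).
by apply: eq_esum => u Ju; rewrite Hf /coefficient mem_set.
Qed.

(** The model consists of genuine functions of z, whereas the Fourier series of [x] is a class: a
    representative is cut off and pulled back along [torus_arg]. The coefficient space is the line
    of [w], which keeps the values in [E]. *)
Definition model_map x (z : R[i] * R[i]) : E := restr (repr (fs x)) (torus_arg z) *: w.

Lemma cmeasurableM (D : set square) (f g : square -> R[i]) :
  cmeasurable D f -> cmeasurable D g -> cmeasurable D (fun y => f y * g y).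
Proof.
move=> [fr fi] [gr gi]; split.
  rewrite (_ : (fun _ => _) = fun y => Re (f y) * Re (g y) - Im (f y) * Im (g y)).
    by apply: measurable_funB; exact: measurable_funM.
  by apply/funext => y; case: (f y) (g y) => [? ?] [? ?].
rewrite (_ : (fun _ => _) = fun y => Re (f y) * Im (g y) + Im (f y) * Re (g y)).
  by apply: measurable_funD; exact: measurable_funM.
by apply/funext => y; case: (f y) (g y) => [? ?] [? ?].
Qed.

Lemma restr_unit_cmeasurable (F : L2fun area) : cmeasurable US (restr F).
Proof.
have [[mr mi] _] := L2fun_restr_sqint F.
by split; [exact: measurable_funS mr|exact: measurable_funS mi].
Qed.

Lemma torus_sqnorm_line (phi : R[i] * R[i] -> E) (t : square -> R[i]) :
  cmeasurable US t -> (forall y, US y -> phi (torus_point y) = t y *: w) ->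
  torus_sqnorm phi = (\int[area]_(y in D0) (rnorm (t y) ^+ 2)%:E)%E.
Proof.
move=> [mr mi] H; rewrite /torus_sqnorm.
transitivity (\int[area]_(y in US) (rnorm (t y) ^+ 2)%:E)%E.
  by apply: eq_integral => y /set_mem Uy; rewrite H// rnormZ w1 mulr1.
apply: integral_unit_square; apply/measurable_EFinP.
under eq_fun do rewrite rnorm2E.
by apply: measurable_funD; exact: measurable_funX.
Qed.

Lemma torus_sqnorm_eq0 (phi : R[i] * R[i] -> E) (t : square -> R[i]) :
  cmeasurable US t -> (forall y, US y -> phi (torus_point y) = t y *: w) ->
  (\forall y \ae area, D0 y -> t y = 0) -> torus_sqnorm phi = 0%E.
Proof.
move=> mt /(torus_sqnorm_line mt) -> t0.
have mF : measurable_fun D0 (fun y => (rnorm (t y) ^+ 2)%:E).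
  apply/measurable_EFinP; under eq_fun do rewrite rnorm2E.
  have sub := @open_square_sub R; have mU := @measurable_unit_square R.
  have [mr mi] := mt.
  by apply: measurable_funD; apply: measurable_funX;
    [exact: measurable_funS mr|exact: measurable_funS mi].
rewrite (ae_eq_integral (fun=> 0%E))//; first exact: integral0.
by apply: filterS t0 => y H /H ->; rewrite /rnorm normr0 expr0n.
Qed.

Lemma model_map_point x y : US y -> model_map x (torus_point y) = restr (repr (fs x)) y *: w.
Proof. by move=> Uy; rewrite /model_map torus_argK. Qed.

Lemma torus_sqnorm_model x :
  torus_sqnorm (model_map x) = (\int[area]_(y in D0) (rnorm (repr (fs x) y) ^+ 2)%:E)%E.
Proof.
rewrite (torus_sqnorm_line (restr_unit_cmeasurable (repr (fs x))) (model_map_point x)).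
by apply: eq_integral => y Dy; rewrite /restr Dy.
Qed.

Lemma inner_line_cmeasurable (t : square -> R[i]) c : cmeasurable US t ->
  cmeasurable US (fun y => inner (t y *: w) (c *: w)).
Proof.
move=> mt; have -> : (fun y => inner (t y *: w) (c *: w)) = fun y => t y * c^*.
  by apply/funext => y; rewrite innerZl innerZr inner_unit// mulr1.
by apply: cmeasurableM.
Qed.

(** This provides the separable range required by [torus_measurable]. *)
Lemma rational_line_dense : exists2 A : set E, countable A & forall c, closure A (c *: w).
Proof.
exists [set (ratr q.1 +i* ratr q.2)%C *: w | q in [set: rat * rat]].
  exact: sub_countable (card_image_le _ _) (countableP _).
move=> [c d]; apply/closureP => e e0.
have e2 : 0 < e / 2 by rewrite divr_gt0.
have approx (t : R) : exists q : rat, `|t - ratr q| < e / 2.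
  have /rat_in_itvoo[q] : t - e / 2 < t + e / 2.
    by rewrite ltrBlDr -addrA ltrDl addr_gt0.
  by rewrite in_itv /= => /andP[q1 q2]; exists q; rewrite ltr_norml; lra.
have [q1 Hq1] := approx c; have [q2 Hq2] := approx d.
exists ((ratr q1 +i* ratr q2)%C *: w); first by exists (q1, q2).
rewrite -scalerBl rnormZ w1 mulr1 -(@ltr_pXn2r _ 2) ?nnegrE ?crnorm_ge0 ?(ltW e0)//.
rewrite rnorm2E /=.
have sq (s : R) : `|s| < e / 2 -> s ^+ 2 <= (e / 2) ^+ 2 by move=> /ltW/sqr_ler_norm.
have := sq _ Hq1; have := sq _ Hq2; have := mulr_gt0 e0 e0.
by rewrite -!expr2 exprMn exprVn; lra.
Qed.

(** Tested on the line of [w], the weak vector-valued Fourier integral is a scalar Fourier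
    coefficient. *)
Lemma torus_coefficient (phi : R[i] * R[i] -> E) (t : square -> R[i]) (F : L2fun area) c u :
  cmeasurable US t -> (forall y, US y -> phi (torus_point y) = t y *: w) ->
  (forall y, D0 y -> F y = t y) ->
  cintegral area US (fun y => let z := torus_point y in
    inner (phi z) (c *: w) * (z.1 ^ u.1 * z.2 ^ u.2)^*) =
  c^* * inner (\pi_(L2 area) F : L2 area) (echar u).
Proof.
move=> mt H Ft; have piZ : \pi_(L2 area) (c^* *: F) =
  c^* *: \pi_(L2 area) F by rewrite -scaleL2_pi.
rewrite -innerZl -piZ inner_echar.
transitivity (cintegral area US (fun y => inner (t y *: w) (c *: w) * char (- u) y)).
  by apply: eq_cintegral => y Uy /=; rewrite H// -char_conj.
rewrite cintegral_unit_square.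
  apply: eq_cintegral => y Dy; rewrite innerZl innerZr inner_unit// mulr1 -Ft//.
  by rewrite [F y * _]mulrC.
apply: cmeasurableM; first exact: inner_line_cmeasurable.
by have [mr mi] := @cmeasurable_char R (- u); split;
  [exact: measurable_funS mr|exact: measurable_funS mi].
Qed.

Lemma model_map_torus x : G x -> torus_space J (line w) (model_map x).
Proof.
move=> Gx; have [Lf Hf] := fourier_seriesP Gx.
split.
- by move=> y; exists (restr (repr (fs x)) (torus_arg (torus_point y))).
- split.
    move=> _ [c _ <-]; have [mr mi] := inner_line_cmeasurable c (restr_unit_cmeasurable (repr (fs x))).
    have mU := @measurable_unit_square R.
    by split; [apply: eq_measurable_fun mr|apply: eq_measurable_fun mi] => y /set_mem Uy;
      rewrite /= model_map_point.
  have [A cA HA] := rational_line_dense; exists A => // y; exact: HA.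
- by rewrite torus_sqnorm_model -integral_rnorm_restr; case: (L2fun_restr_sqint (repr (fs x))).
- move=> u Ju; split; first exact: subspace0 (line_subspace w1).1.
  move=> _ [c _ <-]; rewrite inner0l.
  rewrite (torus_coefficient (F := repr (fs x)) c u (restr_unit_cmeasurable _) (model_map_point x)).
    by rewrite reprK Hf /coefficient memNset// mulr0.
  by move=> y Dy; rewrite /restr mem_set.
Qed.

Lemma fourier_ae_eq (F : L2fun area) (g : L2 area) :
  (forall u, inner g (echar u) = inner (\pi_(L2 area) F : L2 area) (echar u)) ->
  \forall y \ae area, D0 y -> (repr g - F) y = 0.
Proof.
move=> H; apply: echar_complete => u.
rewrite (Quotient.pi_add (@ae_null R _ _ area)) (Quotient.pi_opp (@ae_null R _ _ area)) reprK.
by rewrite innerBl H subrr.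
Qed.

Lemma restr_ae0 (F : L2fun area) :
  (\forall y \ae area, D0 y -> F y = 0) -> \forall y \ae area, D0 y -> restr F y = 0.
Proof. by apply: filterS => y H Dy; rewrite /restr mem_set//; exact: H. Qed.

Lemma mul_char_L2fun (F : L2fun area) v : exists M : L2fun area,
  (forall y, M y = restr (fun x => char v x * F x) y) /\
  forall u, inner (\pi_(L2 area) M : L2 area) (echar u) =
    inner (\pi_(L2 area) F : L2 area) (echar (u - v)).
Proof.
have mFv : cmeasurable D0 (fun x => char v x * F x).
  apply: cmeasurableM.
    by have [mr mi] := @cmeasurable_char R v; split;
      [exact: measurable_funS mr|exact: measurable_funS mi].
  by have [mr mi] := L2fun_cmeasurable F; split;
    [exact: measurable_funS mr|exact: measurable_funS mi].
have [|M ME _] := @L2_classP R _ _ area (restr (fun x => char v x * F x)).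
  apply: restr_sqint => //.
  under eq_integral => x _.
    rewrite (_ : rnorm (char v x * F x) = rnorm (F x)); last first.
      by rewrite /rnorm normrM crnormE rnorm_char mul1r.
    over.
  by rewrite -integral_rnorm_restr; case: (L2fun_restr_sqint F).
exists M; split=> [y|u]; first by rewrite ME.
rewrite !inner_echar; apply: eq_cintegral => y Dy.
by rewrite ME /restr mem_set// opprB charD -mulrA mulrCA.
Qed.

(** Multiplication by [z^v] translates Fourier coefficients by [v], just as [V] translates the
    coefficients in the basis [b]. For [u] outside [J] both sides vanish, because [u - v] is outside
    [J] as well. *)
Lemma model_map_shift (V : E -> E) v x : G (V x) -> G x ->
  (forall u, J u -> inner (V x) (b u) = coefficient x (u - v)) ->
  (forall u, ~ J u -> ~ J (u - v)) ->
  torus_sqnorm (model_map (V x) - (fun z => (z.1 ^ v.1 * z.2 ^ v.2) *: model_map x z)) = 0%E.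
Proof.
move=> GVx Gx Vc Jv; have [M [ME MH]] := mul_char_L2fun (repr (fs x)) v.
have [_ HV] := fourier_seriesP GVx; have [_ Hx] := fourier_seriesP Gx.
apply: (torus_sqnorm_eq0 (restr_unit_cmeasurable (repr (fs (V x)) - M))).
  move=> y Uy; rewrite !fctE !model_map_point// scalerA -scalerBl; congr (_ *: _).
  rewrite /restr; case: ifPn => [yD|_]; last by rewrite mulr0 subrr.
  by rewrite -[RHS]/(_ - M y) ME /restr yD.
apply: restr_ae0; apply: fourier_ae_eq => u; rewrite MH reprK HV Hx {1}/coefficient.
case: ifPn => [/set_mem/Vc//|/negP uJ]; rewrite /coefficient memNset//.
by apply: Jv => /mem_set.
Qed.

Lemma diagram_model : given_by_diagram G V1 V2 J.
Proof.
split=> //; exists E, (line w); split.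
  by apply: hilbert_subspaceP cE _; exact: line_subspace.
exists model_map; split.
- move=> x Gx; split; first exact: model_map_torus.
  have [Lf _] := fourier_seriesP Gx.
  rewrite torus_sqnorm_model -integral_rnorm_restr.
  have [F FE FL] := L2_classP (L2fun_restr_sqint (repr (fs x))).
  by rewrite -FE -rnorm_pi -FL (echar_span_restr Lf) fourier_series_rnorm.
- move=> c x y Gx Gy.
  have Gxy : G (c *: x + y) by apply: ((clspan_subspace _).1.2).
  have [_ Hx] := fourier_seriesP Gx; have [_ Hy] := fourier_seriesP Gy.
  have [_ Hxy] := fourier_seriesP Gxy.
  apply: (torus_sqnorm_eq0 (restr_unit_cmeasurable (repr (fs (c *: x + y)) - (c *: repr (fs x) + repr (fs y))))).
    move=> z Uz; rewrite !fctE !model_map_point// scalerA -scalerDl -scalerBl; congr (_ *: _).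
    by rewrite /restr; case: ifP => // _; rewrite mulr0 addr0 subrr.
  apply: restr_ae0; apply: fourier_ae_eq => u.
  have -> : \pi_(L2 area) (c *: repr (fs x) + repr (fs y)) = c *: fs x + fs y.
    by rewrite piD -scaleL2_pi !reprK.
  rewrite innerDl innerZl Hxy Hx Hy /coefficient.
  by case: ifP => _; rewrite ?innerDl ?innerZl// mulr0 addr0.
- move=> phi [phiw [phim _] phifin phi0].
  have phiE y : phi (torus_point y) = inner (phi (torus_point y)) w *: w.
    by have [c _ <-] := phiw y; rewrite innerZl inner_unit// mulr1.
  pose s y := inner (phi (torus_point y)) w.
  have [mr mi] : cmeasurable US s by apply: phim; exists 1; rewrite ?scale1r.
  have mD : cmeasurable D0 s.
    have sub := @open_square_sub R; have mU := @measurable_unit_square R.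
    by split; [exact: measurable_funS mr|exact: measurable_funS mi].
  have mn : measurable_fun US (fun y => (rnorm (s y) ^+ 2)%:E).
    apply/measurable_EFinP; under eq_fun do rewrite rnorm2E.
    by apply: measurable_funD; exact: measurable_funX.
  have sfin : (\int[area]_(y in D0) (rnorm (s y) ^+ 2)%:E < +oo)%E.
    rewrite -integral_unit_square//; apply: le_lt_trans phifin; rewrite le_eqVlt; apply/orP;
      left.
    apply/eqP; apply: eq_integral => y _; rewrite [in RHS]phiE rnormZ w1 mulr1//.
  have [F FE _] := L2_classP (restr_sqint mD sfin).
  have FD y : D0 y -> F y = s y by move=> Dy; rewrite FE /restr mem_set.
  pose c u := inner (\pi_(L2 area) F : L2 area) (echar u).
  have cJ u : ~ J u -> c u = 0.
    move=> Ju; have lw : line w (1 *: w) by exists 1.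
    have [_ /(_ _ lw)] := phi0 u Ju; rewrite inner0l.
    by rewrite (torus_coefficient 1 u (conj mr mi) (fun y _ => phiE y) FD) rmorph1 mul1r =>
      /esym.
  have cfin : (\esum_(u in J) (rnorm (c u) ^+ 2)%:E < +oo)%E.
    exact: le_lt_trans (onb_bessel cL2 e1 eo _) (ltry _).
  (* The coefficients of [phi] are carried over to the basis [b] of [G]. Since they vanish outside
     [J], the image of [x] and [phi] have the same coefficients, and completeness of the characters
     identifies them. *)
  have [x [Gx Hx]] := onb_synthesis cE b1 bo cfin.
  have [_ Hfx] := fourier_seriesP Gx.
  exists x => //; apply: (@torus_sqnorm_eq0 _ (fun y => restr (repr (fs x)) y - s y)).
  + have [mr' mi'] := restr_unit_cmeasurable (repr (fs x)).
    by split; under eq_fun do rewrite raddfB /=; exact: measurable_funB.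
  + by move=> y Uy; rewrite !fctE model_map_point// [in LHS]phiE scalerBl.
  + have := @fourier_ae_eq F (fs x); move=> /(_ _)/filterS; apply.
      move=> y H Dy; rewrite -FD// /restr mem_set//; exact: H.
    move=> u; rewrite Hfx /coefficient; case: ifPn => [/set_mem/Hx//|/negP uJ].
    by rewrite -/(c u) cJ// => /mem_set.
- have J1 u : ~ J u -> ~ J (u - (1, 0)).
    move=> Ju Ju'; apply: Ju; have := dJ (i := (u - (1, 0)).1) (j := (u - (1,
      0)).2) Ju' ler01 (lexx 0).
    by congr J; case: u {Ju'} => i j /=; rewrite !subrK ?addr0// subr0.
  have J2 u : ~ J u -> ~ J (u - (0, 1)).
    move=> Ju Ju'; apply: Ju; have := dJ (i := (u - (0, 1)).1) (j := (u - (0,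
      1)).2) Ju' (lexx 0) ler01.
    by congr J; case: u {Ju'} => i j /=; rewrite !subrK ?addr0// subr0.
  move=> x Gx; split.
    have := @model_map_shift V1 (1, 0) x (V1G Gx) Gx (fun u => V1c Gx) J1.
    congr (torus_sqnorm _ = _); apply/funext => z; rewrite !fctE /mul_z1.
    by rewrite expr1z expr0z mulr1.
  have := @model_map_shift V2 (0, 1) x (V2G Gx) Gx (fun u => V2c Gx) J2.
  congr (torus_sqnorm _ = _); apply/funext => z; rewrite !fctE /mul_z2.
  by rewrite expr1z expr0z mul1r.
Qed.

End diagram_model.

(** * The diagram model on the zero space *)

Section zero_model.
Context (R : realType) (E : innerType R).
Implicit Types (f : R[i] * R[i] -> E).

Lemma torus_sqnorm0 f : (forall x, f (torus_point x) = 0) -> torus_sqnorm f = 0%E.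
Proof. by move=> f0; apply: integral0_eq => x _; rewrite f0 rnorm0 expr0n. Qed.

(** This covers a trivial wandering space, where there is no unit vector to build the model on. *)
Lemma zero_diagram_model (J : set (int * int)) (V1 V2 : E -> E) :
  (forall u : nat -> E, cauchy_sequence u -> exists x, tends u x) ->
  diagram J -> V1 0 = 0 -> V2 0 = 0 -> given_by_diagram [set 0] V1 V2 J.
Proof.
move=> cE dJ V10 V20; split=> //; exists E, [set 0]; split.
  by apply: hilbert_subspaceP cE _; exact: set0_subspace.
exists (fun _ => 0); split.
- move=> _ ->; split; last by rewrite torus_sqnorm0 ?rnorm0 ?expr0n.
  split=> //.
  + split=> [h _|].
      by split; [change (measurable_fun (unit_square (R:=R)) (cst (Re (inner 0 h))))
        | change (measurable_fun (unit_square (R:=R)) (cst (Im (inner 0 h))))];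
        exact: measurable_cst.
    exists [set 0]; first exact: countable1.
    by move=> x; apply: subset_closure.
  + by rewrite torus_sqnorm0 ?ltry.
  + move=> u _; split=> // _ ->; rewrite inner0l /cintegral.
    by congr (_ +i* _)%C; rewrite /Rintegral integral0_eq// => x _ /=; rewrite mul0r.
- move=> c x y _ _; apply: torus_sqnorm0 => z; rewrite scaler0 addr0 subr0//.
- move=> f [f0 _ _ _]; exists 0 => //; apply: torus_sqnorm0 => z.
  by rewrite sub0r fctE f0 oppr0.
- move=> x _; split; apply: torus_sqnorm0 => z.
    by rewrite sub0r fctE /mul_z1 scaler0 oppr0.
  by rewrite sub0r fctE /mul_z2 scaler0 oppr0.
Qed.

End zero_model.

(** * The order defined by the half-plane *)

Section order.
Variables a b p q : int.
Definition height (u : int * int) : int := a * u.1 + b * u.2.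

Definition upper_half : set (int * int) :=
  [set u | 0 < height u \/ height u = 0 /\ 0 < u.1].

Local Notation T := upper_half.
Local Notation e := (b, - a).
Local Notation f := (p, q).

Lemma heightD u v : height (u + v) = height u + height v.
Proof. by rewrite /height /=; ring. Qed.

Lemma heightN u : height (- u) = - height u.
Proof. by rewrite /height /=; ring. Qed.

Lemma heightB u v : height (u - v) = height u - height v.
Proof. by rewrite heightD heightN. Qed.

Lemma height_e : height e = 0.
Proof. by rewrite /height /=; ring. Qed.

Lemma height_eM (s : int) : height (s * b, - (s * a)) = 0.
Proof. by rewrite /height /=; ring. Qed.

Lemma upper_halfD u v : T u -> T v -> T (u + v).
Proof. by rewrite /T /= heightD; lia. Qed.

Lemma upper_halfN u : T u -> ~ T (- u).
Proof. by rewrite /T /= heightN; lia. Qed.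

Hypotheses (a0 : 0 <= a) (b0 : 0 < b) (pq : a * p + b * q = 1).

Lemma height_f : height f = 1.
Proof. exact: pq. Qed.

Lemma height0 : height 0 = 0.
Proof. by rewrite /height /=; ring. Qed.

Lemma heightMn u n : height (u *+ n) = height u *+ n.
Proof. by elim: n => [|n IH]; rewrite ?mulr0n ?height0// !mulrS heightD IH. Qed.

Lemma upper_half_e : T e.
Proof. by right; rewrite height_e. Qed.

Lemma height0E u : height u = 0 -> exists t : int, u = (b * t, - (a * t)).
Proof.
(* The matrix with rows [(a, b)] and [(q, - p)] has determinant -1, so this second coordinate and
   the height determine [u]. *)
move=> hu; exists (q * u.1 - p * u.2).
case: u hu => i j; rewrite /height /= => hu; congr pair.
  have : i * (a * p + b * q) = b * (q * i - p * j) + p * (a * i + b * j) by ring.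
  by rewrite pq hu mulr0 addr0 mulr1.
have : j * (a * p + b * q) = - (a * (q * i - p * j)) + q * (a * i + b * j) by ring.
by rewrite pq hu mulr0 addr0 mulr1.
Qed.

(** This is minimality of [e]: subtracting it keeps the height, and the cone meets the line of
    height 0 exactly in the positive multiples of [e]. *)
Lemma upper_half_case u : T u -> u = e \/ T (u - e).
Proof.
clear a0; move=> [u0|[u0 u1]]; first by right; left; rewrite heightB height_e subr0.
have [t ut] := height0E u0; have [t1|t1] : t = 1 \/ 1 < t.
- have : 0 < t by move: u1; rewrite ut /= pmulr_rgt0.
  by lia.
- by left; rewrite ut t1 !mulr1.
right; right; rewrite heightB height_e u0; split=> //.
by rewrite ut /= -[X in _ - X]mulr1 -mulrBr pmulr_rgt0// subr_gt0.
Qed.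

Lemma upper_half_total u : [\/ T u, u = 0 | T (- u)].
Proof.
have [u0|u0|u0] := ltgtP (height u) 0.
- by apply: Or33; left; rewrite heightN oppr_gt0.
- by apply: Or31; left.
- have [t ->] := height0E u0; have [t0|t0|->] := ltgtP t 0.
  + apply: Or33; right; split; first by rewrite heightN /height /=; ring.
    by change (0 < - (b * t)); rewrite -mulrN pmulr_rgt0 ?oppr_gt0.
  + by apply: Or31; right; rewrite /= pmulr_rgt0//; rewrite /height /=; split=> //; ring.
  + by apply: Or32; rewrite !mulr0 oppr0.
Qed.

Lemma upper_half_height0 u : T u -> height u = 0 -> exists n, u = e *+ n.+1.
Proof.
move=> Tu u0; have [t ut] := height0E u0.
have t0 : 0 < t by move: Tu => [|[_]]; rewrite ?u0 ?ltxx// ut /= pmulr_rgt0.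
case: t t0 ut => // -[//|n] _ ->; exists n.
elim: n => [|n IH]; first by rewrite !mulr1 mulr1n.
by rewrite mulrSr -IH; congr pair => /=; rewrite -[n.+2]addn1 PoszD; ring.
Qed.

Lemma upper_half_semigroup : isometry_semigroup T.
Proof.
split; [exact: upper_halfD|exact: upper_halfN|move=> m n m0 n0].
by left; rewrite /height /= ltr_wpDl ?pmulr_rgt0// mulr_ge0// ltW.
Qed.

Definition column : set (int * int) := [set u | 0 <= u.1 < b /\ 0 <= height u].

Lemma column_height n : 0 <= n -> exists2 u, column u & height u = n.
Proof.
(* The vector [n f] has height [n]; subtracting a multiple of [e] reduces its first coordinate
   modulo [b] without changing the height. *)
move=> n0; exists ((p * n %% b)%Z, q * n + a * (p * n %/ b)%Z); last first.
  have := divz_eq (p * n) b; rewrite /height /=; set r := modz _ _; set s := divz _ _.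
  move=> H; have -> : r = p * n - s * b by rewrite H; ring.
  by transitivity (n * (a * p + b * q)); [ring|rewrite pq mulr1].
split; first by rewrite /= modz_ge0 ?gt_eqF// ltz_pmod.
have := divz_eq (p * n) b; rewrite /height /=; set r := modz _ _; set s := divz _ _.
move=> H; have -> : r = p * n - s * b by rewrite H; ring.
suff -> : a * (p * n - s * b) + b * (q * n + a * s) = n * (a * p + b * q) by rewrite pq mulr1.
by ring.
Qed.

Lemma column_inj u v : column u -> column v -> height u = height v -> u = v.
Proof.
clear a0; move=> [/andP[u0 ub] _] [/andP[v0 vb] _] uv.
have [|t] := @height0E (u - v); first by rewrite heightB uv subrr.
move=> /[dup] /(congr1 fst) /= t1 tuv.
have t0 : t = 0.
  have : - b < b * t < b by rewrite -t1; apply/andP; split; lra.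
  move=> /andP[bt1 bt2].
  have : t < 1 by rewrite -(ltr_pM2l b0) mulr1.
  have : -1 < t by rewrite -(ltr_pM2l b0) mulrN1.
  lia.
by apply/eqP; rewrite -subr_eq0 tuv t0 !mulr0 oppr0.
Qed.

End order.

(** * Wold decompositions *)

Section contraction.
Context (R : realType) (E : innerType R).
Implicit Types (G H M : set E) (V : E -> E).

(** Invariance of a closed span under an operator is obtained from this: the span lies in such a
    preimage as soon as its generators do. *)
Lemma preimage_subspace H M V : closed_subspace H -> closed_subspace M ->
  (forall (c : R[i]) x y, H x -> H y -> V (c *: x + y) = c *: V x + V y) ->
  (forall x, H x -> rnorm (V x) <= rnorm x) ->
  closed_subspace [set x | H x /\ M (V x)].
Proof.
move=> [lH cH] [lM cM] lV nV.
have V0 : V 0 = 0.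
  apply/eqP; rewrite -rnorm_eq0 eq_le rnorm_ge0 andbT -[leRHS](@rnorm0 _ E).
  by apply: nV; exact: subspace0.
split.
  split; first by rewrite /= V0; split; exact: subspace0.
  move=> c x y [Hx MVx] [Hy MVy]; split; first by apply: lH.2.
  by rewrite lV//; apply: lM.2.
apply/closedP => x Hx.
have Hx' : H x by apply: (closedP H).1 => // d /Hx[y [Hy _] xy]; exists y.
split=> //; apply: (closedP M).1 => // d /Hx[y [Hy My] xy]; exists (V y) => //.
apply: le_lt_trans xy; have -> : V x - V y = V (x - y).
  by rewrite (addrC x) -[- y]scaleN1r lV// scaleN1r addrC.
by apply: nV; exact: subspaceB.
Qed.

End contraction.

(* [up u] is the unitary U_1^u.1 U_2^u.2 on the space [H] of the field generated by
   [x0] = X_(0,0), [half_space] is H^(0,0) and V^u is the restriction of [up u]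
   to it when [u] is in [upper_half0 a b]. *)
Section wold.
Context (R : realType) (E : innerType R).
Hypothesis cE : forall u : nat -> E, cauchy_sequence u -> exists x, tends u x.
Variables (H : set E) (up : int * int -> E -> E) (x0 : E) (a b p q : int).
Hypothesis cH : closed_subspace H.
Hypothesis up_iso : forall u, isometry_on H (up u).
Hypothesis up0 : forall x, H x -> up 0 x = x.
Hypothesis upD : forall u v x, H x -> up (u + v) x = up u (up v x).
Hypothesis Hx0 : H x0.
Hypotheses (a0 : 0 <= a) (b0 : 0 < b) (pq : a * p + b * q = 1).

Local Notation height := (height a b).
Local Notation T := (upper_half a b).
Local Notation e := (b, - a).
Local Notation f := (p, q).

Definition half_space : set E := clspan [set up u x0 | u in T].
Local Notation G := half_space.
Hypothesis nodet : forall x, (forall v, exists2 y, G y & x = up v y) -> x = 0.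

(** The semigroup omits 0, while the diagram of the regular part contains it. *)
Definition upper_half0 : set (int * int) := [set u | T u \/ u = 0].
Local Notation T0 := upper_half0.

Definition wandering : set E := [set x | G x /\ proj G (up (- e) x) = 0].
Local Notation K := wandering.

Definition regular_part : set E := clspan (\bigcup_(v in T0) (up v @` K)).
Local Notation Ht := regular_part.

Definition evanescent_part : set E := [set x | G x /\ orth Ht x].
Local Notation He := evanescent_part.

Definition evanescent_wandering : set E := [set x | proj G (up (- f) x) = 0] `&` He.
Local Notation E0 := evanescent_wandering.

Let upH u x : H x -> H (up u x).
Proof. by case: (up_iso u) => + _ _; apply. Qed.

Lemma half_space_subspace : closed_subspace G.
Proof. exact: clspan_subspace. Qed.
Let cG := half_space_subspace.

Lemma half_space_sub : G `<=` H.
Proof. by apply: clspan_min => // _ [u _ <-]; exact: upH. Qed.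
Let GH := half_space_sub.

Lemma up_adj u x y : H x -> H y -> inner (up u x) y = inner x (up (- u) y).
Proof.
move=> Hx Hy; rewrite -{1}(up0 Hy) -(subrr u) upD//.
by rewrite (isometry_inner (up_iso u) cH.1)//; exact: upH.
Qed.

Lemma upK u x : H x -> up u (up (- u) x) = x.
Proof. by move=> Hx; rewrite -upD// subrr up0. Qed.

Lemma upNK u x : H x -> up (- u) (up u x) = x.
Proof. by move=> Hx; rewrite -upD// addNr up0. Qed.

Lemma preimage_up u M : closed_subspace M -> closed_subspace [set x | H x /\ M (up u x)].
Proof.
move=> cM; have [_ lV _] := up_iso u; apply: preimage_subspace => // x Hx.
by rewrite (isometry_rnorm (up_iso u)).
Qed.

Lemma preimage_proj_up u M : closed_subspace M ->
  closed_subspace [set x | H x /\ M (proj G (up u x))].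
Proof.
move=> cM; have [_ lV _] := up_iso u;
  apply: (preimage_subspace (V := fun x => proj G (up u x))) => //.
  by move=> c x y Hx Hy; rewrite lV// proj_linear.
by move=> x Hx; rewrite (le_trans (rnorm_proj cE _ cG))// (isometry_rnorm (up_iso u)).
Qed.

Lemma projG_inner x y : G y -> inner (proj G x) y = inner x y.
Proof.
move=> Gy; have [_ Hp] := projP cE x cG.
by apply/eqP; rewrite eq_sym -subr_eq0 -innerBl Hp.
Qed.

Lemma projG_in x : G (proj G x).
Proof. by have [] := projP cE x cG. Qed.

Lemma projG_eq0 x : proj G x = 0 <-> forall y, G y -> inner x y = 0.
Proof.
split=> [x0' y Gy|/(proj_orth cE cG)//].
by rewrite -projG_inner// x0' inner0l.
Qed.

Lemma up_half u x : T0 u -> G x -> G (up u x).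
Proof.
move=> [Tu|->] Gx; last by rewrite up0//; exact: GH.
suff : G `<=` [set x | H x /\ G (up u x)] by move=> /(_ _ Gx)[].
apply: clspan_min; first exact: preimage_up.
move=> _ [v Tv <-]; split; first exact: upH.
by rewrite -upD//; apply: sub_clspan; exists (u + v) => //; exact: upper_halfD.
Qed.

(* The closed subspaces of [G] that reduce the compression of the action. *)
Definition reducing M : Prop :=
  [/\ closed_subspace M, M `<=` G & forall u x, M x -> M (proj G (up u x))].

Lemma reducing_up M u x : reducing M -> T0 u -> M x -> M (up u x).
Proof.
move=> [_ MG rM] Tu Mx; have := rM u x Mx.
by rewrite (proj_id cE cG)//; apply: up_half => //; exact: MG.
Qed.

(** The compressions of [up u] and [up (- u)] to [G] are adjoint to each other, and [M] is invariant
    under both. *)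
Lemma reducing_compl M : reducing M -> reducing [set x | G x /\ orth M x].
Proof.
move=> [cM MG rM]; split.
- by apply: (setI_subspace cG); exact: orth_subspace.
- by move=> x [].
- move=> u x [Gx Mx]; split; first exact: projG_in.
  move=> y My; rewrite projG_inner; last exact: MG.
  rewrite up_adj; [|exact: GH|exact/GH/MG].
  apply: inner_eq0C; rewrite -projG_inner//; apply: inner_eq0C.
  by apply: Mx; exact: rM.
Qed.

(** Minimality of [e] at work: [u - e] is in the cone or 0, so V^u G is contained in V^e G, to which
    [K] is orthogonal by definition. *)
Lemma wandering_orth u x y : K x -> T u -> G y -> inner (up u y) x = 0.
Proof.
move=> [Gx /projG_eq0 Kx] Tu Gy.
have T0e : T0 (u - e).
  by have [->|] := upper_half_case b0 pq Tu; [right; rewrite subrr|left].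
rewrite -(subrKC e u) upD; last exact: GH.
rewrite up_adj; [|exact/upH/GH|exact: GH].
by apply/inner_eq0C/Kx; exact: up_half.
Qed.

Lemma wanderingP x : K x <-> G x /\ orth (up e @` G) x.
Proof.
split=> [Kx|[Gx Kx]].
  split; first by case: Kx.
  move=> _ [y Gy <-]; apply/inner_eq0C/wandering_orth => //.
  exact: upper_half_e.
split=> //; apply/projG_eq0 => y Gy; apply: inner_eq0C.
rewrite -up_adj; [|exact: GH|exact: GH].
by apply: inner_eq0C; apply: Kx; exists y.
Qed.

Lemma wandering_subspace : closed_subspace K.
Proof.
have -> : K = G `&` orth (up e @` G) by apply/seteqP; split=> x /wanderingP.
by apply: setI_subspace => //; exact: orth_subspace.
Qed.

(** The order is total, so one of [v - u] and [u - v] is in the cone; moving the smaller translate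
    to the other side reduces to [wandering_orth]. *)
Lemma wandering_orthogonal u v x y : u <> v -> K x -> K y ->
  inner (up u x) (up v y) = 0.
Proof.
move=> uv Kx Ky; have [Gx _] := Kx; have [Gy _] := Ky.
wlog Tvu : u v x y uv Kx Ky Gx Gy / T (v - u).
  move=> W; have [Tvu|/eqP|] := upper_half_total b0 pq (v - u).
  - exact: W.
  - by rewrite subr_eq0 => /eqP vu; case: uv.
  - by rewrite opprB => Tuv; apply/inner_eq0C/W => // /esym.
rewrite up_adj; [|exact: GH|exact/upH/GH].
rewrite -upD ?[- u + v]addrC; last exact: GH.
exact/inner_eq0C/wandering_orth.
Qed.

Lemma regular_subspace : closed_subspace Ht.
Proof. exact: clspan_subspace. Qed.

Lemma regular_sub : Ht `<=` G.
Proof.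
apply: clspan_min => // _ [v Tv [k [Gk _] <-]]; exact: up_half.
Qed.

(** A translate of [K] either stays among the translates by the cone or is moved to a negative
    index; in the latter case it is orthogonal to all of [G] and its compression is 0. *)
Lemma regular_reducing : reducing Ht.
Proof.
split; [exact: regular_subspace|exact: regular_sub|move=> u x Hx].
suff : Ht `<=` [set x | H x /\ Ht (proj G (up u x))] by move=> /(_ _ Hx)[].
apply: clspan_min; first exact/preimage_proj_up/regular_subspace.
move=> _ [v Tv [k Kk <-]]; have [Gk _] := Kk; split; first exact/upH/GH.
rewrite -upD; last exact: GH.
have [Tuv|uv|Tuv] := upper_half_total b0 pq (u + v).
- have T0uv : T0 (u + v) by left.
  rewrite (proj_id cE cG); last exact: up_half.
  by apply: sub_clspan; exists (u + v) => //; exists k.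
- rewrite uv up0; last exact: GH.
  rewrite (proj_id cE cG)//; apply: sub_clspan; exists 0; first by right.
  by exists k => //; rewrite up0//; exact: GH.
- rewrite (proj_orth cE cG); first exact: subspace0 regular_subspace.1.
  move=> y Gy; rewrite up_adj; [|exact: GH|exact: GH].
  exact/inner_eq0C/wandering_orth.
Qed.

Lemma evanescent_reducing : reducing He.
Proof. exact/reducing_compl/regular_reducing. Qed.

Lemma evanescent_sub : He `<=` G.
Proof. by move=> x []. Qed.

Lemma evanescent_subspace : closed_subspace He.
Proof. by case: evanescent_reducing. Qed.

Lemma wold_sum : orthogonal_sum G Ht He.
Proof.
split; [exact: regular_subspace|exact: evanescent_subspace| |].
  by move=> x y Hx [_ Hy]; apply/inner_eq0C/Hy.
apply/seteqP; split=> [x Gx|_ [x Hx [y [Gy _] <-]]]; last first.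
  by apply: (subspaceD cG.1) => //; exact: regular_sub.
have [y [z [Hy Gz Hz ->]]] := orthK_sub cE cG regular_subspace regular_sub Gx.
by exists y => //; exists z.
Qed.

(** The defect [x - V^e (V^e)^* x] belongs to [K], hence to [Ht], but also to [He]; it is therefore
    0. *)
Lemma evanescent_unitary x : He x -> He (up (- e) x).
Proof.
move=> Hx; have [Gx _] := Hx.
have [cHe HeG rHe] := evanescent_reducing.
set y := proj G (up (- e) x); have Hy : He y by exact: rHe.
have [Gy _] := Hy.
have T0e : T0 e by left; exact: upper_half_e.
suff r0 : x - up e y = 0.
  by rewrite -(subrK (up e y) x) r0 add0r upNK//; exact: GH.
have Hr : He (x - up e y).
  by apply: subspaceB => //; [exact: cHe.1|exact: reducing_up evanescent_reducing _ _].
have Kr : K (x - up e y).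
  apply/wanderingP; split; first exact: HeG.
  move=> _ [z Gz <-]; apply: inner_eq0C; rewrite innerBr.
  rewrite (isometry_inner (up_iso e) cH.1) ?up_adj; try exact: GH.
  by rewrite [inner z y]innerC projG_inner// -innerC subrr.
apply: inner_self_eq0; have [_] := Hr; apply.
apply: sub_clspan; exists 0; first by right.
by exists (x - up e y) => //; rewrite up0//; exact/GH/HeG.
Qed.

(** An index of non-negative height outside the cone is a negative multiple of [e], and on [He] the
    action of [- e] is available. *)
Lemma evanescent_up u x : 0 <= height u -> He x -> He (up u x).
Proof.
move=> hu Hx; have [Tu|u0|Tu] := upper_half_total b0 pq u.
- by apply: reducing_up evanescent_reducing _ Hx; left.
- by apply: reducing_up evanescent_reducing _ Hx; right.
have hu0 : height (- u) = 0.
  apply/eqP; rewrite eq_le heightN oppr_le0 hu /=; rewrite -heightN.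
  by case: Tu => [/ltW//|[->]].
have [n Hn] := upper_half_height0 b0 pq Tu hu0.
rewrite -[u]opprK Hn => {Hn hu hu0 Tu}.
elim: n.+1 => [|m IH]; first by rewrite mulr0n oppr0 up0//; exact/GH/evanescent_sub.
rewrite mulrS opprD upD; last exact/GH/evanescent_sub.
exact: evanescent_unitary.
Qed.

Lemma evanescent_wandering_sub : E0 `<=` He.
Proof. by move=> x []. Qed.

Lemma evanescent_wanderingP x : E0 x <-> He x /\ orth (up f @` G) x.
Proof.
split=> [[/projG_eq0 Ex Hx]|[Hx Ex]]; split=> //.
  move=> _ [y Gy <-]; apply: inner_eq0C.
  rewrite up_adj; [|exact: GH|exact/GH/evanescent_sub].
  exact/inner_eq0C/Ex.
apply/projG_eq0 => y Gy; apply: inner_eq0C.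
rewrite -up_adj; [|exact: GH|exact/GH/evanescent_sub].
by apply/inner_eq0C/Ex; exists y.
Qed.

Lemma evanescent_wandering_subspace : closed_subspace E0.
Proof.
have -> : E0 = He `&` orth (up f @` G) by apply/seteqP; split=> x /evanescent_wanderingP.
by apply: setI_subspace; [exact: evanescent_subspace|exact: orth_subspace].
Qed.

(** Here [u - f] may lie outside the cone, so V^u G need not be inside V^f G. The [Ht] part of [y]
    stays in [Ht], which is orthogonal to [He]; on the [He] part non-negative height of [u - f]
    suffices. *)
Lemma evanescent_wandering_orth u x y : E0 x -> 0 < height u -> G y ->
  inner (up u y) x = 0.
Proof.
move=> /evanescent_wanderingP[Hx Ex] hu Gy.
have T0u : T0 u by left; left.
have [_ _ _ GE] := wold_sum; move: Gy; rewrite {1}GE => -[yt Hyt [ye Hye <-]].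
have [Gt Ge] := (regular_sub Hyt, evanescent_sub Hye).
have [_ lV _] := up_iso u; rewrite -[yt]scale1r lV ?scale1r; try exact: GH.
rewrite innerDl; have -> : inner (up u yt) x = 0.
  by apply: inner_eq0C; apply: (Hx.2); exact: reducing_up regular_reducing _ _.
rewrite add0r -(subrKC f u) upD; last exact: GH.
apply/inner_eq0C/Ex; eexists; last by [].
by apply/evanescent_sub/evanescent_up => //; rewrite heightB height_f// subr_ge0.
Qed.

Lemma evanescent_wandering_up u x : height u = 0 -> E0 x -> E0 (up u x).
Proof.
move=> hu Ex; have Hx := evanescent_wandering_sub Ex.
apply/evanescent_wanderingP; split; first by apply: evanescent_up; rewrite ?hu.
move=> _ [y Gy <-]; rewrite up_adj; [|exact/GH/evanescent_sub|exact/upH/GH].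
rewrite -upD; last exact: GH.
apply/inner_eq0C/evanescent_wandering_orth => //.
by rewrite heightD heightN hu height_f.
Qed.

Lemma evanescent_levels u v x y : height u <> height v -> E0 x -> E0 y ->
  inner (up u x) (up v y) = 0.
Proof.
move=> uv Ex Ey.
have [Gx Gy] := (evanescent_sub (evanescent_wandering_sub Ex),
                 evanescent_sub (evanescent_wandering_sub Ey)).
wlog huv : u v x y uv Ex Ey Gx Gy / height u < height v.
  move=> W; have [vu|vu|//] := ltgtP (height u) (height v); first exact: W.
  by apply/inner_eq0C/W => // /esym.
rewrite up_adj; [|exact: GH|exact/upH/GH].
rewrite -upD; last exact: GH.
by apply/inner_eq0C/evanescent_wandering_orth; rewrite // heightD heightN addrC subr_gt0.
Qed.

Local Notation J0 := (column a b).

(** A vector [x] of [He] orthogonal to all levels can be divided by V^f indefinitely inside [He]; it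
    then lies in every translate of [G], and [nodet] applies. *)
Lemma evanescent_span : clspan (\bigcup_(u in J0) (up u @` E0)) = He.
Proof.
have J0E u x : J0 u -> E0 x -> He (up u x).
  by move=> [_ hu] /evanescent_wandering_sub; exact: evanescent_up.
apply: (closed_subspace_eq cE evanescent_subspace (clspan_subspace _)).
  apply: clspan_min; first exact: evanescent_subspace.
  by move=> _ [u Ju [x Ex <-]]; exact: J0E.
move=> x Hx xo; have Gx := evanescent_sub Hx.
have step n : exists2 y, He y & x = up (f *+ n) y.
  elim: n => [|n [y Hy xy]]; first by exists x; rewrite ?mulr0n ?up0//; exact: GH.
  have Gy := evanescent_sub Hy.
  have T0f : T0 f by left; left; rewrite height_f.
  set z := proj G (up (- f) y); have Hz : He z.
    by have [_ _] := evanescent_reducing; apply.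
  have Gz := evanescent_sub Hz.
  exists z => //; rewrite mulrSr upD; last exact: GH.
  (* The remainder [y - V^f (V^f)^* y] lies in [E0]. Translated by [f *+ n] it lies in the level of
     height [n], to which [x] is orthogonal. *)
  suff r0 : y - up f z = 0 by rewrite xy -{1}(subrK (up f z) y) r0 add0r.
  have Er : E0 (y - up f z).
    apply/evanescent_wanderingP; split.
      by apply: subspaceB => //;
        [exact: evanescent_subspace.1|exact: reducing_up evanescent_reducing _ _].
    move=> _ [w Gw <-]; apply: inner_eq0C; rewrite innerBr.
    rewrite (isometry_inner (up_iso f) cH.1) ?up_adj; try exact: GH.
    by rewrite [inner w z]innerC projG_inner// -innerC subrr.
  apply: inner_self_eq0; rewrite {1}innerBl.
  have Gr := evanescent_sub (evanescent_wandering_sub Er).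
  rewrite [X in _ - X](_ : _ = 0) ?subr0.
    rewrite -(isometry_inner (up_iso (f *+ n)) cH.1); try exact: GH.
    rewrite -xy; apply: xo; apply: sub_clspan.
    have [u Ju hu] := column_height b0 pq (le0z_nat n).
    (* The index [f *+ n] itself may be outside the column. It differs from the column point [u] of
       height [n] by a vector of height 0, which preserves [E0]. *)
    exists u => //; exists (up (f *+ n - u) (y - up f z)).
      by apply: evanescent_wandering_up; rewrite // heightB heightMn height_f// hu natz subrr.
    by rewrite -upD ?subrKC//; exact: GH.
  by apply: evanescent_wandering_orth; rewrite // height_f.
apply: nodet => v.
(* With more than [height v] divisions, the index [- v + f *+ n] has non-negative height, so that
   [x] is in [up v] of [G]. *)
have [y Hy ->] := step `|height v|.+1.
have Gy := evanescent_sub Hy.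
exists (up (- v + f *+ `|height v|.+1) y); last first.
  by rewrite -upD; [rewrite addrA subrr add0r|exact: GH].
apply/evanescent_sub/evanescent_up => //.
rewrite heightD heightN heightMn height_f// natz; lia.
Qed.

(** As 0 is not in the cone, the first generator of [G] is [up e x0]. Generators of positive height
    are orthogonal to [E0], and those of height 0 are translates of [up e x0] by multiples of [e]; a
    vector of [E0] orthogonal to the orbit of [w] is orthogonal to all generators. *)
Lemma evanescent_cyclic : exists w, E0 w /\ clspan [set up (e *+ n) w | n in [set: nat]] = E0.
Proof.
have cE0 := evanescent_wandering_subspace.
have Gx1 : G (up e x0) by apply: sub_clspan; exists e => //; exact: upper_half_e.
have [Ew Hw] := projP cE (up e x0) cE0.
have en0 n : height (e *+ n) = 0 by rewrite heightMn height_e mul0rn.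
exists (proj E0 (up e x0)); split=> //.
apply: (closed_subspace_eq cE cE0 (clspan_subspace _)).
  by apply: clspan_min => // _ [n _ <-]; exact: evanescent_wandering_up.
move=> x Ex xo; have Gx := evanescent_sub (evanescent_wandering_sub Ex).
apply: (clspan_orth Gx) => _ [u Tu <-].
have Hw0 z : E0 z -> inner z (up e x0) = inner z (proj E0 (up e x0)).
  move=> Ez; apply/eqP; rewrite -subr_eq0 -innerBr.
  exact/eqP/inner_eq0C/Hw.
have [hu|hu] : 0 < height u \/ height u = 0 by case: Tu => [|[]]; [left|right].
  rewrite -[u](subrK e) upD//; apply/inner_eq0C/evanescent_wandering_orth => //.
  by rewrite heightB height_e subr0.
have [n un] := upper_half_height0 b0 pq Tu hu.
rewrite un mulrSr upD//; apply: inner_eq0C; rewrite up_adj; [|exact: upH|exact: GH].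
apply: inner_eq0C; rewrite Hw0; last first.
  by apply: evanescent_wandering_up => //; rewrite heightN en0 oppr0.
rewrite up_adj ?opprK; [|exact: GH|exact/GH/evanescent_sub/evanescent_wandering_sub].
by apply: xo; apply: sub_clspan; exists n.
Qed.

(** By minimality of [e], each generator of [G] is [up e x0] or a translate of it by an element of
    the cone, hence orthogonal to [K]. A vector of [K] orthogonal to the projection [w] of [up e x0]
    is thus 0. *)
Lemma wandering_line : exists w, K w /\ forall x, K x -> exists c : R[i], x = c *: w.
Proof.
have cK := wandering_subspace.
have Gx1 : G (up e x0) by apply: sub_clspan; exists e => //; exact: upper_half_e.
have [Kw Hw] := projP cE (up e x0) cK; set w := proj K _ in Kw Hw.
have w_cyclic x : K x -> inner x w = 0 -> x = 0.
  move=> Kx xw; have [Gx _] := Kx; apply: (clspan_orth Gx) => _ [u Tu <-].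
  have [->|Tue] := upper_half_case b0 pq Tu.
    apply: inner_eq0C; rewrite -(subrK w (up e x0)) innerDl Hw// add0r.
    exact: inner_eq0C.
  by rewrite -[u](subrK e) upD//; apply/inner_eq0C/wandering_orth.
exists w; split=> // x Kx.
(* [w] may vanish; then [K] is zero and the coefficient is arbitrary. *)
have [ww|ww] := eqVneq (inner w w) 0.
  exists 0; rewrite scale0r; apply: w_cyclic => //.
  by rewrite (inner_self_eq0 ww) inner0r.
exists (inner x w / inner w w); apply/eqP; rewrite -subr_eq0; apply/eqP/w_cyclic.
  by apply: (subspaceB cK.1) => //; exact: (subspaceZ _ cK.1).
by rewrite innerBl innerZl divfK// subrr.
Qed.

Lemma inner_upN u x y : H x -> H y -> inner (up (- u) x) y = inner x (up u y).
Proof. by move=> Hx Hy; rewrite up_adj// opprK. Qed.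

(** Since [up u] maps [G] into itself, [up (- u)] preserves the orthogonal complement of [G].
    Compressions of such inverses can therefore be composed. *)
Lemma proj_up_proj u x : T0 u -> H x -> proj G (up (- u) (proj G x)) = proj G (up (- u) x).
Proof.
move=> Tu Hx; have Gp : G (proj G x) by exact: projG_in.
apply/eqP; rewrite -subr_eq0 -(projB cE _ _ cG); apply/eqP/projG_eq0 => y Gy.
rewrite innerBl !inner_upN//; try exact: GH.
by rewrite -innerBl -(projG_inner _ (up_half Tu Gy)) (projB cE)// (proj_id cE cG)// subrr inner0l.
Qed.

Lemma half_space_reducing : reducing G.
Proof. by split=> // u x _; exact: projG_in. Qed.

(** * The pair of isometries, its adjoints and its powers *)

Variables V1 V2 : E -> E.
Hypothesis V1E : forall x, H x -> V1 x = up (1, 0) x.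
Hypothesis V2E : forall x, H x -> V2 x = up (0, 1) x.

Let posT0 (m n : nat) : T0 (m%:Z, n%:Z).
Proof.
case: m => [|m].
  case: n => [|n]; [by right|left; left].
  by change (0 < a * 0 + b * n.+1%:Z); rewrite mulr0 add0r pmulr_rgt0.
left; have [h0|h0] := eqVneq (a * m.+1%:Z + b * n%:Z) 0; first by right.
by left; rewrite lt0r h0/= addr_ge0// mulr_ge0// ltW.
Qed.

Lemma iter_up (V : E -> E) u : (forall x, H x -> V x = up u x) ->
  forall n x, H x -> iter n V x = up (u *+ n) x.
Proof.
move=> VE; elim=> [|n IH] x Hx; first by rewrite mulr0n up0.
by rewrite iterS IH// VE ?mulrS ?upD//; exact: upH.
Qed.

Lemma pairMn (i j : int) n : (i, j) *+ n = (i *+ n, j *+ n).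
Proof. by elim: n => [|n IH]; rewrite ?mulr0n// !mulrS IH. Qed.

Lemma iter_V1 n x : H x -> iter n V1 x = up (n%:Z, 0) x.
Proof. by move=> Hx; rewrite (iter_up V1E)// pairMn mul0rn natz. Qed.

Lemma iter_V2 n x : H x -> iter n V2 x = up (0, n%:Z) x.
Proof. by move=> Hx; rewrite (iter_up V2E)// pairMn mul0rn natz. Qed.

(** The right-hand side does not depend on [M]: adjoints inside a reducing subspace are restrictions
    of the adjoint on [G]. *)
Lemma adjoint_up M (V : E -> E) u y : reducing M -> (forall x, H x -> V x = up u x) ->
  M y -> adjoint M V y = proj G (up (- u) y).
Proof.
move=> [cM MG rM] VE My; apply: (adjoint_uniq cM.1); first exact: rM.
move=> x Mx; have Gx := MG _ Mx; rewrite VE; last exact: GH.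
rewrite up_adj; [|exact: GH|exact/GH/MG].
by rewrite [RHS]innerC projG_inner// -innerC.
Qed.

Lemma iter_adjoint M (V : E -> E) u n y : reducing M -> (forall x, H x -> V x = up u x) ->
  T0 u -> M y -> iter n (adjoint M V) y = proj G (up (- (u *+ n)) y).
Proof.
move=> rM VE Tu My; have [cM MG cl] := rM; elim: n => [|n IH].
  by rewrite mulr0n oppr0 up0 ?(proj_id cE cG)//; [exact: MG|exact/GH/MG].
rewrite iterS IH (adjoint_up rM VE); last exact: cl.
rewrite proj_up_proj//; last exact/upH/GH/MG.
by rewrite -upD ?mulrS ?opprD//; exact/GH/MG.
Qed.

Lemma up_pair i j x : H x -> up (i, 0) (up (0, j) x) = up (i, j) x.
Proof.
move=> Hx; rewrite -upD//; congr (up _ _).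
by transitivity (i + 0, 0 + j); last rewrite addr0 add0r.
Qed.

Lemma up_pairC i j x : H x -> up (0, j) (up (i, 0) x) = up (i, j) x.
Proof. by move=> Hx; rewrite -upD// addrC upD// up_pair. Qed.

Lemma vpowE M u x : reducing M -> M x -> vpow M V1 V2 u x = proj G (up u x).
Proof.
move=> rM Mx; have [cM MG cl] := rM; have Hx := GH (MG _ Mx).
have T1 : T0 (1, 0) by exact: (posT0 1 0).
have T2 : T0 (0, 1) by exact: (posT0 0 1).
have M2 n : M (up (0, n%:Z) x) by apply: reducing_up rM _ Mx; exact: posT0.
have M1 n : M (up (n%:Z, 0) x) by apply: reducing_up rM _ Mx; exact: posT0.
have N1 m : - ((1, 0) *+ m : int * int) = (- m%:Z, 0).
  by rewrite pairMn mul0rn; congr pair; rewrite /= ?oppr0// natz.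
have N2 m : - ((0, 1) *+ m : int * int) = (0, - m%:Z).
  by rewrite pairMn mul0rn; congr pair; rewrite /= ?oppr0// natz.
case: u => [[m|m] [n|n]] /=.
- rewrite iter_V2// iter_V1; last exact: upH.
  rewrite up_pair// (proj_id cE cG)//; apply: up_half; first exact: posT0.
  exact: MG.
- rewrite iter_V1// -iterS (iter_adjoint _ rM V2E)//.
  by rewrite N2 up_pairC// NegzE.
- rewrite iter_V2// -iterS (iter_adjoint _ rM V1E)//.
  by rewrite N1 up_pair// NegzE.
- rewrite -!iterS (iter_adjoint _ rM V2E)// (iter_adjoint _ rM V1E)//; last exact: cl.
  rewrite proj_up_proj ?N1 ?N2; last exact: upH.
    by rewrite up_pair// !NegzE.
  by rewrite pairMn mul0rn natz; exact: (posT0 m.+1 0).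
Qed.

Lemma vpow_up M u x : reducing M -> T0 u -> M x -> vpow M V1 V2 u x = up u x.
Proof.
move=> rM Tu Mx; rewrite vpowE// (proj_id cE cG)//; apply: up_half => //.
by have [_ MG _] := rM; exact: MG.
Qed.

Lemma reducing_isometry M u : reducing M -> T0 u -> isometry_on M (up u).
Proof.
move=> rM Tu; have [_ MG _] := rM; have [_ lu nu] := up_iso u; split.
- by move=> x; exact: reducing_up.
- by move=> c x y /MG/GH Hx /MG/GH Hy; exact: lu.
- by move=> x /MG/GH; exact: nu.
Qed.

Lemma eq_isometry M (V W : E -> E) : linear_subspace M -> (forall x, M x -> V x = W x) ->
  isometry_on M W -> isometry_on M V.
Proof.
move=> lM VW [MW lW nW]; split.
- by move=> x Mx; rewrite VW//; exact: MW.
- by move=> c x y Mx My; rewrite !VW//; [exact: lW|apply: lM.2].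
- by move=> x Mx; rewrite VW//; exact: nW.
Qed.

Lemma reducing_isometric_pair M : reducing M -> isometric_pair T M V1 V2.
Proof.
move=> rM; have [cM MG _] := rM; split.
- exact: upper_half_semigroup.
- apply: (eq_isometry cM.1 (W := up (1, 0))).
    by move=> x /MG/GH; exact: V1E.
  by apply: reducing_isometry => //; exact: (posT0 1 0).
- apply: (eq_isometry cM.1 (W := up (0, 1))).
    by move=> x /MG/GH; exact: V2E.
  by apply: reducing_isometry => //; exact: (posT0 0 1).
- move=> x /MG/GH Hx; rewrite V2E// V1E; last exact: upH.
  by rewrite V1E// V2E; [rewrite -!upD|exact: upH].
- move=> u Tu; apply: (eq_isometry cM.1 (W := up u)).
    by move=> x; apply: vpow_up => //; left.
  by apply: reducing_isometry => //; left.
Qed.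

(** By [vpowE] each compression of [up u] is a word in [V1], [V2] and their adjoints, so invariance
    under these four operators gives invariance under all compressions. *)
Lemma reducing_reduces N M : reducing N -> M `<=` N -> reducing M <-> reduces N V1 V2 M.
Proof.
move=> rN MN; have [cN NG clN] := rN; split=> [rM|[cM _ MV MVa]].
  have [cM MG clM] := rM; split=> //.
    by move=> x Mx; rewrite V1E ?V2E; try exact/GH/MG;
      split; apply: reducing_up => //; [exact: (posT0 1 0)|exact: (posT0 0 1)].
  move=> x Mx; rewrite (adjoint_up rN V1E (MN _ Mx)) (adjoint_up rN V2E (MN _ Mx)).
  by split; exact: clM.
split=> // [|u x Mx]; first exact: subset_trans MN NG.
have iM (V : E -> E) n y : (forall z, M z -> M (V z)) -> M y -> M (iter n V y).
  by move=> VM My; elim: n => //= n; exact: VM.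
have M1 y := fun My : M y => (MV y My).1.
have M2 y := fun My : M y => (MV y My).2.
have M1a y := fun My : M y => (MVa y My).1.
have M2a y := fun My : M y => (MVa y My).2.
rewrite -(vpowE u rN (MN _ Mx)).
by case: u => [[m|m] [n|n]]; rewrite /vpow; do 2 (apply: (iM) => //).
Qed.

Lemma regular_totally_non_unitary : totally_non_unitary T Ht V1 V2.
Proof.
split; first exact: reducing_isometric_pair regular_reducing.
move=> M /[dup] rHM [_ MHt _ _] [_ qM].
have rM : reducing M by apply/(reducing_reduces regular_reducing MHt).
have [cM MG clM] := rM.
have MK : M `<=` orth K.
  rewrite -qM; have [_ clK] := orth_subspace K; rewrite (closure_id (orth K)).1//.
  apply: closure_subset => _ [kl [mn [x [Tkl Tmn Td Mx ->]]]] k Kk.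
  (* The adjoint inside [M] cancels [kl]: as [mn - kl] is in the cone, [up (mn - kl) x] remains in
     [M] and no projection intervenes. *)
  have Mu : M (up (mn - kl) x) by apply: reducing_up rM _ Mx; left.
  rewrite (adjoint_uniq (z := up (mn - kl) x) cM.1 Mu).
    by apply: wandering_orth => //; exact: MG.
  move=> y My; rewrite !vpow_up//; try by left.
  rewrite up_adj; [|exact/GH/MG|exact/upH/GH/MG].
  by rewrite -upD ?[- kl + mn]addrC//; exact/GH/MG.
apply/seteqP; split=> [x Mx|_ ->]; last exact: subspace0 cM.1.
apply: (clspan_orth (MHt _ Mx)) => _ [v Tv [k Kk <-]].
have [Gk _] := Kk; apply: inner_eq0C.
rewrite up_adj; [|exact: GH|exact/GH/MG].
by apply: inner_eq0C; rewrite -projG_inner//; apply: MK => //; exact: clM.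
Qed.

Lemma imset_up_subspace u M : closed_subspace M -> M `<=` H -> closed_subspace (up u @` M).
Proof.
move=> cM MH; have -> : up u @` M = [set x | H x /\ M (up (- u) x)].
  apply/seteqP; split=> [_ [x Mx <-]|x [Hx Mx]].
    by split; [exact/upH/MH|rewrite upNK//; exact: MH].
  by exists (up (- u) x) => //; rewrite upK.
exact: preimage_up.
Qed.

Lemma imset_clspan u (A : set E) : A `<=` H -> up u @` clspan A = clspan (up u @` A).
Proof.
move=> AH; have cAH : clspan A `<=` H by exact: clspan_min.
apply/seteqP; split=> [_ [x Ax <-]|].
  suff : clspan A `<=` [set x | H x /\ clspan (up u @` A) (up u x)] by move=> /(_ _ Ax)[].
  apply: clspan_min; first exact/preimage_up/clspan_subspace.
  by move=> y Ay; split; [exact: AH|apply: sub_clspan; exists y].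
apply: clspan_min; first by apply: imset_up_subspace => //; exact: clspan_subspace.
by move=> _ [y Ay <-]; exists y => //; exact: sub_clspan.
Qed.

Lemma proj_imset_up u M x : closed_subspace M -> M `<=` H -> H x ->
  proj (up u @` M) x = up u (proj M (up (- u) x)).
Proof.
move=> cM MH Hx; have [Mp Hp] := projP cE (up (- u) x) cM.
apply: (proj_uniq cE); first exact: imset_up_subspace.
  by exists (proj M (up (- u) x)).
move=> _ [y My <-]; have Hy := MH _ My; rewrite innerBl.
rewrite (isometry_inner (up_iso u) cH.1)//; last exact: MH.
by rewrite -inner_upN// -innerBl Hp.
Qed.

Lemma regular_bigsum :
  orthogonal_bigsum T0 (fun u => vpow G V1 V2 u @` K) Ht.
Proof.
have KH : K `<=` H by move=> x [/GH].
have EK u : T0 u -> vpow G V1 V2 u @` K = up u @` K.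
  by move=> Tu; apply: eq_imagel => x [Gx _]; apply: vpow_up => //; exact: half_space_reducing.
split.
- by move=> u Tu; rewrite EK//; apply: imset_up_subspace => //; exact: wandering_subspace.
- move=> u v Tu Tv uv x y; rewrite !EK// => -[x' Kx <-] [y' Ky <-].
  exact: wandering_orthogonal.
- by rewrite /regular_part; congr clspan; apply: eq_bigcupr => u Tu; rewrite EK.
Qed.

(** The diagram is the half-plane of non-negative height, not the cone. It is invariant under
    multiples of [e], and division of the first coordinate by [b] tiles it by columns. *)
Lemma column_periodic : exists J, periodic_diagram J b a J0.
Proof.
exists [set u | 0 <= height u]; split.
- move=> i j m n /= hu m0 n0; change (0 <= a * (i + m) + b * (j + n)).
  have -> : a * (i + m) + b * (j + n) = (a * i + b * j) + (a * m + b * n) by ring.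
  by rewrite addr_ge0// addr_ge0// mulr_ge0// ltW.
- by rewrite -gtz0_ge1.
- exact: a0.
- by apply/seteqP; split=> u [].
have hk (kappa : int) u : height ((kappa * b, - (kappa * a)) + u) = height u.
  by rewrite heightD height_eM add0r.
split.
  apply/trivIsetP => i j _ _ ij; apply/seteqP; split=> // _ [[u [/andP[u0 ub] _] <-]].
  move=> [v [/andP[v0 vb] _] /(congr1 fst)/=] uv; case/eqP: ij.
  have : b * (i - j) = v.1 - u.1.
    have : j * b + v.1 = i * b + u.1 := uv.
    by lra.
  move=> ij; have : -1 < i - j by rewrite -(ltr_pM2l b0) ij mulrN1; lra.
  have : i - j < 1 by rewrite -(ltr_pM2l b0) ij mulr1; lra.
  by clear; lia.
apply/seteqP; split=> [u hu|_ [kappa _ [u [_ hu] <-]]]; last by rewrite /= hk.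
exists (u.1 %/ b)%Z => //; exists (u - ((u.1 %/ b)%Z * b, - ((u.1 %/ b)%Z * a))); last first.
  by rewrite addrC subrK.
have := divz_eq u.1 b; set s := divz _ _ => H1; split; last first.
  by rewrite heightB height_eM subr0.
change (0 <= u.1 - s * b < b).
have -> : u.1 - s * b = (u.1 %% b)%Z by rewrite {1}H1; ring.
by rewrite modz_ge0 ?gt_eqF// ltz_pmod.
Qed.

(** * Generalized powers on the evanescent part *)

Section powers.
Variable U : E -> E.
Hypothesis UE : forall x, He x -> U x = up e x.

Let HeH x : He x -> H x. Proof. by move=> /evanescent_sub/GH. Qed.
Let E0He x : E0 x -> He x. Proof. exact: evanescent_wandering_sub. Qed.
Let E0H : E0 `<=` H. Proof. by move=> x /E0He/HeH. Qed.
Let cE0 := evanescent_wandering_subspace.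
Let E0up u x : height u = 0 -> E0 x -> E0 (up u x).
Proof. exact: evanescent_wandering_up. Qed.

Lemma evanescent_wandering_unitary : unitary_on E0 U.
Proof.
have he := height_e a b.
split.
  apply: (eq_isometry cE0.1 (W := up e)) => [x /E0He/UE//|].
  have [_ lu nu] := up_iso e; split.
  - by move=> x; exact: E0up.
  - by move=> c x y /E0H Hx /E0H Hy; exact: lu.
  - by move=> x /E0H; exact: nu.
apply/seteqP; split=> [_ [x Ex <-]|x Ex].
  by rewrite UE; [exact: E0up|exact: E0He].
have Ex' : E0 (up (- e) x) by apply: E0up => //; rewrite heightN he oppr0.
by exists (up (- e) x) => //; rewrite UE ?upK//; [exact: E0H|exact: E0He].
Qed.

Lemma iter_U n x : He x -> iter n U x = up (e *+ n) x.
Proof.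
move=> Hx; elim: n => [|n IH]; first by rewrite mulr0n up0//; exact: HeH.
rewrite iterS IH UE ?mulrS ?upD//; first exact: HeH.
by apply: evanescent_up => //; rewrite heightMn height_e mul0rn.
Qed.

Lemma cyclic_vectorE w : cyclic_vector E0 U w <->
  E0 w /\ clspan [set up (e *+ n) w | n in [set: nat]] = E0.
Proof.
rewrite /cyclic_vector; split=> -[Ew]; have Hw := E0He Ew.
  rewrite (_ : [set iter _ _ _ | _ in _] = [set up (e *+ n) w | n in [set: nat]])//.
  by apply: eq_imagel => n _; exact: iter_U.
rewrite (_ : [set iter _ _ _ | _ in _] = [set up (e *+ n) w | n in [set: nat]])//.
by apply: eq_imagel => n _; exact: iter_U.
Qed.

Lemma evanescent_bigsum w : cyclic_vector E0 U w ->
  orthogonal_bigsum J0 (fun u => clspan [set iter n U (vpow G V1 V2 u w) | n in [set: nat]]) He.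
Proof.
move=> /cyclic_vectorE[Ew Hw].
have EJ u : J0 u -> clspan [set iter n U (vpow G V1 V2 u w) | n in [set: nat]] = up u @` E0.
  move=> [_ hu]; have Hu : He (up u w) by exact: evanescent_up (E0He Ew).
  rewrite vpowE; [|exact: half_space_reducing|exact/evanescent_sub/E0He].
  rewrite (proj_id cE cG); last exact: evanescent_sub.
  rewrite -Hw imset_clspan; last first.
    by move=> _ [n _ <-]; exact/upH/E0H.
  congr clspan; rewrite image_comp; apply: eq_imagel => n _ /=.
  by rewrite iter_U// -!upD 1?addrC//; exact: E0H.
split.
- by move=> u _; exact: clspan_subspace.
- move=> u v Ju Jv uv x y; rewrite !EJ// => -[x' Ex <-] [y' Ey <-].
  apply: evanescent_levels => // huv; apply: uv.
  exact: (column_inj b0 pq).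
- by rewrite -evanescent_span; congr clspan; apply: eq_bigcupr => u Ju; rewrite EJ.
Qed.

Lemma proj_evanescent_up u x : height u = 0 -> H x -> proj E0 (up u x) = up u (proj E0 x).
Proof.
move=> hu Hx; have [Ep Hp] := projP cE x cE0.
apply: (proj_uniq cE cE0); first exact: E0up.
move=> z Ez; rewrite innerBl !up_adj//; try exact: E0H.
by rewrite -innerBl Hp//; apply: E0up; rewrite // heightN hu oppr0.
Qed.

Lemma proj_evanescent_low u x : height u < 0 -> He x -> proj E0 (up (- u) x) = 0.
Proof.
move=> hu Hx; apply: (proj_orth cE cE0) => z Ez.
by apply: evanescent_wandering_orth; rewrite ?heightN ?oppr_gt0//; exact: evanescent_sub.
Qed.

Lemma evanescent_powers : generalized_powers He V1 V2 b a J0 E0 U.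
Proof.
split; [exact: column_periodic|exact: hilbert_subspaceP|exact: evanescent_wandering_unitary|].
have sq0 : @family_sqnorm R E (fun=> 0) = 0%E.
  by apply: esum1 => u _; rewrite rnorm0 expr0n.
have cM u : J0 u -> closed_subspace (up u @` E0) by move=> _; exact: imset_up_subspace.
have oM u v : J0 u -> J0 v -> u <> v ->
    forall x y, (up u @` E0) x -> (up v @` E0) y -> inner x y = 0.
  move=> Ju Jv uv _ _ [x Ex <-] [y Ey <-]; apply: evanescent_levels => // huv.
  by apply: uv; exact: (column_inj b0 pq).
(* The component of [x] in the level [up u] of [E0], brought back to [E0]. *)
pose W x u := if u \in J0 then proj E0 (up (- u) x) else 0.
have sqW (c : int * int -> E) : (forall u, ~ J0 u -> c u = 0) ->
    family_sqnorm c = (\esum_(u in J0) (rnorm (c u) ^+ 2)%:E)%E.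
  move=> c0; rewrite /family_sqnorm [RHS]esum_mkcond; apply: eq_esum => u _.
  by case: ifPn => // /negP uJ; rewrite c0 ?rnorm0 ?expr0n// => Ju; apply: uJ; exact: mem_set.
have WJ x u : ~ J0 u -> W x u = 0.
  by rewrite /W => Ju; case: ifP => // /set_mem.
have projM x u : He x -> proj (up u @` E0) x = up u (proj E0 (up (- u) x)).
  by move=> Hx; apply: proj_imset_up => //; exact: HeH.
have WE x u : 0 <= u.1 < b -> He x -> W x u = proj E0 (up (- u) x).
  move=> ub Hx; rewrite /W; case: ifPn => // /negP uJ.
  rewrite proj_evanescent_low// ltNge; apply/negP => hu.
  by apply: uJ; apply: mem_set; split.
have WS x u v : J0 u -> H x -> W (up v x) u = proj E0 (up (- (u - v)) x).
  by move=> Ju Hx; rewrite /W mem_set// -upD// opprB addrC.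
have W0 x u : E0 (W x u).
  rewrite /W; case: ifPn => _; last exact: subspace0 cE0.1.
  by have [] := projP cE (up (- u) x) cE0.
exists W; split.
- move=> x Hx; split; last first.
    rewrite sqW; last exact: WJ.
    rewrite -(parseval cE cM oM); last by rewrite evanescent_span.
    apply: eq_esum => u Ju; rewrite projM// (isometry_rnorm (up_iso u)) /W ?mem_set//.
    by apply: E0H; have [] := projP cE (up (- u) x) cE0.
  split=> [u _|u|]; [exact: W0|exact: WJ|].
  rewrite sqW; last exact: WJ.
  rewrite (_ : esum _ _ = (rnorm x ^+ 2)%:E) ?ltry//.
  rewrite -(parseval cE cM oM); last by rewrite evanescent_span.
  apply: eq_esum => u Ju; rewrite projM// (isometry_rnorm (up_iso u)) /W ?mem_set//.
  by apply: E0H; have [] := projP cE (up (- u) x) cE0.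
- move=> c x y Hx Hy; rewrite (_ : _ - _ = fun=> 0)//; apply/funext => u.
  rewrite !fctE /W; case: ifPn => _; last by rewrite scaler0 addr0 subrr.
  have [_ lu _] := up_iso (- u).
  by rewrite lu; [rewrite (proj_linear cE)// subrr|exact: HeH|exact: HeH].
- move=> g [gE g0 gfin].
  have [x [Gx Hx]] : exists x, clspan (\bigcup_(u in J0) (up u @` E0)) x /\
      forall u, J0 u -> proj (up u @` E0) x = up u (g u).
    apply: (synthesis cE cM oM) => [u Ju|]; first by exists (g u) => //; exact: gE.
    rewrite (_ : esum _ _ = family_sqnorm g)// sqW//; apply: eq_esum => u Ju.
    by rewrite (isometry_rnorm (up_iso u))//; apply: E0H; exact: gE.
  rewrite evanescent_span in Gx; exists x => //.
  rewrite (_ : _ - _ = fun=> 0)//; apply/funext => u; rewrite !fctE.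
  have [Ju|Ju] := pselect (J0 u); last by rewrite WJ// g0// subr0.
  have := Hx _ Ju; rewrite projM// => /(congr1 (up (- u))); rewrite !upNK.
  + by rewrite /W mem_set// => ->; rewrite subrr.
  + by apply: E0H; exact: gE.
  + by apply: E0H; have [] := projP cE (up (- u) x) cE0.
- move=> x Hx; have HHx := HeH Hx.
  rewrite V1E// V2E//; split; rewrite (_ : _ - _ = fun=> 0)//; apply/funext => u;
      rewrite !fctE /power1 /power2; case: ifPn => [/set_mem Ju|/negP uJ];
      try by rewrite WJ ?subrr// => /mem_set.
    rewrite WS//; case: eqP => [u0|/eqP u0].
      (* For [u.1 = 0] the index [u - (1, 0)] leaves the strip on the left. Adding [e] brings it
         back to first coordinate [b - 1], and [U], which is [up e] on [He], compensates. *)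
      have ub : 0 <= (b - 1, u.2 - a).1 < b by rewrite /= subr_ge0 -gtz0_ge1 b0 gtrBl.
      rewrite UE; last exact/E0He/W0.
      rewrite WE// -proj_evanescent_up ?height_e//; last exact: upH.
      rewrite -upD// (_ : e - _ = - (u - (1, 0))) ?subrr//.
      rewrite opprB; transitivity (b - (b - 1), - a - (u.2 - a)); first by [].
      by rewrite !opprB; transitivity (1 - u.1, 0 - u.2); first (congr pair; rewrite ?u0; lra).
    have ub : 0 <= (u.1 - 1, u.2).1 < b.
      by have [/andP[u1 u2] _] := Ju;
        rewrite /= subr_ge0 -gtz0_ge1 lt0r u0 u1 /= ltrBlDr ltr_wpDr.
    rewrite WE// (_ : (u.1 - 1, u.2) = u - (1, 0)) ?subrr//.
    by transitivity (u.1 - 1, u.2 - 0); first rewrite subr0.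
  rewrite WS//; have ub : 0 <= (u.1, u.2 - 1).1 < b by have [] := Ju.
  rewrite WE// (_ : (u.1, u.2 - 1) = u - (0, 1)) ?subrr//.
  by transitivity (u.1 - 0, u.2 - 1); first rewrite subr0.
Qed.

End powers.

Lemma evanescent_cyclic_powers : cyclic_generalized_powers He V1 V2.
Proof.
exists b, a, (column a b), E, E0, (up e); split; first exact: evanescent_powers.
have [w [Ew Hw]] := evanescent_cyclic; exists w.
by apply/(cyclic_vectorE (U := up e)).
Qed.

Lemma iter_adjoint_V1V2 m n x : G x ->
  iter m (adjoint G V1) (iter n V2 x) = proj G (up (- m%:Z, n%:Z) x).
Proof.
move=> Gx; rewrite iter_V2; last exact: GH.
rewrite (iter_adjoint _ half_space_reducing V1E (posT0 1 0)); last by apply: up_half => //;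
  exact: (posT0 0 n).
rewrite -[in RHS]up_pair ?pairMn ?mul0rn ?natz; last exact: GH.
by congr (proj G (up _ _)); congr pair; exact: oppr0.
Qed.

Lemma iter_adjoint_V2V1 m n x : G x ->
  iter m (adjoint G V2) (iter n V1 x) = proj G (up (n%:Z, - m%:Z) x).
Proof.
move=> Gx; rewrite iter_V1; last exact: GH.
rewrite (iter_adjoint _ half_space_reducing V2E (posT0 0 1)); last by apply: up_half => //;
  exact: (posT0 n 0).
rewrite -[in RHS]up_pairC ?pairMn ?mul0rn ?natz; last exact: GH.
by congr (proj G (up _ _)); congr pair; exact: oppr0.
Qed.

Lemma upper_half0_diagram : diagram T0.
Proof.
move=> i j m n Tij m0 n0; have Tmn : T0 (m, n).
  by case: m m0 => // m _; case: n n0 => // n _; exact: posT0.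
have -> : (i + m, j + n) = (i, j) + (m, n) :> (int * int)%type by [].
case: Tij Tmn => [Tij|->] [Tmn|->]; rewrite ?addr0 ?add0r; [|by left..|by right].
by left; exact: upper_halfD.
Qed.

Lemma regular_diagram : given_by_diagram Ht V1 V2 T0.
Proof.
have V10 : V1 0 = 0.
  by rewrite V1E; [exact: isometry0 (up_iso _) cH.1|exact: subspace0 cH.1].
have V20 : V2 0 = 0.
  by rewrite V2E; [exact: isometry0 (up_iso _) cH.1|exact: subspace0 cH.1].
have [k [Kk lineK]] := wandering_line.
(* Without a unit vector in [K] the regular part is zero and the zero model is used. *)
have [k0|k0] := eqVneq k 0.
  have -> : Ht = [set 0].
    apply/seteqP; split=> [|_ ->]; last exact: subspace0 regular_subspace.1.
    apply: clspan_min; first exact: set0_subspace.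
    move=> _ [v _ [x Kx <-]] /=; have [c ->] := lineK x Kx.
    by rewrite k0 scaler0 (isometry0 (up_iso _) cH.1).
  exact: zero_diagram_model upper_half0_diagram V10 V20.
have nk0 : rnorm k != 0 by rewrite rnorm_eq0.
pose w := ((rnorm k)^-1)%:C%C *: k.
have cK := wandering_subspace.
have Kw : K w by exact: subspaceZ cK.1 Kk.
have Gw : G w by case: Kw.
have w1 : rnorm w = 1.
  rewrite rnormZ /rnorm ger0_norm /=; first by rewrite -/(rnorm k) mulVf.
  by rewrite lecR invr_ge0 rnorm_ge0.
have lineKw x : K x -> exists c, x = c *: w.
  move=> /lineK[c ->]; exists (c * (rnorm k)%:C%C); rewrite /w scalerA -mulrA -rmorphM /=.
  by rewrite divff// mulr1.
have HtE : Ht = clspan ((fun u => up u w) @` T0).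
  apply/seteqP; split; apply: clspan_min; try exact: clspan_subspace.
    move=> _ [v Tv [x Kx <-]]; have [c ->] := lineKw x Kx.
    have [_ lu _] := up_iso v; have H0 : H 0 := subspace0 cH.1.
    have -> : up v (c *: w) = c *: up v w.
      by have := lu c w 0 (GH Gw) H0; rewrite !addr0 (isometry0 (up_iso v) cH.1) addr0.
    by apply: (subspaceZ _ (clspan_subspace _).1); apply: sub_clspan; exists v.
  by move=> _ [v Tv <-]; apply: sub_clspan; exists v => //; exists w.
have shift (V : E -> E) v x u : (forall x, H x -> V x = up v x) -> Ht x -> T0 u ->
    inner (V x) (up u w) = coefficient T0 (fun u => up u w) x (u - v).
  move=> VE Hx Tu; have Gx := regular_sub Hx.
  rewrite VE; last exact: GH.
  rewrite up_adj; [|exact: GH|exact/upH/GH].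
  rewrite -upD; last exact: GH.
  rewrite [- v + u]addrC /coefficient; case: ifPn => // /negP nT.
  have Tvu : T (v - u).
    have [Tuv|uv|] := upper_half_total b0 pq (u - v); last by rewrite opprB.
    - by case: nT; apply: mem_set; left.
    - by case: nT; apply: mem_set; right.
  by rewrite -opprB -up_adj; [exact: wandering_orth|exact: GH|exact: GH].
rewrite HtE; apply: (diagram_model cE (b := fun u => up u w) upper_half0_diagram _ _ w1).
- by move=> u _; rewrite (isometry_rnorm (up_iso u))//; exact: GH.
- by move=> u v _ _ uv; exact: wandering_orthogonal.
- rewrite -HtE => x Hx; rewrite V1E; last exact/GH/regular_sub.
  by apply: reducing_up regular_reducing _ Hx; exact: (posT0 1 0).
- rewrite -HtE => x Hx; rewrite V2E; last exact/GH/regular_sub.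
  by apply: reducing_up regular_reducing _ Hx; exact: (posT0 0 1).
- by rewrite -HtE => x u; exact: shift.
- by rewrite -HtE => x u; exact: shift.
Qed.

End wold.

(** * The action of the shifts *)

Section integer_powers.
Context (R : realType) (E : innerType R).
Variables (H : set E) (U : E -> E).
Hypotheses (cH : closed_subspace H) (U_unitary : unitary_on H U).

(** On [H] the adjoint of [U] is its inverse; as a function on all of [E], [U] need not be
    invertible. *)
Definition zpow (i : int) x : E :=
  match i with
  | Posz n => iter n U x
  | Negz n => iter n.+1 (adjoint H U) x
  end.

Lemma unitaryK x : H x -> adjoint H U (U x) = x.
Proof.
have [iU _] := U_unitary; move=> Hx; apply: (adjoint_uniq cH.1 Hx) => y Hy.
exact: (isometry_inner iU cH.1).
Qed.

Lemma unitaryVK x : H x -> H (adjoint H U x) /\ U (adjoint H U x) = x.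
Proof.
by have [_ UH] := U_unitary; rewrite -{1}UH => -[y Hy <-]; rewrite unitaryK.
Qed.

Lemma zpow_sub i x : H x -> H (zpow i x).
Proof.
have [[UH _ _] _] := U_unitary; move=> Hx; case: i => n; rewrite /zpow.
  by elim: n => //= n; exact: UH.
by elim: n.+1 => //= m /unitaryVK[].
Qed.

Lemma zpowS i x : H x -> zpow (i + 1) x = U (zpow i x).
Proof.
move=> Hx; case: i => [n|[|n]]; first by rewrite -PoszD addn1.
  by have [_ ->] := unitaryVK Hx.
rewrite (_ : Negz n.+1 + 1 = Negz n); last by lia.
by have /unitaryVK[_] := zpow_sub (Negz n) Hx.
Qed.

Lemma zpowB1 i x : H x -> zpow (i - 1) x = adjoint H U (zpow i x).
Proof.
by move=> Hx; rewrite -{2}(subrK 1 i) zpowS// unitaryK//; exact: zpow_sub.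
Qed.

Lemma zpowD i j x : H x -> zpow (i + j) x = zpow i (zpow j x).
Proof.
move=> Hx; have Hj := zpow_sub j Hx; elim: i => [|n IH|n IH]; first by rewrite add0r.
  by rewrite -addn1 PoszD addrAC zpowS// IH zpowS.
rewrite -addn1 PoszD opprD addrAC zpowB1// IH zpowB1//.
Qed.

Lemma zpow_isometry i : isometry_on H (zpow i).
Proof.
have [[UH lU nU] _] := U_unitary.
have aU x : H x -> H (adjoint H U x) by move=> /unitaryVK[].
have [n] : exists n, i = n%:Z \/ i = - n%:Z by case: i => n; [exists n|exists n.+1];
  [left|right; rewrite NegzE].
have S j : isometry_on H (zpow j) -> isometry_on H (zpow (j + 1)).
  move=> [Hj lj nj]; split=> [x Hx|c x y Hx Hy|x Hx].
  - exact: zpow_sub.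
  - by rewrite !zpowS//; [rewrite lj// lU//; exact: zpow_sub|apply: cH.1.2].
  - by rewrite zpowS// nU ?nj//; exact: zpow_sub.
have B j : isometry_on H (zpow j) -> isometry_on H (zpow (j - 1)).
  move=> [Hj lj nj]; split=> [x Hx|c x y Hx Hy|x Hx].
  - exact: zpow_sub.
  - have [Hx' Hy'] := (zpow_sub (j - 1) Hx, zpow_sub (j - 1) Hy).
    rewrite [LHS]zpowB1//; last by apply: cH.1.2.
    rewrite lj// -[j](subrK 1) !zpowS// -lU// unitaryK ?subrK//.
    by apply: cH.1.2.
  - rewrite -[RHS]nj// -{2}[j](subrK 1) zpowS// nU//; exact: zpow_sub.
elim: n i => [|n IH] i.
  move=> i0; have -> : i = 0 by case: i0 => ->; rewrite ?oppr0.
  by split.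
by case=> ->; rewrite -addn1 PoszD ?opprD; [apply: S|apply: B]; apply: IH; [left|right].
Qed.

Lemma zpow_commute (V : E -> E) i x : (forall y, H y -> H (V y)) ->
  commute_on H V U -> H x -> V (zpow i x) = zpow i (V x).
Proof.
move=> VH VU; have aV y : H y -> V (adjoint H U y) = adjoint H U (V y).
  move=> /unitaryVK[Hy Uy]; rewrite -{2}Uy VU// unitaryK//; exact: VH.
move=> Hx; case: i => n; rewrite /zpow.
  elim: n => //= n IH; rewrite VU ?IH//; exact: (zpow_sub n Hx).
elim: n => /= [|n IH]; first exact: aV.
by rewrite aV ?IH//; exact: (zpow_sub (Negz n) Hx).
Qed.

End integer_powers.

(** * Two commuting unitaries as an action of Z^2 *)

Section unitary_action.
Context (R : realType) (E : innerType R).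
Variables (H : set E) (U1 U2 : E -> E).
Hypotheses (cH : closed_subspace H) (U1_unitary : unitary_on H U1)
  (U2_unitary : unitary_on H U2) (U12 : commute_on H U1 U2).

Definition unitary_action (u : int * int) x : E :=
  zpow H U1 u.1 (zpow H U2 u.2 x).
Local Notation up := unitary_action.

Lemma unitary_action_isometry u : isometry_on H (up u).
Proof.
have [H1 l1 n1] := zpow_isometry cH U1_unitary u.1.
have [H2 l2 n2] := zpow_isometry cH U2_unitary u.2.
split=> [x Hx|c x y Hx Hy|x Hx]; rewrite /up.
- exact/H1/H2.
- by rewrite l2// l1//; exact: H2.
- by rewrite n1 ?n2//; exact: H2.
Qed.

Lemma unitary_actionD u v x : H x -> up (u + v) x = up u (up v x).
Proof.
move=> Hx; rewrite /up /=.
have z2 i y : H y -> H (zpow H U2 i y) by exact: zpow_sub.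
have z1 i y : H y -> H (zpow H U1 i y) by exact: zpow_sub.
rewrite !zpowD//; last exact/z2/z2.
congr (zpow H U1 _ _); symmetry; apply: zpow_commute => //; last exact: z2.
- exact: z2.
- move=> y Hy; symmetry; apply: zpow_commute => //.
  by case: U1_unitary => -[].
Qed.

End unitary_action.
(** At [- u] the form of the half-plane is [g] times the height of [u]. Reflection turns the case of
    negative first coordinate, where the value 0 is allowed, into that of positive first
    coordinate. *)
Lemma halfplane_past_upper (k l g a b : int) : 0 < g -> k = - (g * a) -> l = - (g * b) ->
  opp_set (halfplane_past k l) = upper_half a b.
Proof.
move=> g0 -> ->.
have hE i j : (- i) * (- (g * a)) + (- j) * (- (g * b)) = g * height a b (i, j).
  by rewrite /height /=; ring.
have uE i j : opp_set (halfplane_past (- (g * a)) (- (g * b))) (i, j) <->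
    (if - i < 0 then 0 <= height a b (i, j) else 0 < height a b (i, j)).
  by rewrite -(pmulr_rge0 _ g0) -(pmulr_rgt0 _ g0) -hE.
apply/seteqP; split=> -[i j].
  by move/uE; case: ifP; rewrite /upper_half /=; lia.
by move=> Tu; apply/uE; move: Tu; rewrite /upper_half /=; case: ifP; lia.
Qed.

(** * The action on the random field *)

Section field_action.
Context (R : realType) d (Omega : measurableType d) (P : probability Omega R).
Variables (X : int * int -> Omega -> R[i]) (U1 U2 : L2 P -> L2 P).
Local Notation H := (field_space P X).
Local Notation cls v := (L2_class P (X v)).
Hypotheses (U1_unitary : unitary_on H U1) (U2_unitary : unitary_on H U2).
Hypothesis U1X : forall s t : int, U1 (cls (s, t)) = cls (s - 1, t).
Hypothesis U2X : forall s t : int, U2 (cls (s, t)) = cls (s, t - 1).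
Local Notation up := (unitary_action H U1 U2).

Let cH : closed_subspace H.
Proof. exact: clspan_subspace. Qed.

Lemma field_space_class v : H (cls v).
Proof. by apply: sub_clspan; exists v. Qed.

Lemma zpow_class (U : L2 P -> L2 P) (h : int * int) i v : unitary_on H U ->
  (forall u, U (cls u) = cls (u - h)) -> zpow H U i (cls v) = cls (v - h *~ i).
Proof.
move=> uU UX; have adjX u : adjoint H U (cls u) = cls (u + h).
  by rewrite -[in LHS](addrK h u) -UX unitaryK//; exact: field_space_class.
case: i => n; rewrite /zpow.
  elim: n => [|n IH]; first by rewrite mulr0z subr0.
  by rewrite iterS IH UX -addn1 PoszD mulrzDr opprD addrA.
rewrite NegzE mulrNz opprK; elim: n.+1 => [|m IH]; first by rewrite mulr0z addr0.
by rewrite iterS IH adjX -addn1 PoszD mulrzDr addrA.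
Qed.

Lemma unitary_action_class u v : up u (cls v) = cls (v - u).
Proof.
have X1 w : U1 (cls w) = cls (w - (1, 0)).
  by case: w => s t; rewrite U1X; congr (cls _); transitivity (s - 1, t - 0);
    first rewrite subr0.
have X2 w : U2 (cls w) = cls (w - (0, 1)).
  by case: w => s t; rewrite U2X; congr (cls _); transitivity (s - 0, t - 1);
    first rewrite subr0.
have pairMz (i j n : int) : (i, j) *~ n = (i *~ n, j *~ n) :> (int * int)%type.
  by case: n => n; rewrite ?NegzE ?mulrNz -!pmulrn pairMn.
rewrite /unitary_action (zpow_class _ _ U2_unitary X2) (zpow_class _ _ U1_unitary X1).
congr (cls _); rewrite !pairMz !mul0rz !intz -addrA -opprD; congr (v - _).
by case: u => i j; transitivity (0 + i, j + 0); last rewrite add0r addr0.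
Qed.

End field_action.


Theorem theorem21 (R : realType) (d : measure_display)
    (Omega : measurableType d) (P : probability Omega R)
    (X : int * int -> Omega -> R[i]) (k l : int)
    (Sv := halfplane_past k l)
    (Sv1 : Sv (-1, 0)) (Sv2 : Sv (0, -1))
    (X_stationary : weak_stationary P X)
    (X_nodet : no_deterministic_part P X Sv)
    (U1 U2 : L2 P -> L2 P)
    (U1_unitary : unitary_on (field_space P X) U1)
    (U2_unitary : unitary_on (field_space P X) U2)
    (U12 : commute_on (field_space P X) U1 U2)
    (U1X : forall s t : int, U1 (L2_class P (X (s, t))) = L2_class P (X (s - 1, t)))
    (U2X : forall s t : int, U2 (L2_class P (X (s, t))) = L2_class P (X (s, t - 1)))
    (H00 := past_space P X Sv (0, 0))
    (V1 := U1) (V2 := U2)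
    (V1a := adjoint H00 V1) (V2a := adjoint H00 V2) :
  exists Ht He : set (L2 P),
    [/\ orthogonal_sum H00 Ht He,
        reduces H00 V1 V2 Ht /\ reduces H00 V1 V2 He,
        totally_non_unitary (opp_set Sv) Ht V1 V2,
        cyclic_generalized_powers He V1 V2
      & k < 0 -> l < 0 -> coprimez k l ->
        forall p q : int, p * k + q * l = -1 ->
          p <= - l -> 0 < p -> q <= 0 -> k < q ->
        (let J0 := [set ij | opp_set Sv ij /\ 0 <= ij.1 <= - l - 1]
                     `|` [set (0, 0)] in
         let HH := [set x | iter `|p|%N V1a (iter `|q|%N V2 x) = 0] `&` He in
         let U := fun x => iter `|k|%N V2a (iter `|l|%N V1 x) in
         [/\ generalized_powers He V1 V2 (- l) (- k) J0 HH U,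
             exists w, cyclic_vector HH U w
           & forall w, cyclic_vector HH U w ->
               orthogonal_bigsum J0
                 (fun ij => clspan [set iter kappa U (vpow H00 V1 V2 ij w)
                                   | kappa in [set: nat]]) He]) /\
        (let J := opp_set Sv `|` [set (0, 0)] in
         let K := [set x | H00 x /\ iter `|l|%N V1a (iter `|k|%N V2 x) = 0] in
         given_by_diagram Ht V1 V2 J /\
         orthogonal_bigsum J (fun ij => vpow H00 V1 V2 ij @` K) Ht)].
Proof.
pose H := field_space P X; pose up := unitary_action H U1 U2.
pose x0 := L2_class P (X (0, 0)); have cE := @L2_complete R _ _ P.
have cH : closed_subspace H by exact: clspan_subspace.
have up_iso u : isometry_on H (up u) by exact: unitary_action_isometry.
have up0 x : H x -> up 0 x = x by [].
have upD u v x : H x -> up (u + v) x = up u (up v x) by exact: unitary_actionD.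
have upX u v : up u (L2_class P (X v)) = L2_class P (X (v - u)).
  exact: unitary_action_class.
have Hx0 : H x0 by exact: field_space_class.
have V1E x : H x -> V1 x = up (1, 0) x by [].
have V2E x : H x -> V2 x = up (0, 1) x by [].
have [k0 l0] : k <= 0 /\ l < 0.
  by move: Sv1 Sv2; rewrite /Sv /halfplane_past /=; clear; lia.
pose g := gcdz k l.
have g0 : 0 < g.
  by rewrite lt0r gcdz_eq0 (lt_eqF l0) andbF.
pose a := - (k %/ g)%Z; pose b := - (l %/ g)%Z.
have ka : k = - (g * a) by rewrite mulrN opprK mulrC divzK// dvdz_gcdl.
have lb : l = - (g * b) by rewrite mulrN opprK mulrC divzK// dvdz_gcdr.
have a0 : 0 <= a by rewrite -(pmulr_rge0 _ g0) -oppr_le0 -ka.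
have b0 : 0 < b by rewrite -(pmulr_rgt0 _ g0) -oppr_lt0 -lb.
(* The Bezout relation for [k] and [l], divided by their gcd; the signs come from those in [a] and
   [b]. *)
have [p [q pq]] : exists p q, a * p + b * q = 1.
  have [u [v uv]] := Bezoutz k l; exists (- u), (- v).
  apply: (mulfI (x := g)); first by rewrite gt_eqF.
  by rewrite mulr1 -[RHS]uv {1}ka {1}lb; ring.
have TE : opp_set Sv = upper_half a b by exact: halfplane_past_upper g0 ka lb.
have GE : H00 = half_space up x0 a b.
  rewrite /half_space -TE; congr clspan; apply/seteqP; split=> _ [v Sv_v <-].
    exists (- v); last by rewrite upX sub0r opprK.
    by rewrite /opp_set /= opprK -[v]subr0.
  by exists (- v); rewrite ?upX ?sub0r//= subr0.
have nodet x : (forall v, exists2 y, half_space up x0 a b y & x = up v y) -> x = 0.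
  move=> Hx; have : (\bigcap_ij past_space P X Sv ij) x; last by rewrite X_nodet.
  (* As [up] shifts indices backwards, [up (- v)] carries [H00] into the past space at [v]. *)
  move=> v _; have [y] := Hx (- v); rewrite -GE => Gy ->.
  suff : H00 `<=` [set x | H x /\ past_space P X Sv v (up (- v) x)].
    by move=> /(_ _ Gy)[].
  apply: clspan_min; first exact/(preimage_up cH up_iso)/clspan_subspace.
  move=> _ [u Su <-]; split; first exact: field_space_class.
  rewrite upX opprK; apply: sub_clspan; exists (u + v) => //=.
  by rewrite addrK; move: Su; rewrite /= subr0.
have g1 : coprimez k l -> g = 1 by move=> /eqP.
clearbody a b g x0 up.
exists (regular_part up x0 a b), (evanescent_part up x0 a b).
rewrite /V1a /V2a TE GE; split.
- exact (wold_sum cE cH up_iso up0 upD Hx0 b0 pq).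
- have rG := half_space_reducing cE up x0 a b.
  split.
    apply/(reducing_reduces cE cH up_iso up0 upD Hx0 a0 b0 V1E V2E rG).
      exact (regular_sub cH up_iso up0 upD Hx0).
    exact (regular_reducing cE cH up_iso up0 upD Hx0 b0 pq).
  apply/(reducing_reduces cE cH up_iso up0 upD Hx0 a0 b0 V1E V2E rG).
    exact: evanescent_sub.
  exact (evanescent_reducing cE cH up_iso up0 upD Hx0 b0 pq).
- exact (regular_totally_non_unitary cE cH up_iso up0 upD Hx0 a0 b0 pq V1E V2E).
- exact (evanescent_cyclic_powers cE cH up_iso up0 upD Hx0 a0 b0 pq nodet V1E V2E).
move=> k_lt0 _ kl p' q' pq1 _ p0 q0 _.
have aE : a = - k by rewrite ka (g1 kl) mul1r opprK.
have bE : b = - l by rewrite lb (g1 kl) mul1r opprK.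
(* [E0] depends on the choice of [f]. The given Bezout pair now replaces the one chosen above, and
   the preceding lemmas apply to it. *)
have {}pq : a * p' + b * q' = 1 by rewrite aE bE; move: pq1; clear; lra.
have nk : `|k|%N%:Z = a by rewrite aE; move: k0; clear; lia.
have nl : `|l|%N%:Z = b by rewrite bE; move: l0; clear; lia.
have np : `|p'|%N%:Z = p' by move: p0; clear; lia.
have nq : `|q'|%N%:Z = - q' by move: q0; clear; lia.
have J00 : column a b (0, 0).
  by split; [exact: b0|rewrite [height _ _ _]height0].
(* The origin is the only point of the column outside the cone, being its only point of height 0. *)
have J0E : [set u | upper_half a b u /\ 0 <= u.1 <= - l - 1] `|` [set (0, 0)] = column a b.
  rewrite -bE; apply/seteqP; split=> [u [[Tu /andP[u0 ub]]|->]|u [/andP[u0 ub] hu]].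
  - by split; [rewrite u0 -ltzD1 subrK in ub *|case: Tu => [/ltW//|[->]]].
  - exact: J00.
  have [h0|h0] := eqVneq (height a b u) 0; last first.
    left; split; first by left; rewrite lt0r h0.
    by rewrite u0 -ltzD1 subrK.
  have [u1|u1] := eqVneq u.1 0; last first.
    left; split; first by right; rewrite lt0r u1.
    by rewrite u0 -ltzD1 subrK.
  right; apply: (column_inj b0 pq _ J00); first by split=> //; rewrite u0.
  by rewrite h0 [RHS]height0.
have JE : upper_half a b `|` [set (0, 0)] = upper_half0 a b by [].
(* Since [q' <= 0], the exponents of the adjoint of [V1] and of [V2] are the coordinates of [- f],
   and the kernel is that of the compression of [up (- f)]. *)
have HHE : [set x | iter `|p'| (adjoint (half_space up x0 a b) V1) (iter `|q'| V2 x) = 0]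
    `&` evanescent_part up x0 a b = evanescent_wandering up x0 a b p' q'.
  apply/seteqP; split=> x [] /=.
    move=> + Hx; rewrite (iter_adjoint_V1V2 cE cH up_iso up0 upD Hx0 a0 b0 V1E V2E);
      last exact: evanescent_sub Hx.
    by rewrite np nq.
  move=> + Hx; split=> //=.
  rewrite (iter_adjoint_V1V2 cE cH up_iso up0 upD Hx0 a0 b0 V1E V2E);
    last exact: evanescent_sub Hx.
  by rewrite np nq.
have KE : [set x | half_space up x0 a b x /\
    iter `|l| (adjoint (half_space up x0 a b) V1) (iter `|k| V2 x) = 0] = wandering up x0 a b.
  apply/seteqP; split=> x [Gx] /=;
    rewrite (iter_adjoint_V1V2 cE cH up_iso up0 upD Hx0 a0 b0 V1E V2E)// nl nk.
    by rewrite -[X in (- b, X)]opprK.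
  by rewrite -[X in (- b, X)]opprK => Hx; split.
split.
  rewrite J0E HHE -aE -bE; set U := fun x => _.
  (* [U] is the compression of [up e]; as [e] is in the cone, [up e] preserves [G] and the
     projection does nothing. *)
  have UE x : evanescent_part up x0 a b x -> U x = up (b, - a) x.
    move=> Hx; rewrite /U (iter_adjoint_V2V1 cE cH up_iso up0 upD Hx0 a0 b0 V1E V2E) ?nl ?nk;
      last exact: evanescent_sub Hx.
    rewrite (proj_id cE); first by [].
      exact: half_space_subspace.
    apply: (up_half cH up_iso up0 upD Hx0); first by left; exact: upper_half_e.
    exact: evanescent_sub Hx.
  split.
  - exact (evanescent_powers cE cH up_iso up0 upD Hx0 a0 b0 pq nodet V1E V2E UE).
  - have [w [Ew Hw]] := evanescent_cyclic cE cH up_iso up0 upD Hx0 b0 pq.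
    by exists w; apply/(cyclic_vectorE cE cH up_iso up0 upD Hx0 b0 pq UE).
  - exact (evanescent_bigsum cE cH up_iso up0 upD Hx0 a0 b0 pq nodet V1E V2E UE).
rewrite JE KE; split.
  exact (regular_diagram cE cH up_iso up0 upD Hx0 a0 b0 pq V1E V2E).
exact (regular_bigsum cE cH up_iso up0 upD Hx0 a0 b0 pq V1E V2E).
Qed.
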